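(* There exist constants $k_0>1$ and $C>0$, independent of $N$, $\varepsilon$ and $\boldsymbol x^*$, such that for every $k\ge k_0$ the following holds. Let $\sigma_\beta,\sigma_\eta>0$ satisfy all of the following: $$\sigma_\beta\ge k(\varepsilon+\delta_M),\qquad \sigma_\eta\ge k\,\hat\varepsilon_M^{1/2},$$ $$\sigma_\beta\ge kN^{-1},\qquad \sigma_\eta\ge kN^{-3/4},\qquad \sigma_\eta\ge\sigma_\eta^*:=\begin{cases}kN^{-1/2}&\text{if }\hat\varepsilon_s\le N^{-2},\\ k\hat\varepsilon_s^{-1/2}N^{-3/2}&\text{if }\hat\varepsilon_s\ge N^{-2},\end{cases}$$ $$\sigma_\beta\ge kN^{-1}\ln N,\qquad \sigma_\eta\ge kN^{-1}\ln N,\qquad \sigma_\eta\ge k\varepsilon^{1/4}N^{-1/2}\ln^{1/2}N ,$$ where $\delta_M:=\max_{\boldsymbol x\in\Omega}\delta$ and $\hat\varepsilon_M:=\max_{\boldsymbol x\in\Omega}\hat\varepsilon$. Then for every mesh node $\boldsymbol x^*\in\Omega\setminus\Omega_{xy}$, with $\omega$ the weight function and $G$ the discrete Green's function associated with $\boldsymbol x^*$, $$\|G\|_{MSD}\le\sqrt8\,|||G|||_\omega\le\begin{cases}CN\sigma_\beta^{1/2}&\text{if }\boldsymbol x^*\in\Omega_s,\\ CN^{1/2}\ln^{1/2}N&\text{if }\boldsymbol x^*\in\Omega_x\cup\Omega_y.\end{cases}$$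
   Context: Setting. $\Omega=(0,1)^2$; $\boldsymbol b=(b_1,b_2)^T$ is a constant vector with $b_1,b_2>0$; $c>0$ is a constant; $0<\varepsilon\ll|\boldsymbol b|$ is a small parameter; $N$ is an even positive integer. Constants called independent of $N$ and $\varepsilon$ may depend on $\boldsymbol b,c,\beta_1,\beta_2,C^*$ (introduced here and below), but not on $N,\varepsilon$ or the node $\boldsymbol x^*$. Shishkin mesh. $\beta_1,\beta_2>0$ are fixed constants, $\rho=2.5$, $\lambda_x=\min\{1/2,\rho\varepsilon\beta_1^{-1}\ln N\}$, $\lambda_y=\min\{1/2,\rho\varepsilon\beta_2^{-1}\ln N\}$. It is assumed throughout that $\varepsilon\le N^{-1}$, $\lambda_x=\rho\varepsilon\beta_1^{-1}\ln N$ and $\lambda_y=\rho\varepsilon\beta_2^{-1}\ln N$. Put $\Omega_s=[0,1-\lambda_x]\times[0,1-\lambda_y]$, $\Omega_x=[1-\lambda_x,1]\times[0,1-\lambda_y]$, $\Omega_y=[0,1-\lambda_x]\times[1-\lambda_y,1]$, $\Omega_{xy}=[1-\lambda_x,1]\times[1-\lambda_y,1]$. Mesh points $(x_i,y_j)$, $0\le i,j\le N$: $x_i=2i(1-\lambda_x)/N$ for $i\le N/2$ and $x_i=1-2(N-i)\lambda_x/N$ for $i>N/2$; $y_j$ is defined likewise with $\lambda_y$. Each rectangle $[x_i,x_{i+1}]\times[y_j,y_{j+1}]$ is split into two triangles by the diagonal from $(x_i,y_{j+1})$ to $(x_{i+1},y_j)$; $\mathcal T_N$ is the resulting triangulation.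 $V^N$ is the space of $v\in C(\bar\Omega)$ with $v|_{\partial\Omega}=0$ and $v|_K\in P_1(K)$ for all $K\in\mathcal T_N$. Parameters. $\delta=C^*N^{-1}$ on $\Omega_s$ and $\delta=0$ elsewhere; $\delta_K:=\delta|_K$ (so $\delta_K=C^*N^{-1}$ if $K\subset\Omega_s$ and $\delta_K=0$ otherwise). $C^*>0$ is a fixed constant independent of $\varepsilon,N$, small enough for the standard SDFEM coercivity condition $c\,\delta_K\le 1/2$. The function $\hat\varepsilon$ is either (1) $\hat\varepsilon=\varepsilon$ on $\Omega$, or (2) $\hat\varepsilon=\max(\varepsilon,N^{-3/2})$ on $\Omega_s$ and $\hat\varepsilon=\varepsilon$ on $\Omega\setminus\Omega_s$. Write $\hat\varepsilon_s:=\hat\varepsilon|_{\Omega_s}$. Notation. $b=\sqrt{b_1^2+b_2^2}$, $\boldsymbol\beta=(b_1,b_2)^T/b$, $\boldsymbol\eta=(-b_2,b_1)^T/b$, $v_\beta=\boldsymbol\beta^T\nabla v$, $v_\eta=\boldsymbol\eta^T\nabla v$. $(\cdot,\cdot)$, $\|\cdot\|$ are the $L^2(\Omega)$ inner product and norm; a subscript $K$ or $D$ means over that set. Piecewise constant coefficients $\hat\varepsilon,\delta$ in front of inner products or norms are understood inside the integrals. Bilinear form and energy norm (for continuous functions that are smooth on each triangle and vanish on $\partial\Omega$): $$a_{MSD}(u,v)=\varepsilon(u_\beta,v_\beta)+\hat\varepsilon(u_\eta,v_\eta)+(bu_\beta+cu,v)+\sum_{K\in\mathcal T_N}(bu_\beta+cu,\delta_K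 b v_\beta)_K ,$$ $$\|v\|_{MSD}^2=\varepsilon\|v_\beta\|^2+\hat\varepsilon\|v_\eta\|^2+c\|v\|^2+\sum_{K}\delta_K\|bv_\beta\|_K^2 .$$ Discrete Green's function. For a mesh node $\boldsymbol x^*\in\Omega$, $G\in V^N$ is defined by $a_{MSD}(v,G)=v(\boldsymbol x^* )$ for all $v\in V^N$. Weight. For $\sigma_\beta,\sigma_\eta>0$ and $g(r)=2/(1+e^r)$, $$\omega(\boldsymbol x)=g\Big(\tfrac{(\boldsymbol x-\boldsymbol x^* )\cdot\boldsymbol\beta}{\sigma_\beta}\Big)g\Big(\tfrac{(\boldsymbol x-\boldsymbol x^* )\cdot\boldsymbol\eta}{\sigma_\eta}\Big)g\Big(-\tfrac{(\boldsymbol x-\boldsymbol x^* )\cdot\boldsymbol\eta}{\sigma_\eta}\Big).$$ Here $(\omega^{-1})_\beta>0$, and the weighted energy norm is $$|||G|||_\omega^2=\varepsilon\|\omega^{-1/2}G_\beta\|^2+\hat\varepsilon\|\omega^{-1/2}G_\eta\|^2+\tfrac b2\|(\omega^{-1})_\beta^{1/2}G\|^2+c\|\omega^{-1/2}G\|^2+\sum_{K}b^2\delta_K\|\omega^{-1/2}G_\beta\|_K^2 .$$ *)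

(* Defs.v *)
From HB Require Import structures.
From mathcomp Require Import all_boot all_order all_algebra.
From mathcomp Require Import all_classical all_reals all_analysis.
Set Implicit Arguments.
Unset Strict Implicit.
Unset Printing Implicit Defensive.
Import Order.TTheory GRing.Theory Num.Theory.
Import numFieldNormedType.Exports.
Local Open Scope classical_set_scope.
Local Open Scope ring_scope.

(* The data on which "constants independent of N and eps" may depend.
   mesh_beta1 and mesh_beta2 are the constants in the transition points of the
   Shishkin mesh; they are unrelated to the unit vector [beta_dir]. *)
Record data (R : realType) := Data {
  b1 : R; b2 : R;
  c : R;
  mesh_beta1 : R; mesh_beta2 : R;
  Cstar : R
}.

Definition data_pos (R : realType) (P : data R) : Prop :=
  [/\ 0 < b1 P, 0 < b2 P & 0 < c P] /\
  [/\ 0 < mesh_beta1 P, 0 < mesh_beta2 P & 0 < Cstar P].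

Section Plane.
Context {R : realType}.
Implicit Types (f g v : R * R -> R) (d x y : R * R) (D : set (R * R)).

Definition dot x y : R := x.1 * y.1 + x.2 * y.2.

(* The partial derivatives are the total ['D_v] of the library.  For a
   continuous piecewise affine v they are the classical ones in the interior of
   every triangle, i.e., off a null set of the domain. *)
Definition grad v x : R * R := ('D_(1, 0) v x, 'D_(0, 1) v x).

Definition ddir d v x : R := dot d (grad v x).

Definition L2dot D f g : R :=
  \int[(@lebesgue_measure R \x @lebesgue_measure R)%E]_(x in D) (f x * g x).

Definition L2norm D f : R := Num.sqrt (L2dot D f f).

Definition Omega : set (R * R) := `]0, 1[%classic `*` `]0, 1[%classic.
Definition Omegabar : set (R * R) := `[0, 1]%classic `*` `[0, 1]%classic.

End Plane.

Section ShishkinMesh.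
Context {R : realType}.
Variables (P : data R) (N : nat) (eps : R).

Definition rho : R := 5 / 2.

Definition transition (mb : R) : R :=
  Num.min (1 / 2) (rho * eps * mb^-1 * ln N%:R).

Definition lambda_x : R := transition (mesh_beta1 P).
Definition lambda_y : R := transition (mesh_beta2 P).

Definition Omega_s : set (R * R) :=
  `[0, 1 - lambda_x]%classic `*` `[0, 1 - lambda_y]%classic.
Definition Omega_x : set (R * R) :=
  `[1 - lambda_x, 1]%classic `*` `[0, 1 - lambda_y]%classic.
Definition Omega_y : set (R * R) :=
  `[0, 1 - lambda_x]%classic `*` `[1 - lambda_y, 1]%classic.
Definition Omega_xy : set (R * R) :=
  `[1 - lambda_x, 1]%classic `*` `[1 - lambda_y, 1]%classic.

Definition mesh_point (lambda : R) (i : nat) : R :=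
  if (i <= N./2)%N then 2 * i%:R * (1 - lambda) / N%:R
  else 1 - 2 * (N%:R - i%:R) * lambda / N%:R.

Definition mesh_x (i : nat) : R := mesh_point lambda_x i.
Definition mesh_y (j : nat) : R := mesh_point lambda_y j.

Definition is_node (x : R * R) : Prop :=
  exists i j : 'I_N.+1, x = (mesh_x i, mesh_y j).

(* (i, j, false) and (i, j, true) index the closed triangles lying below and
   above the diagonal from (x_i, y_{j+1}) to (x_{i+1}, y_j) of the (i, j) cell *)
Definition tri_index : finType := ('I_N * 'I_N * bool)%type.

Definition triangle (K : tri_index) : set (R * R) :=
  let: (i, j, above) := K in
  let xi := mesh_x i in let xi1 := mesh_x i.+1 in
  let yj := mesh_y j in let yj1 := mesh_y j.+1 in
  if above then
    [set x | [/\ x.1 <= xi1, x.2 <= yj1 &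
      1 <= (x.1 - xi) / (xi1 - xi) + (x.2 - yj) / (yj1 - yj)]]
  else
    [set x | [/\ xi <= x.1, yj <= x.2 &
      (x.1 - xi) / (xi1 - xi) + (x.2 - yj) / (yj1 - yj) <= 1]].

Definition P1_on (D : set (R * R)) (v : R * R -> R) : Prop :=
  exists p0 p1 p2 : R, forall x, D x -> v x = p0 + p1 * x.1 + p2 * x.2.

(* Only the restriction of v to the closed unit square is meaningful. *)
Definition in_VN (v : R * R -> R) : Prop :=
  [/\ {within Omegabar, continuous v},
      forall x, (Omegabar `\` Omega) x -> v x = 0 &
      forall K, P1_on (triangle K) v].

End ShishkinMesh.

Section Method.
Context {R : realType}.
Variables (P : data R) (N : nat) (eps : R).
(* [modified] selects between the two admissible choices of epsilon-hat:
   [false] is eps everywhere, [true] is max(eps, N^(-3/2)) on Omega_s. *)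
Variable modified : bool.

Definition bnorm : R := Num.sqrt (b1 P ^+ 2 + b2 P ^+ 2).
Definition beta_dir : R * R := (b1 P / bnorm, b2 P / bnorm).
Definition eta_dir : R * R := (- b2 P / bnorm, b1 P / bnorm).

Local Notation D_beta := (ddir beta_dir).
Local Notation D_eta := (ddir eta_dir).

Definition delta (x : R * R) : R :=
  if x \in Omega_s P N eps then Cstar P * N%:R^-1 else 0.

Definition delta_K (K : tri_index N) : R :=
  if `[< triangle P eps K `<=` Omega_s P N eps >] then Cstar P * N%:R^-1
  else 0.

Definition epshat_s : R :=
  if modified then Num.max eps (N%:R `^ (- (3 / 2))) else eps.

Definition epshat (x : R * R) : R :=
  if x \in Omega_s P N eps then epshat_s else eps.

Definition delta_M : R := sup (delta @` Omega).
Definition epshat_M : R := sup (epshat @` Omega).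

Definition a_MSD (u v : R * R -> R) : R :=
  eps * L2dot Omega (D_beta u) (D_beta v)
  + L2dot Omega (fun x => epshat x * D_eta u x) (D_eta v)
  + L2dot Omega (fun x => bnorm * D_beta u x + c P * u x) v
  + \sum_(K : tri_index N)
      L2dot (triangle P eps K) (fun x => bnorm * D_beta u x + c P * u x)
                               (fun x => delta_K K * bnorm * D_beta v x).

Definition norm_MSD (v : R * R -> R) : R :=
  Num.sqrt (
    eps * L2norm Omega (D_beta v) ^+ 2
    + L2norm Omega (fun x => Num.sqrt (epshat x) * D_eta v x) ^+ 2
    + c P * L2norm Omega v ^+ 2
    + \sum_(K : tri_index N)
        delta_K K * L2norm (triangle P eps K) (fun x => bnorm * D_beta v x) ^+ 2).

Definition is_green (xstar : R * R) (G : R * R -> R) : Prop :=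
  in_VN P N eps G /\
  forall v, in_VN P N eps v -> a_MSD v G = v xstar.

Definition g (r : R) : R := 2 / (1 + expR r).

Definition omega (sigma_beta sigma_eta : R) (xstar x : R * R) : R :=
  g (dot (x - xstar) beta_dir / sigma_beta)
  * g (dot (x - xstar) eta_dir / sigma_eta)
  * g (- (dot (x - xstar) eta_dir / sigma_eta)).

(* [w] is the weight; the argument of the square root below is positive for
   [w := omega sigma_beta sigma_eta xstar]. *)
Definition norm_weighted (w : R * R -> R) (v : R * R -> R) : R :=
  let w_mhalf x := (Num.sqrt (w x))^-1 in
  let w_inv x := (w x)^-1 in
  Num.sqrt (
    eps * L2norm Omega (fun x => w_mhalf x * D_beta v x) ^+ 2
    + L2norm Omega (fun x => Num.sqrt (epshat x) * (w_mhalf x * D_eta v x)) ^+ 2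
    + bnorm / 2 * L2norm Omega (fun x => Num.sqrt (D_beta w_inv x) * v x) ^+ 2
    + c P * L2norm Omega (fun x => w_mhalf x * v x) ^+ 2
    + \sum_(K : tri_index N)
        bnorm ^+ 2 * delta_K K *
        L2norm (triangle P eps K) (fun x => w_mhalf x * D_beta v x) ^+ 2).

Definition sigma_eta_star (k : R) : R :=
  if epshat_s <= N%:R ^- 2 then k * N%:R `^ (- (1 / 2))
  else k * epshat_s `^ (- (1 / 2)) * N%:R `^ (- (3 / 2)).

End Method.

(* Main.v *)
Require Import Defs.
From HB Require Import structures.
From mathcomp Require Import all_boot all_order all_algebra.
From mathcomp Require Import all_classical all_reals all_analysis.
From mathcomp Require Import measurable_realfun ring lra zify.
Set Implicit Arguments.
Unset Strict Implicit.
Unset Printing Implicit Defensive.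
Import Order.TTheory GRing.Theory Num.Theory.
Import numFieldNormedType.Exports.
Local Open Scope classical_set_scope.
Local Open Scope ring_scope.

(** The estimate is a weighted energy argument.  Let Theta be the inverse of the
    weight omega.  It grows along the flow, its derivative Theta_beta is
    positive and at most Theta / sigma_beta, and the lower bounds on sigma_beta
    and sigma_eta make it vary by at most a factor 2 over a mesh cell.

    If Theta G could be used as a trial function, coercivity would give at once
    W^2 / 4 <= a_MSD(Theta G, G): the convection term becomes
    (b/2) (Theta_beta G, G) after an integration by parts, and the remaining
    cross terms are absorbed because sigma_beta and sigma_eta are large
    ([coercive_pointwise]).  Theta G is not in V^N, but its nodal interpolant I
    is, and a_MSD(I, G) = I(xstar) = G(xstar) because Theta(xstar) = 1.  Hence
    W^2 / 4 <= G(xstar) + (a functional of the interpolation error Theta G - I),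
    which is [energy_identity] with [coercive_sum].

    The error functional is at most W^2 / 8 once k is large.  On the cells of
    Omega_s, which are isotropic of size 1/N, the second order remainder of
    Theta G at a point involves no second derivative of G; together with an
    inverse estimate it leaves a factor k^(-1/2) in front of the local energy
    ([coarse_scalar_bound], [energy_err_coarse]).  In the layers an inverse
    estimate would cost the fine mesh size.  There a first order bound is used,
    with relative size 1 / (N sigma) <= 1 / (k ln N); it leaves, besides the
    local energy, the term Theta G^2 / (eps ln^2 N) ([energy_err_layer]).
    Since G vanishes on the outflow boundary and the layers have width
    O(eps ln N), a discrete Poincare inequality along the rows and columns of
    the mesh bounds this term by the weighted gradient ([layer_poincare]).

    So W^2 <= 8 G(xstar) ([weighted_energy_le]), and it remains to bound the point
    value by W.  For xstar in Omega_s one triangle with corner xstar suffices, by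
    Theta_beta(xstar) = 1 / (2 sigma_beta): G(xstar)^2 <= C N^2 sigma_beta W^2
    ([node_coarse_bound]).  For xstar in a layer, summing the differences of G up
    to the outflow boundary gives G(xstar)^2 <= C N ln N W^2 ([node_x_bound],
    [node_y_bound]).  Division by W yields both bounds ([quadratic_bound]).

    All integrals are reduced to sums over the open triangles, on which every
    integrand is an explicit formula, so that the values of derivatives on the
    edges do not matter.  The integration by parts is done line by
    line: Fubini, the fundamental theorem of calculus on each triangle, and a
    telescoping sum over the cells of a row ([sum_integral2_derive_x]). *)

(** * Integrals of bounded functions over plane sets *)

Section NullSets.
Context d (T : measurableType d) (R : realType).
Variable mu : {measure set T -> \bar R}.
Import HBNNSimple.
Local Open Scope ereal_scope.

(** No measurability of the integrands is required, so the lemma applies to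
    expressions built from the total derivative, which are known only off the
    skeleton of the mesh. The price is to argue on the simple functions below
    the integrand. *)
Lemma ge0_integral_eq_off_null (N : set T) (f h : T -> \bar R) :
  measurable N -> mu N = 0 ->
  (forall x, 0 <= f x) -> (forall x, 0 <= h x) ->
  (forall x, ~ N x -> f x = h x) -> \int[mu]_x f x = \int[mu]_x h x.
Proof.
move=> mN N0; wlog suff le : f h / (forall x, 0 <= f x) -> (forall x, 0 <= h x) ->
    (forall x, ~ N x -> f x = h x) -> \int[mu]_x f x <= \int[mu]_x h x.
  move=> f0 h0 fh; apply/eqP; rewrite eq_le !le// => x Nx.
  by rewrite fh.
move=> f0 h0 fh.
rewrite !ge0_integralTE//; apply: ge_ereal_sup => _ [g /= gf <-].
(* a simple function below f, cut off on N, is below h *)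
have sgE : sintegral mu g = sintegral mu (g \_ (~` N)).
  rewrite -[in RHS](@integral_nnsfun _ _ _ mu _ (measurableC mN) g).
  rewrite -[X in X = _](_ : \int[mu]_x (g x)%:E = _); last first.
    by rewrite integral_nnsfun// patch_setT.
  rewrite (ge0_negligible_integral mN)// ?setTD//.
    exact/measurable_EFinP/measurable_funP.
  by move=> x _; rewrite lee_fin.
rewrite sgE (mrestrict g (measurableC mN)).
apply: ereal_sup_ubound => /=.
exists (proj_nnsfun g (measurableC mN)) => //= x.
rewrite /= /mindic /= indicE; case: (boolP (x \in ~` N)) => xN.
  by rewrite mulr1 -fh//; apply: set_mem.
by rewrite mulr0.
Qed.

Lemma integral_eq_off_null (D N : set T) (f h : T -> \bar R) :
  measurable N -> mu N = 0 ->
  (forall x, D x -> ~ N x -> f x = h x) ->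
  \int[mu]_(x in D) f x = \int[mu]_(x in D) h x.
Proof.
move=> mN N0 fh; rewrite integral_mkcond [RHS]integral_mkcond.
have e x : ~ N x -> (f \_ D) x = (h \_ D) x.
  by move=> Nx; rewrite !patchE; case: ifPn => // /set_mem Dx; exact: fh.
rewrite integralE [RHS]integralE; congr (_ - _);
  apply: (ge0_integral_eq_off_null mN N0) => // x Nx.
  by rewrite !funeposE e.
by rewrite !funenegE e.
Qed.

Lemma Rintegral_eq_off_null (D N : set T) (f h : T -> R) :
  measurable N -> mu N = 0 ->
  (forall x, D x -> ~ N x -> f x = h x) ->
  (\int[mu]_(x in D) f x = \int[mu]_(x in D) h x)%R.
Proof.
move=> mN N0 fh; rewrite /Rintegral (@integral_eq_off_null D N (EFin \o f) (EFin \o h))//.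
by move=> x Dx Nx /=; rewrite fh.
Qed.
End NullSets.

Section PlaneIntegral.
Context {R : realType}.
Local Notation mu := (@lebesgue_measure R).
Local Notation mu2 := (@lebesgue_measure R \x @lebesgue_measure R)%E.
Implicit Types (f g : R * R -> R) (D Z : set (R * R)).

(** The class is closed under sums and products and contains everything that is
    integrated below; its members are integrable on every measurable subset of
    the unit square. *)
Definition bmeasurable f := measurable_fun setT f /\
  exists M, forall p, Omegabar p -> `|f p| <= M.

Lemma bmeasurable_cst (a : R) : bmeasurable (fun=> a).
Proof. by split; [exact: measurable_cst | exists `|a|]. Qed.

Lemma bmeasurable_fst : bmeasurable (fun p => p.1).
Proof.
split; first exact: measurable_fst.
by exists 1 => -[x y] [/= ]; rewrite !in_itv /= => /andP[x0 x1] _; rewrite ger0_norm.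
Qed.

Lemma bmeasurable_snd : bmeasurable (fun p => p.2).
Proof.
split; first exact: measurable_snd.
by exists 1 => -[x y] [/= _]; rewrite !in_itv /= => /andP[x0 x1]; rewrite ger0_norm.
Qed.

Lemma bmeasurableD f g : bmeasurable f -> bmeasurable g -> bmeasurable (fun p => f p + g p).
Proof.
move=> [mf [M Mf]] [mg [M' Mg]]; split; first exact: measurable_funD.
exists (M + M') => p Op; apply: (le_trans (ler_normD _ _)).
by rewrite lerD ?Mf ?Mg.
Qed.

Lemma bmeasurableM f g : bmeasurable f -> bmeasurable g -> bmeasurable (fun p => f p * g p).
Proof.
move=> [mf [M Mf]] [mg [M' Mg]]; split; first exact: measurable_funM.
by exists (M * M') => p Op; rewrite normrM ler_pM ?Mf ?Mg.
Qed.

Lemma bmeasurableN f : bmeasurable f -> bmeasurable (fun p => - f p).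
Proof.
move=> [mf [M Mf]]; split; first exact: measurableT_comp.
by exists M => p Op; rewrite normrN Mf.
Qed.

Lemma bmeasurableB f g : bmeasurable f -> bmeasurable g -> bmeasurable (fun p => f p - g p).
Proof. by move=> nf ng; apply: bmeasurableD => //; exact: bmeasurableN. Qed.

Lemma bmeasurableX f n : bmeasurable f -> bmeasurable (fun p => f p ^+ n).
Proof.
move=> nf; elim: n => [|n ih]; first by under eq_fun do rewrite expr0; exact: bmeasurable_cst.
by under eq_fun do rewrite exprS; exact: bmeasurableM.
Qed.

Lemma bmeasurable_sum (I : Type) (s : seq I) (F : I -> R * R -> R) :
  (forall i, bmeasurable (F i)) -> bmeasurable (fun p => \sum_(i <- s) F i p).
Proof.
move=> nF; elim: s => [|i s ih].
  by under eq_fun do rewrite big_nil; exact: bmeasurable_cst.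
by under eq_fun do rewrite big_cons; exact: bmeasurableD.
Qed.

Lemma bmeasurable_indic D : measurable D -> bmeasurable (\1_D).
Proof.
move=> mD; split; first exact: measurable_indic.
exists 1 => p _; rewrite indicE; case: (p \in D); by rewrite ?normr1 ?normr0.
Qed.

Lemma measurable_gt0_set f : measurable_fun setT f -> measurable [set p | 0 < f p].
Proof.
move=> mf; rewrite (_ : [set _ | _] = setT `&` f @^-1` `]0, +oo[%classic).
  exact: mf.
by apply/seteqP; split => p /=; rewrite in_itv /= andbT => // -[].
Qed.

Lemma measurable_ge0_set f : measurable_fun setT f -> measurable [set p | 0 <= f p].
Proof.
move=> mf; rewrite (_ : [set _ | _] = setT `&` f @^-1` `[0, +oo[%classic).
  exact: mf.
by apply/seteqP; split => p /=; rewrite in_itv /= andbT => // -[].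
Qed.

Lemma mu_itv_oo (a b : R) : a <= b -> mu `]a, b[%classic = (b - a)%:E.
Proof.
rewrite lebesgue_measure_itv /= lte_fin.
by rewrite le_eqVlt => /orP[/eqP ->|ab]; rewrite ?ltxx ?subrr ?ab ?EFinB.
Qed.

Lemma mu2_rect (a b c d : R) : a <= b -> c <= d ->
  mu2 (`]a, b[%classic `*` `]c, d[%classic) = ((b - a) * (d - c))%:E.
Proof.
move=> ab cd; rewrite product_measure1E; [|exact: measurable_itv..].
by rewrite EFinM -(mu_itv_oo ab) -(mu_itv_oo cd).
Qed.

Lemma Omega_sub_Omegabar : (@Omega R) `<=` Omegabar.
Proof. by move=> p [p1 p2]; split; apply: subset_itv_oo_cc. Qed.

Lemma measurable_Omega : measurable (@Omega R).
Proof. by apply: measurableX; exact: measurable_itv. Qed.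

Lemma measurable_Omegabar : measurable (@Omegabar R).
Proof. by apply: measurableX; exact: measurable_itv. Qed.

Lemma mu2_Omegabar : mu2 (@Omegabar R) = 1%E.
Proof.
have E : mu `[0 : R, 1]%classic = 1%E.
  by rewrite lebesgue_measure_itv /= lte_fin ltr01 sube0.
rewrite product_measure1E; [|exact: measurable_itv..].
by rewrite -[RHS]mul1e -{1}E -{1}E.
Qed.

Lemma bmeasurable_integrable D f : measurable D -> D `<=` Omegabar -> bmeasurable f ->
  mu2.-integrable D (EFin \o f).
Proof.
move=> mD DO [mf [M Mf]]; apply: measurable_bounded_integrable => //.
- rewrite (@le_lt_trans _ _ (mu2 Omegabar))//.
    by apply: le_measure; rewrite ?inE//; exact: measurable_Omegabar.
  by rewrite [X in (X < _)%E]mu2_Omegabar ltry.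
- exact: measurable_funTS.
- exists M; split; first exact: num_real.
  by move=> B MB p Dp /=; apply: le_trans (ltW MB); apply: Mf; exact: DO.
Qed.

Definition integral2 D f : R := \int[mu2]_(p in D) f p.

Section OnD.
Variable D : set (R * R).
Hypotheses (mD : measurable D) (DO : D `<=` Omegabar).

Lemma integral2D f g : bmeasurable f -> bmeasurable g -> integral2 D (fun p => f p + g p) = integral2 D f + integral2 D g.
Proof. by move=> nf ng; rewrite /integral2 RintegralD//; exact: bmeasurable_integrable. Qed.

Lemma integral2B f g : bmeasurable f -> bmeasurable g -> integral2 D (fun p => f p - g p) = integral2 D f - integral2 D g.
Proof. by move=> nf ng; rewrite /integral2 RintegralB//; exact: bmeasurable_integrable. Qed.

Lemma integral2Z f (a : R) : bmeasurable f -> integral2 D (fun p => a * f p) = a * integral2 D f.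
Proof. by move=> nf; rewrite /integral2 RintegralZl//; exact: bmeasurable_integrable. Qed.

Lemma integral2_le f g : bmeasurable f -> bmeasurable g -> (forall p, D p -> f p <= g p) -> integral2 D f <= integral2 D g.
Proof. by move=> nf ng fg; apply: le_Rintegral => //; exact: bmeasurable_integrable. Qed.

Lemma integral2_ge0 f : (forall p, D p -> 0 <= f p) -> 0 <= integral2 D f.
Proof. by move=> f0; rewrite /integral2; apply: Rintegral_ge0. Qed.

Lemma integral2_sum (I : Type) (s : seq I) (F : I -> R * R -> R) :
  (forall i, bmeasurable (F i)) ->
  integral2 D (fun p => \sum_(i <- s) F i p) = \sum_(i <- s) integral2 D (F i).
Proof.
move=> nF; elim: s => [|i s ih].
  under eq_fun do rewrite big_nil.
  by rewrite big_nil /integral2 Rintegral_cst// mul0r.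
under eq_fun do rewrite big_cons.
by rewrite big_cons integral2D ?ih//; exact: bmeasurable_sum.
Qed.

Lemma integral2_eq f g : (forall p, D p -> f p = g p) -> integral2 D f = integral2 D g.
Proof. by move=> fg; apply: eq_Rintegral => p /set_mem; exact: fg. Qed.

End OnD.

Lemma integral2_indic A D f : measurable A -> measurable D -> A `<=` D ->
  integral2 D (fun p => f p * \1_A p) = integral2 A f.
Proof.
move=> mA mD AD; rewrite /integral2 -[in RHS](setIidr AD) Rintegral_mkcondr.
apply: eq_Rintegral => p _; rewrite patchE indicE; case: ifPn => _.
  by rewrite mulr1.
by rewrite mulr0.
Qed.

Lemma integral2_subset A D f : measurable A -> measurable D -> A `<=` D -> D `<=` Omegabar ->
  bmeasurable f -> (forall p, D p -> 0 <= f p) -> integral2 A f <= integral2 D f.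
Proof.
move=> mA mD AD DO nf f0; rewrite -(integral2_indic _ mA mD AD).
apply: integral2_le => //; first by apply: bmeasurableM => //; exact: bmeasurable_indic.
move=> p Dp; rewrite indicE; case: (_ \in _); rewrite ?mulr1 ?mulr0//.
exact: f0.
Qed.

(** The integrand may be arbitrary on the null set Z; on each piece it is given
    by a function that is defined and bounded on the whole square. *)
Lemma integral2_pieces (I : finType) (To : I -> set (R * R)) Z D f (F : I -> R * R -> R) :
  measurable D -> D `<=` Omegabar -> (forall i, measurable (To i)) ->
  (forall i, To i `<=` D) ->
  (forall i j p, To i p -> To j p -> i = j) ->
  measurable Z -> mu2 Z = 0%E ->
  (forall p, D p -> ~ Z p -> exists i, To i p) ->
  (forall i p, To i p -> f p = F i p) -> (forall i, bmeasurable (F i)) ->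
  integral2 D f = \sum_i integral2 (To i) (F i).
Proof.
move=> mD DO mTo ToD dTo mZ Z0 cov fF nF.
transitivity (integral2 D (fun p => \sum_i F i p * \1_(To i) p)).
  rewrite /integral2; apply: (@Rintegral_eq_off_null _ _ _ mu2 _ _ _ _ mZ Z0) => p Dp /(cov _ Dp)[i Ti].
  rewrite (bigD1 i)//= big1 ?addr0; last first.
    move=> j ji; rewrite indicE memNset ?mulr0// => Tj.
    by move/negP: ji; apply; apply/eqP; exact: dTo Tj Ti.
  by rewrite indicE mem_set// mulr1; exact: fF.
rewrite integral2_sum//; last by move=> i; apply: bmeasurableM => //; exact: bmeasurable_indic.
by apply: eq_bigr => i _; rewrite integral2_indic.
Qed.

Definition line (a b e : R) : set (R * R) := [set p | a * p.1 + b * p.2 = e].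

Lemma measurable_line a b e : measurable (line a b e).
Proof.
have mf : measurable_fun setT (fun p : R * R => a * p.1 + b * p.2).
  apply: (proj1 (bmeasurableD (bmeasurableM (bmeasurable_cst a) bmeasurable_fst) (bmeasurableM (bmeasurable_cst b) bmeasurable_snd))).
rewrite (_ : line _ _ _ = setT `&` (fun p : R * R => a * p.1 + b * p.2) @^-1` [set e]).
  by apply: mf => //; exact: measurable_set1.
by rewrite setTI.
Qed.

Lemma line_null a b e : (a != 0) || (b != 0) -> mu2 (line a b e) = 0%E.
Proof.
have [b0|b0 _] := eqVneq b 0.
  rewrite orbF => a0.
  rewrite (_ : line _ _ _ = [set e / a] `*` setT).
    rewrite product_measure1E; [|exact: measurable_set1|exact: measurableT].
    by rewrite [X in (X * _)%E](_ : _ = 0%E) ?mul0e//; exact: lebesgue_measure_set1.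
  apply/seteqP; split => -[x y] /=; rewrite /line /= b0 mul0r addr0.
    by move=> <-; split => //; rewrite mulrC mulKf.
  by case=> -> _; rewrite mulrC divfK.
rewrite /product_measure1 /= integral0_eq// => x _ /=.
rewrite (_ : xsection _ _ = [set (e - a * x) / b]) ?lebesgue_measure_set1//.
apply/seteqP; split => y; rewrite /xsection /= ?inE /line /=.
  by move=> <-; rewrite addrAC subrr add0r mulrC mulKf.
by move=> ->; rewrite [b * _]mulrCA mulfV// mulr1 addrC subrK.
Qed.

End PlaneIntegral.

(** * Triangles and triangulated tensor product meshes *)

Section Triangles.
Context {R : realType}.
Local Notation mu := (@lebesgue_measure R).

(** The right-angled triangle with corner c and legs along the axes of signed
    lengths u and w: with negative u and w it is the upper triangle of a cell. *)
Definition otri (c : R * R) (u w : R) : set (R * R) :=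
  [set p | [/\ 0 < (p.1 - c.1) / u, 0 < (p.2 - c.2) / w &
               (p.1 - c.1) / u + (p.2 - c.2) / w < 1]].

Definition ctri (c : R * R) (u w : R) : set (R * R) :=
  [set p | [/\ 0 <= (p.1 - c.1) / u, 0 <= (p.2 - c.2) / w &
               (p.1 - c.1) / u + (p.2 - c.2) / w <= 1]].

Lemma otri_ctri c u w : otri c u w `<=` ctri c u w.
Proof. by move=> p [] *; split; apply: ltW. Qed.

Lemma bmeasurable_coord1 c u : bmeasurable (fun p : R * R => (p.1 - c) / u).
Proof. exact: bmeasurableM (bmeasurableB bmeasurable_fst (bmeasurable_cst _)) (bmeasurable_cst _). Qed.

Lemma bmeasurable_coord2 c w : bmeasurable (fun p : R * R => (p.2 - c) / w).
Proof. exact: bmeasurableM (bmeasurableB bmeasurable_snd (bmeasurable_cst _)) (bmeasurable_cst _). Qed.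

Lemma measurable_otri c u w : measurable (otri c u w).
Proof.
rewrite (_ : otri _ _ _ = [set p | 0 < (p.1 - c.1) / u] `&`
   ([set p | 0 < (p.2 - c.2) / w] `&`
    [set p | 0 < 1 - ((p.1 - c.1) / u + (p.2 - c.2) / w)])).
  apply: measurableI; first exact: (measurable_gt0_set (proj1 (bmeasurable_coord1 _ _))).
  apply: measurableI; first exact: (measurable_gt0_set (proj1 (bmeasurable_coord2 _ _))).
  apply: measurable_gt0_set.
  exact: (proj1 (bmeasurableB (bmeasurable_cst _) (bmeasurableD (bmeasurable_coord1 _ _) (bmeasurable_coord2 _ _)))).
apply/seteqP; split => p /=; rewrite subr_gt0; first by case=> s1 s2 s3; split.
by case=> ? [].
Qed.

Lemma measurable_ctri c u w : measurable (ctri c u w).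
Proof.
rewrite (_ : ctri _ _ _ = [set p | 0 <= (p.1 - c.1) / u] `&`
   ([set p | 0 <= (p.2 - c.2) / w] `&`
    [set p | 0 <= 1 - ((p.1 - c.1) / u + (p.2 - c.2) / w)])).
  apply: measurableI; first exact: (measurable_ge0_set (proj1 (bmeasurable_coord1 _ _))).
  apply: measurableI; first exact: (measurable_ge0_set (proj1 (bmeasurable_coord2 _ _))).
  apply: measurable_ge0_set.
  exact: (proj1 (bmeasurableB (bmeasurable_cst _) (bmeasurableD (bmeasurable_coord1 _ _) (bmeasurable_coord2 _ _)))).
apply/seteqP; split => p /=; rewrite subr_ge0; first by case=> s1 s2 s3; split.
by case=> ? [].
Qed.

Lemma integral_derive_oo (F f : R -> R) (a b : R) : a < b ->
  (forall x : R, is_derive x (1 : R) F (f x)) -> continuous f ->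
  mu.-integrable `]a, b[ (EFin \o f) /\
  (\int[mu]_(x in `]a, b[) (f x)%:E = (F b - F a)%:E)%E.
Proof.
move=> ab dF cf.
have icc : mu.-integrable `[a, b] (EFin \o f).
  apply: continuous_compact_integrable; first exact: segment_compact.
  exact: continuous_subspaceT.
have ioo : mu.-integrable `]a, b[ (EFin \o f).
  by apply: integrableS icc => //; exact: subset_itv_oo_cc.
split=> //.
have cF : continuous F.
  move=> x; apply: differentiable_continuous; apply/derivable1_diffP.
  by have [] := dF x.
have mf : measurable_fun setT f by exact: continuous_measurable_fun.
rewrite (@integral_itv_bndo_bndc _ (BRight a) b (EFin \o f)); last first.
  by apply/measurable_EFinP; exact: measurable_funTS.
rewrite (@integral_itv_obnd_cbnd _ a (BRight b) (EFin \o f)); last first.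
  by apply/measurable_EFinP; exact: measurable_funTS.
rewrite (@continuous_FTC2 _ f F)//.
- exact: continuous_subspaceT.
- split=> [x _|| ]; first by have [] := dF x.
    by apply: cvg_at_right_filter; exact: cF.
  by apply: cvg_at_left_filter; exact: cF.
- by move=> x _; rewrite derive1E; apply: derive_val.
Qed.

(** The section of the triangle at height y is an interval with end points c.1
    and c.1 + u (1 - t), in an order that depends on the sign of u; this is the
    origin of the sign in front of the increment of F. *)
Lemma integral_otri_section (F f : R -> R) c u w (y : R) : u != 0 -> w != 0 ->
  (forall x : R, is_derive x (1 : R) F (f x)) -> continuous f ->
  let t := (y - c.2) / w in
  let g x := f x * \1_(otri c u w) (x, y) in
  mu.-integrable setT (EFin \o g) /\
  (\int[mu]_x (g x)%:E =
   (if (0 < t) && (t < 1) then Num.sg u * (F (c.1 + u * (1 - t)) - F c.1) else 0)%:E)%E.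
Proof.
move=> u0 w0 dF cf t g.
case: ifPn => [/andP[t0 t1]|tn]; last first.
  have -> : g = cst 0.
    apply/funext => x; rewrite /g indicE memNset ?mulr0// => -[/= s0 t0 st].
    move/negP: tn; apply; rewrite t0 /=.
    by apply: le_lt_trans st; rewrite lerDr ltW.
  split; first exact: integrable0.
  by rewrite integral0.
set d := c.1 + u * (1 - t).
wlog suff H : / exists a b : R, [/\ a < b, F b - F a = Num.sg u * (F d - F c.1) &
    forall x, otri c u w (x, y) <-> a < x < b].
  have [a [b [ab <- S]]] := H.
  have [i1 i2] := integral_derive_oo ab dF cf.
  have gE : g = f \_ `]a, b[.
    apply/funext => x; rewrite /g patchE indicE.
    have -> : (x \in `]a, b[%classic) = ((x, y) \in otri c u w).
      by apply/idP/idP => /set_mem /=; rewrite ?in_itv => /S H1; apply/mem_set => //=;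
         rewrite in_itv.
    by case: ifP; rewrite ?mulr1 ?mulr0.
  rewrite gE; split.
    by rewrite -restrict_EFin; apply/(integrable_mkcond _ _).1.
  rewrite -i2 [RHS]integral_mkcond.
  by apply: eq_integral => x _; rewrite restrict_EFin.
have [u_gt0|u_lt0|] := ltgtP 0 u; last by move=> /esym/eqP; rewrite (negbTE u0).
  exists c.1, d; split.
  - by rewrite /d ltrDl mulr_gt0// subr_gt0.
  - by rewrite gtr0_sg// mul1r.
  - move=> x; rewrite /otri /= -/t; split.
      case=> s0 _ st; apply/andP; split.
        by rewrite -subr_gt0 -(pmulr_lgt0 _ (_ : 0 < u^-1)) ?invr_gt0.
      by rewrite /d -ltrBlDl mulrC -ltr_pdivrMr// ltrBrDr.
    case/andP=> s0 st; split => //.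
      by rewrite divr_gt0// subr_gt0.
    by rewrite -ltrBrDr ltr_pdivrMr// mulrC ltrBlDl.
exists d, c.1; split.
- by rewrite /d gtrDl nmulr_rlt0// subr_gt0.
- by rewrite ltr0_sg// mulN1r opprB.
- move=> x; rewrite /otri /= -/t; split.
    case=> s0 _ st; apply/andP; split; last first.
      by rewrite -subr_lt0 -(nmulr_lgt0 _ (_ : u^-1 < 0)) ?invr_lt0.
    by rewrite /d -ltrBrDl mulrC -ltr_ndivrMr// ltrBrDr.
  case/andP=> st s0; split => //.
    by rewrite nmulr_lgt0 ?invr_lt0// subr_lt0.
  by rewrite -ltrBrDr ltr_ndivrMr// mulrC ltrBrDl.
Qed.

End Triangles.

Lemma sum_tri (V : zmodType) N (f : tri_index N -> V) :
  \sum_K f K = \sum_(i < N) \sum_(j < N) (f (i, j, false) + f (i, j, true)).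
Proof.
under [RHS]eq_bigr do under eq_bigr => j _ do
  rewrite addrC -(big_bool _ (fun a => f (_, j, a))).
rewrite pair_bigA /= pair_bigA /=.
by apply: eq_bigr => -[[i j] a].
Qed.

Section TensorMesh.
Context {R : realType}.
Local Notation mu := (@lebesgue_measure R).
Local Notation mu2 := (@lebesgue_measure R \x @lebesgue_measure R)%E.
Variable N : nat.
Variables xs ys : nat -> R.

(** Both triangles of a cell are encoded by their right-angled corner and signed
    legs: the corner is at index i + a, the other end of the leg at index i + ~~
    a. *)
Definition signed_step (zs : nat -> R) (i : nat) (a : bool) : R :=
  zs (i + ~~ a)%N - zs (i + a)%N.
Definition corner (K : tri_index N) : R * R :=
  (xs (K.1.1 + K.2)%N, ys (K.1.2 + K.2)%N).
Definition signed_width (K : tri_index N) : R := signed_step xs K.1.1 K.2.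
Definition signed_height (K : tri_index N) : R := signed_step ys K.1.2 K.2.
Definition open_tri (K : tri_index N) := otri (corner K) (signed_width K) (signed_height K).
Definition closed_tri (K : tri_index N) := ctri (corner K) (signed_width K) (signed_height K).

Lemma measurable_open_tri K : measurable (open_tri K).
Proof. exact: measurable_otri. Qed.

Hypothesis ltxs : forall i, (i < N)%N -> xs i < xs i.+1.
Hypothesis ltys : forall i, (i < N)%N -> ys i < ys i.+1.
Hypotheses (xs0 : xs 0 = 0) (xsN : xs N = 1) (ys0 : ys 0 = 0) (ysN : ys N = 1).

Lemma increasing_le (zs : nat -> R) : (forall i, (i < N)%N -> zs i < zs i.+1) ->
  forall i j, (i <= j <= N)%N -> zs i <= zs j.
Proof.
move=> lt i j /andP[ij jN].
elim: j ij jN => [|j ih]; first by rewrite leqn0 => /eqP ->.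
rewrite leq_eqVlt => /orP[/eqP -> //|ij] jN.
by apply: (le_trans (ih ij (ltnW jN))); apply/ltW/lt.
Qed.

Lemma signed_step_false zs i : signed_step zs i false = zs i.+1 - zs i.
Proof. by rewrite /signed_step addn1 addn0. Qed.

Lemma signed_step_true zs i : signed_step zs i true = - (zs i.+1 - zs i).
Proof. by rewrite /signed_step addn1 addn0 opprB. Qed.

Lemma signed_width_neq0 K : signed_width K != 0.
Proof.
case: K => -[i j] []; rewrite /signed_width /= ?signed_step_true ?signed_step_false ?oppr_eq0 gt_eqF// subr_gt0 ltxs//.
Qed.

Lemma signed_height_neq0 K : signed_height K != 0.
Proof.
case: K => -[i j] []; rewrite /signed_height /= ?signed_step_true ?signed_step_false ?oppr_eq0 gt_eqF// subr_gt0 ltys//.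
Qed.

Lemma open_tri_cell (K : tri_index N) p : open_tri K p ->
  [/\ xs K.1.1 < p.1 < xs K.1.1.+1 & ys K.1.2 < p.2 < ys K.1.2.+1].
Proof.
have aux (zs : nat -> R) i (a : bool) z : zs i < zs i.+1 ->
    0 < (z - zs (i + a)%N) / signed_step zs i a < 1 -> zs i < z < zs i.+1.
  move=> lt; rewrite -subr_gt0 in lt.
  case: a; rewrite ?signed_step_true ?signed_step_false ?addn0 ?addn1 => /andP[].
    by rewrite ltr_ndivrMr ?nmulr_lgt0 ?invr_lt0 ?oppr_lt0// mul1r; lra.
  by rewrite ltr_pdivrMr ?pmulr_lgt0 ?invr_gt0// mul1r; lra.
case: K => -[i j] a [/= s t st]; split; [apply: (aux _ _ a)|apply: (aux _ _ a)].
- exact: ltxs.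
- by rewrite s /=; lra.
- exact: ltys.
- by rewrite t /=; lra.
Qed.

Lemma open_tri_Omega K : open_tri K `<=` (@Omega R).
Proof.
move=> p /open_tri_cell[/andP[a b] /andP[c d]]; split => /=; rewrite in_itv /=.
  rewrite (le_lt_trans _ a)/=; last by rewrite -xs0; apply: increasing_le => //; exact: ltnW.
  by rewrite (lt_le_trans b)// -xsN; apply: increasing_le => //; rewrite ltn_ord leqnn.
rewrite (le_lt_trans _ c)/=; last by rewrite -ys0; apply: increasing_le => //; exact: ltnW.
by rewrite (lt_le_trans d)// -ysN; apply: increasing_le => //; rewrite ltn_ord leqnn.
Qed.

Lemma open_tri_Omegabar K : open_tri K `<=` (@Omegabar R).
Proof. by move=> p /open_tri_Omega; exact: Omega_sub_Omegabar. Qed.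

Let cell_inj (zs : nat -> R) i j z : (forall i, (i < N)%N -> zs i < zs i.+1) ->
  (i < N)%N -> (j < N)%N -> zs i < z < zs i.+1 -> zs j < z < zs j.+1 -> i = j.
Proof.
move=> lt iN jN /andP[a b] /andP[c d]; apply/eqP; case: ltngtP => // ij.
  have : zs i.+1 <= zs j by apply: increasing_le => //; rewrite ij ltnW.
  by move=> /(lt_le_trans b) /(lt_trans c); rewrite ltxx.
have : zs j.+1 <= zs i by apply: increasing_le => //; rewrite ij ltnW.
by move=> /(lt_le_trans d) /(lt_trans a); rewrite ltxx.
Qed.

(** The local coordinates of the two triangles of a cell are exchanged by t -> 1
    - t. *)
Lemma coord_true (zs : nat -> R) i z : zs i < zs i.+1 ->
  (z - zs (i + true)%N) / signed_step zs i true =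
  1 - (z - zs (i + false)%N) / signed_step zs i false.
Proof.
move=> lt; rewrite signed_step_true signed_step_false addn0 addn1; field.
by apply: lt0r_neq0; lra.
Qed.

Lemma open_tri_disj K K' p : open_tri K p -> open_tri K' p -> K = K'.
Proof.
move=> Kp Kp'; have [a b] := open_tri_cell Kp; have [a' b'] := open_tri_cell Kp'.
case: K Kp a b => -[i j] e Kp /= a b; case: K' Kp' a' b' => -[i' j'] e' Kp' /= a' b'.
have /val_inj ii : i = i' :> nat by apply: cell_inj a a'.
have /val_inj jj : j = j' :> nat by apply: cell_inj b b'.
subst i' j'; congr (_, _).
case: Kp => /= s t st; case: Kp' => /= s' t' st'.
case: e s t st => s t st; case: e' s' t' st' => // s' t' st'.
  move: st; rewrite !coord_true//; try (exact: ltxs || exact: ltys).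
  by move: st'; lra.
move: st'; rewrite !coord_true//; try (exact: ltxs || exact: ltys).
by move: st; lra.
Qed.

(** Integration by parts without boundary terms. On a horizontal line the
    contributions of the two triangles of a cell add up to the increment of H
    over the cell, because the value of F on the common diagonal cancels; these
    increments telescope along the row. *)
Lemma sum_integral2_derive_x (F D : tri_index N -> R * R -> R) (H : R * R -> R) :
  (forall K p, closed_tri K p -> H p = F K p) ->
  (forall y : R, 0 < y < 1 -> H (0, y) = 0 /\ H (1, y) = 0) ->
  (forall K, bmeasurable (D K)) ->
  (forall K (y x : R), is_derive x (1 : R) (fun x => F K (x, y)) (D K (x, y))) ->
  (forall K (y : R), continuous (fun x : R => D K (x, y))) ->
  \sum_K integral2 (open_tri K) (D K) = 0.
Proof.
move=> HF H0 nD dF cD.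
pose Phi p := \sum_K D K p * \1_(open_tri K) p.
have nPhi : bmeasurable Phi.
  apply: bmeasurable_sum => K; apply: bmeasurableM => //; apply: bmeasurable_indic; exact: measurable_open_tri.
have PhiT : Phi \_ Omegabar = Phi.
  apply/funext => p; rewrite patchE; case: ifPn => // pO.
  rewrite /Phi big1// => K _; rewrite indicE memNset ?mulr0//.
  by move=> /open_tri_Omegabar /mem_set; rewrite (negbTE pO).
have iPhi : mu2.-integrable setT (EFin \o Phi).
  rewrite -PhiT -restrict_EFin; apply/(integrable_mkcond _ _).1.
    exact: measurable_Omegabar.
  by apply: bmeasurable_integrable => //; exact: measurable_Omegabar.
transitivity (integral2 Omegabar Phi).
  rewrite /Phi integral2_sum//; first last.
  - by move=> K; apply: bmeasurableM => //; apply: bmeasurable_indic; exact: measurable_open_tri.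
  - exact: measurable_Omegabar.
  apply: eq_bigr => K _; rewrite integral2_indic//; [exact: measurable_open_tri| |exact: open_tri_Omegabar].
  exact: measurable_Omegabar.
rewrite /integral2 Rintegral_mkcond PhiT /Rintegral.
rewrite -[X in fine X](integral21_prod_meas1 iPhi).
rewrite integral0_eq// => y _; rewrite /fubini_G /=.
pose t K := (y - (corner K).2) / signed_height K.
have sec K := integral_otri_section (corner K) y (signed_width_neq0 K) (signed_height_neq0 K)
  (dF K y) (cD K y).
transitivity (\sum_K \int[mu]_x (D K (x, y) * \1_(open_tri K) (x, y))%:E)%E.
  rewrite -integral_sum//; last first.
    by move=> K; exact: (sec K).1.
  by apply: eq_integral => x _; rewrite sumEFin.
under eq_bigr do rewrite (sec _).2.
rewrite sumEFin; congr EFin.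
set V := BIG_F.
(* the diagonal meets the line at d, where both triangles contribute H with
   opposite signs *)
have cell (i j : 'I_N) : V (i, j, false) + V (i, j, true) =
    if (ys j < y < ys j.+1) then H (xs i.+1, y) - H (xs i, y) else 0.
  have hx := ltxs (ltn_ord i); have hy := ltys (ltn_ord j).
  rewrite /V /=; set tf := (y - ys (j + false)%N) / signed_height (i, j, false).
  rewrite [signed_height (i, j, true)]/signed_height /= coord_true// -[_ / signed_step _ _ false]/tf.
  have -> : (0 < 1 - tf) && (1 - tf < 1) = (0 < tf) && (tf < 1).
    by apply/idP/idP => /andP[? ?]; apply/andP; split; lra.
  have -> : (0 < tf) && (tf < 1) = (ys j < y < ys j.+1).
    rewrite /tf /signed_height /= signed_step_false addn0 ltr_pdivrMr ?subr_gt0// mul1r.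
    by rewrite pmulr_lgt0 ?invr_gt0 ?subr_gt0// ltrD2r.
  case: ifPn => [/andP[y0 y1]|_]; last by rewrite addr0.
  have tf0 : 0 < tf by rewrite /tf /signed_height /= signed_step_false addn0 divr_gt0// subr_gt0.
  have tf1 : tf < 1.
    by rewrite /tf /signed_height /= signed_step_false addn0 ltr_pdivrMr ?subr_gt0// mul1r ltrD2r.
  rewrite /signed_width /= signed_step_true signed_step_false addn0 addn1.
  rewrite gtr0_sg ?subr_gt0// ltr0_sg ?oppr_lt0 ?subr_gt0//.
  have Ht x (b : bool) : 0 <= (x - xs (i + b)%N) / signed_step xs i b ->
     (x - xs (i + b)%N) / signed_step xs i b + (if b then 1 - tf else tf) <= 1 ->
     F (i, j, b) (x, y) = H (x, y).
    move=> s0 s1; rewrite (HF (i, j, b))//; split => //=.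
      rewrite /signed_height /=; case: (b) => //; last exact: ltW.
      rewrite coord_true// -[_ / signed_step _ _ false]/tf; lra.
    rewrite /signed_height /= /signed_width /=; case: (b) s1 => // s1.
    by rewrite [X in _ + X]coord_true// -[_ / signed_step _ _ false in X in _ + X]/tf; lra.
  set d := xs i + _ * (1 - tf).
  have dE : xs i.+1 + - (xs i.+1 - xs i) * (1 - (1 - tf)) = d by rewrite /d; ring.
  have sd : (d - xs (i + false)%N) / signed_step xs i false = 1 - tf.
    by rewrite signed_step_false addn0 /d; field; apply: lt0r_neq0; lra.
  rewrite dE.
  have s0 : (xs i - xs (i + false)%N) / signed_step xs i false = 0.
    by rewrite addn0 subrr mul0r.
  have s1 : (xs i.+1 - xs (i + false)%N) / signed_step xs i false = 1.
    by rewrite signed_step_false addn0 divff// lt0r_neq0// subr_gt0.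
  rewrite (Ht d false) ?sd; [|lra..].
  rewrite (Ht (xs i) false) ?s0; [|lra..].
  rewrite (Ht d true) ?coord_true// ?sd; [|lra..].
  rewrite (Ht (xs i.+1) true) ?coord_true// ?s1; [|lra..].
  by ring.
rewrite sum_tri exchange_big /=.
rewrite big1// => j _.
under eq_bigr do rewrite cell.
case: (boolP (ys j < y < ys j.+1)) => [/andP[y0 y1]|_]; last by rewrite big1.
rewrite -(big_mkord xpredT (fun i => H (xs i.+1, y) - H (xs i, y))) telescope_sumr//.
rewrite xs0 xsN; have [|-> ->] := H0 y; last by rewrite subrr.
rewrite (le_lt_trans _ y0)/=; last by rewrite -ys0; apply: increasing_le => //; exact: ltnW.
by rewrite (lt_le_trans y1)// -ysN; apply: increasing_le => //; rewrite ltn_ord leqnn.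
Qed.

End TensorMesh.

Section MeshDecomposition.
Context {R : realType}.
Local Notation mu2 := (@lebesgue_measure R \x @lebesgue_measure R)%E.

Definition swap (p : R * R) : R * R := (p.2, p.1).

Lemma measurable_swap : measurable_fun setT swap.
Proof. by apply: measurable_fun_pair; [exact: measurable_snd|exact: measurable_fst]. Qed.

Lemma bmeasurable_swap f : bmeasurable f -> bmeasurable (f \o swap).
Proof.
move=> [mf [M Mf]]; split; first by apply: measurableT_comp => //; exact: measurable_swap.
by exists M => -[x y] [Ox Oy]; apply: Mf.
Qed.

Lemma integral2_swap D f : measurable D -> D `<=` (@Omegabar R) -> bmeasurable f ->
  integral2 (swap @^-1` D) (f \o swap) = integral2 D f.
Proof.
move=> mD DO nf.
have mD' : measurable (swap @^-1` D).
  by rewrite -[X in measurable X]setTI; exact: measurable_swap.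
have DO' : swap @^-1` D `<=` (@Omegabar R) by move=> -[x y] /DO[].
have i1 : mu2.-integrable setT (EFin \o (f \_ D)).
  by rewrite -restrict_EFin; apply/(integrable_mkcond _ _).1 => //; exact: bmeasurable_integrable.
have i2 : mu2.-integrable setT (EFin \o ((f \o swap) \_ (swap @^-1` D))).
  rewrite -restrict_EFin; apply/(integrable_mkcond _ _).1 => //.
  by apply: bmeasurable_integrable => //; exact: bmeasurable_swap.
rewrite /integral2 Rintegral_mkcond [RHS]Rintegral_mkcond /Rintegral; congr fine.
rewrite -[LHS](integral21_prod_meas1 i2) -[RHS](integral12_prod_meas1 i1).
apply: eq_integral => x _; apply: eq_integral => y _ /=; rewrite !patchE.
by congr (EFin (if _ then _ else _)); apply/idP/idP => /set_mem H; apply/mem_set.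
Qed.

Variable N : nat.
Variables xs ys : nat -> R.
Hypothesis ltxs : forall i, (i < N)%N -> xs i < xs i.+1.
Hypothesis ltys : forall i, (i < N)%N -> ys i < ys i.+1.
Hypotheses (xs0 : xs 0 = 0) (xsN : xs N = 1) (ys0 : ys 0 = 0) (ysN : ys N = 1).

Definition swapK (K : tri_index N) : tri_index N := (K.1.2, K.1.1, K.2).

Lemma swapKK : involutive swapK. Proof. by case=> -[]. Qed.

Lemma open_tri_swap K : open_tri xs ys (swapK K) = swap @^-1` (open_tri ys xs K).
Proof.
case: K => -[i j] a; apply/seteqP; split => -[x y] /= [/= s t st]; split => //=;
  by rewrite addrC.
Qed.

Lemma closed_tri_swap K p : closed_tri ys xs (swapK K) (swap p) -> closed_tri xs ys K p.
Proof.
case: K => -[i j] a; case: p => x y /= [/= s t st]; split => //=;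
  by rewrite addrC.
Qed.

(** The reflection x <-> y maps the triangulation onto the one with xs and ys
    exchanged. *)
Lemma sum_integral2_derive_y (F D : tri_index N -> R * R -> R) (H : R * R -> R) :
  (forall K p, closed_tri xs ys K p -> H p = F K p) ->
  (forall x : R, 0 < x < 1 -> H (x, 0) = 0 /\ H (x, 1) = 0) ->
  (forall K, bmeasurable (D K)) ->
  (forall K (x y : R), is_derive y (1 : R) (fun y => F K (x, y)) (D K (x, y))) ->
  (forall K (x : R), continuous (fun y : R => D K (x, y))) ->
  \sum_K integral2 (open_tri xs ys K) (D K) = 0.
Proof.
move=> HF H0 nD dF cD.
apply: (etrans _ (@sum_integral2_derive_x _ _ ys xs ltys ltxs ys0 ysN xs0 xsN
  (fun K => F (swapK K) \o swap) (fun K => D (swapK K) \o swap) (H \o swap) _ _ _ _ _)).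
- rewrite (reindex_inj (inv_inj swapKK)) /=.
  apply: eq_bigr => K _.
  rewrite -(integral2_swap (measurable_open_tri _ _ _)); last first.
  + exact: nD.
  + exact: open_tri_Omegabar.
  congr integral2; rewrite open_tri_swap; by apply/seteqP; split => -[].
- by move=> K p TKp /=; apply: HF; apply: closed_tri_swap; rewrite swapKK; case: p TKp.
- by move=> y y01 /=; exact: H0.
- by move=> K; apply: bmeasurable_swap.
- by move=> K y; exact: (cD (swapK K) y).
Qed.

Lemma cell_exists (zs : nat -> R) (z : R) : zs 0%N < z < zs N ->
  exists2 i : 'I_N, zs i <= z & z < zs i.+1.
Proof.
move=> /andP[z0 zN].
suff : forall n, (n <= N)%N -> z < zs n -> exists2 i : 'I_N, zs i <= z & z < zs i.+1.
  by apply; [exact: leqnn|].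
elim=> [_ /(lt_trans z0)|n ih nN zn]; first by rewrite ltxx.
have [/(ih (ltnW nN)) //|nz] := ltP z (zs n).
by exists (Ordinal nN).
Qed.

Definition edges (K : tri_index N) : set (R * R) :=
  line 1 0 (corner xs ys K).1 `|` (line 0 1 (corner xs ys K).2 `|`
  line (signed_width xs K)^-1 (signed_height ys K)^-1
    (1 + (corner xs ys K).1 / signed_width xs K + (corner xs ys K).2 / signed_height ys K)).

(** Each edge is replaced by the line through it, which is still a null set. *)
Definition skeleton : set (R * R) := \big[setU/set0]_(K : tri_index N) edges K.

Let null (A : set (R * R)) := measurable A /\ mu2 A = 0%E.

Let null_setU A B : null A -> null B -> null (A `|` B).
Proof.
move=> [mA A0] [mB B0]; split; first exact: measurableU.
by rewrite -[RHS]A0 (@measureU0 _ _ _ mu2).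
Qed.

Lemma skeleton_null : measurable skeleton /\ mu2 skeleton = 0%E.
Proof.
rewrite -/(null skeleton) /skeleton; elim/big_ind: _ => [||K _].
- split; last exact: (@measure0 _ _ _ mu2).
  by rewrite -(@set0X R R setT); apply: measurableX.
- exact: null_setU.
have s1 := signed_width_neq0 ltxs K; have s2 := signed_height_neq0 ltys K.
apply: null_setU; [|apply: null_setU];
  (split; first exact: measurable_line); apply: line_null.
- by rewrite oner_eq0.
- by rewrite oner_eq0 orbT.
- by rewrite invr_eq0 s1.
Qed.

Lemma edges_skeleton (K : tri_index N) : edges K `<=` skeleton.
Proof. by move=> p Ep; rewrite /skeleton -bigcup_seq; exists K => //=; exact: mem_index_enum. Qed.

Lemma closed_tri_sub_open_tri (K : tri_index N) p : closed_tri xs ys K p -> ~ skeleton p -> open_tri xs ys K p.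
Proof.
have s1 := signed_width_neq0 ltxs K; have s2 := signed_height_neq0 ltys K.
move=> [s t st] nS.
have nE q : edges K q -> q != p.
  by move=> Eq; apply/eqP => qp; apply: nS; rewrite -qp; exact: edges_skeleton Eq.
split; rewrite lt_neqAle ?s ?t ?st andbT.
- apply: contra_not_neq nS => /esym/eqP; rewrite mulf_eq0 invr_eq0 (negbTE s1) orbF subr_eq0.
  by move=> /eqP e; apply: (@edges_skeleton K); left; rewrite /line /= mul1r mul0r addr0.
- apply: contra_not_neq nS => /esym/eqP; rewrite mulf_eq0 invr_eq0 (negbTE s2) orbF subr_eq0.
  by move=> /eqP e; apply: (@edges_skeleton K); right; left; rewrite /line /= mul1r mul0r add0r.
- apply: contra_not_neq nS => e; apply: (@edges_skeleton K); right; right.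
  rewrite /line /=; move: e s1 s2; move: (signed_width xs K) (signed_height ys K) => u w e s1 s2.
  by rewrite -e /=; field; rewrite s1 s2.
Qed.

Lemma cover_open_tri p : Omega p -> ~ skeleton p -> exists K : tri_index N, open_tri xs ys K p.
Proof.
case: p => x y [/= ]; rewrite !in_itv /= => x01 y01 nS.
have [|i xi1 xi2] := @cell_exists xs x; first by rewrite xs0 xsN.
have [|j yj1 yj2] := @cell_exists ys y; first by rewrite ys0 ysN.
have hx := ltxs (ltn_ord i); have hy := ltys (ltn_ord j).
pose s := (x - xs (i + false)%N) / signed_step xs i false.
pose t := (y - ys (j + false)%N) / signed_step ys j false.
have s0 : 0 <= s by rewrite /s signed_step_false addn0 divr_ge0 ?subr_ge0// ltW.
have t0 : 0 <= t by rewrite /t signed_step_false addn0 divr_ge0 ?subr_ge0// ltW.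
have s1 : s <= 1 by rewrite /s signed_step_false addn0 ler_pdivrMr ?subr_gt0// mul1r lerD2r ltW.
have t1 : t <= 1 by rewrite /t signed_step_false addn0 ler_pdivrMr ?subr_gt0// mul1r lerD2r ltW.
case: (leP (s + t) 1) => st.
  by exists (i, j, false); apply: closed_tri_sub_open_tri.
exists (i, j, true); apply: closed_tri_sub_open_tri => //.
rewrite /closed_tri /ctri /= /signed_width /signed_height /=.
by rewrite !coord_true// -/s -/t; split; lra.
Qed.

Lemma integral2_Omega f (F : tri_index N -> R * R -> R) :
  (forall K p, open_tri xs ys K p -> f p = F K p) -> (forall K, bmeasurable (F K)) ->
  integral2 Omega f = \sum_K integral2 (open_tri xs ys K) (F K).
Proof.
move=> fF nF; have [mS S0] := skeleton_null.
apply: (@integral2_pieces _ _ (open_tri xs ys) skeleton) => //.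
- exact: measurable_Omega.
- exact: Omega_sub_Omegabar.
- by move=> K; exact: measurable_open_tri.
- by move=> K; exact: open_tri_Omega.
- by move=> K K' p; exact: open_tri_disj.
- exact: cover_open_tri.
Qed.

Lemma closed_tri_box (K : tri_index N) p : closed_tri xs ys K p ->
  [/\ xs K.1.1 <= p.1 <= xs K.1.1.+1 & ys K.1.2 <= p.2 <= ys K.1.2.+1].
Proof.
have aux (zs : nat -> R) i (a : bool) z : zs i < zs i.+1 ->
    0 <= (z - zs (i + a)%N) / signed_step zs i a <= 1 -> zs i <= z <= zs i.+1.
  move=> lt; rewrite -subr_gt0 in lt.
  case: a; rewrite ?signed_step_true ?signed_step_false ?addn0 ?addn1 => /andP[].
    by rewrite ler_ndivrMr ?nmulr_lge0 ?invr_lt0 ?oppr_lt0// mul1r; lra.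
  by rewrite ler_pdivrMr ?pmulr_lge0 ?invr_gt0// mul1r; lra.
case: K => -[i j] a [/= s t st]; split.
  by apply: (aux _ _ a); [exact: ltxs|rewrite s /=; lra].
by apply: (aux _ _ a); [exact: ltys|rewrite t /=; lra].
Qed.

Lemma closed_tri_Omegabar (K : tri_index N) : closed_tri xs ys K `<=` Omegabar.
Proof.
move=> p /closed_tri_box[/andP[x1 x2] /andP[y1 y2]]; split => /=; rewrite in_itv /=.
  rewrite (le_trans _ x1)/=; last by rewrite -xs0; apply: increasing_le ltxs _ _ _; exact: ltnW.
  by rewrite (le_trans x2)// -xsN; apply: increasing_le ltxs _ _ _; rewrite ltn_ord leqnn.
rewrite (le_trans _ y1)/=; last by rewrite -ys0; apply: increasing_le ltys _ _ _; exact: ltnW.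
by rewrite (le_trans y2)// -ysN; apply: increasing_le ltys _ _ _; rewrite ltn_ord leqnn.
Qed.

Lemma integral2_closed_tri (K : tri_index N) f F :
  (forall p, open_tri xs ys K p -> f p = F p) -> bmeasurable F ->
  integral2 (closed_tri xs ys K) f = integral2 (open_tri xs ys K) F.
Proof.
move=> fF nF; have [mS S0] := skeleton_null.
rewrite (@integral2_pieces _ unit (fun=> open_tri xs ys K) skeleton _ f (fun=> F))//.
- by rewrite big_const card_unit /= addr0.
- exact: measurable_ctri.
- exact: closed_tri_Omegabar.
- by move=> _; exact: measurable_open_tri.
- by move=> _; exact: otri_ctri.
- by move=> [] [].
- by move=> p TKp nS; exists tt; exact: closed_tri_sub_open_tri.
Qed.

End MeshDecomposition.

(** * Affine functions on a triangle *)

Section ReferenceTriangle.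
Context {R : realType}.
Local Notation mu2 := (@lebesgue_measure R \x @lebesgue_measure R)%E.

Definition aff (q : R * R * R) (p : R * R) : R := q.1.1 + q.1.2 * p.1 + q.2 * p.2.

Lemma bmeasurable_aff q : bmeasurable (aff q).
Proof.
apply: bmeasurableD; first apply: bmeasurableD; first exact: bmeasurable_cst.
  by apply: bmeasurableM; [exact: bmeasurable_cst|exact: bmeasurable_fst].
by apply: bmeasurableM; [exact: bmeasurable_cst|exact: bmeasurable_snd].
Qed.

Variables (c : R * R) (u w : R).
Hypotheses (u0 : u != 0) (w0 : w != 0).
Hypothesis TO : otri c u w `<=` Omegabar.

Definition vtx1 : R * R := (c.1 + u, c.2).
Definition vtx2 : R * R := (c.1, c.2 + w).

Definition vmax (f : R * R -> R) : R :=
  Num.max `|f c| (Num.max `|f vtx1| `|f vtx2|).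

Lemma vmax_ge0 f : 0 <= vmax f. Proof. by rewrite /vmax le_max normr_ge0. Qed.
Lemma le_vmax0 f : `|f c| <= vmax f. Proof. by rewrite /vmax le_max lexx. Qed.
Lemma le_vmax1 f : `|f vtx1| <= vmax f. Proof. by rewrite /vmax !le_max lexx !orbT. Qed.
Lemma le_vmax2 f : `|f vtx2| <= vmax f. Proof. by rewrite /vmax !le_max lexx !orbT. Qed.

Lemma vmax_attained f : [\/ vmax f = `|f c|, vmax f = `|f vtx1| | vmax f = `|f vtx2|].
Proof.
rewrite /vmax; case: (leP `|f vtx1| `|f vtx2|) => _; case: (leP `|f c|) => _;
  by [constructor 1|constructor 2|constructor 3].
Qed.

Lemma aff_bary q p : let s := (p.1 - c.1) / u in let t := (p.2 - c.2) / w in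
  aff q p = (1 - s - t) * aff q c + s * aff q vtx1 + t * aff q vtx2.
Proof. by rewrite /aff /=; field; rewrite u0 w0. Qed.

Lemma aff_le_vmax q p : ctri c u w p -> `|aff q p| <= vmax (aff q).
Proof.
move=> [s0 t0 st]; rewrite aff_bary.
move: s0 t0 st; set s := _ / u; set t := _ / w => s0 t0 st.
have := le_vmax0 (aff q); have := le_vmax1 (aff q); have := le_vmax2 (aff q).
move: (aff q c) (aff q vtx1) (aff q vtx2) (vmax _) => a b d M.
rewrite !ler_norml => /andP[? ?] /andP[? ?] /andP[? ?].
by apply/andP; split; nra.
Qed.

Definition srect (a b a' b' : R) : set (R * R) :=
  [set p | a < (p.1 - c.1) / u < b /\ a' < (p.2 - c.2) / w < b'].

Lemma srectE a b a' b' : a <= b -> a' <= b' ->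
  measurable (srect a b a' b') /\
  mu2 (srect a b a' b') = (`|u * w| * ((b - a) * (b' - a')))%:E.
Proof.
move=> ab ab'.
have itv (d e l r : R) : e != 0 -> l <= r -> exists x y : R,
    [/\ x <= y, y - x = `|e| * (r - l) &
        forall z, (l < (z - d) / e < r) = (x < z < y)].
  move=> e0 lr; have [e_gt0|e_lt0|] := ltgtP 0 e; last by move=> /esym/eqP; rewrite (negbTE e0).
    exists (d + e * l), (d + e * r); split.
    - by rewrite lerD2l ler_pM2l.
    - by rewrite gtr0_norm//; ring.
    - by move=> z; rewrite ltr_pdivlMr// ltr_pdivrMr//; apply/idP/idP => /andP[? ?]; apply/andP; split; lra.
  exists (d + e * r), (d + e * l); split.
  - by rewrite lerD2l ler_nM2l.
  - by rewrite ltr0_norm//; ring.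
  - by move=> z; rewrite ltr_ndivlMr// ltr_ndivrMr//; apply/idP/idP => /andP[? ?]; apply/andP; split; lra.
have [x [y [xy yx H]]] := itv c.1 u a b u0 ab.
have [x' [y' [xy' yx' H']]] := itv c.2 w a' b' w0 ab'.
have -> : srect a b a' b' = `]x, y[%classic `*` `]x', y'[%classic.
  by apply/seteqP; split => -[p q] /=; rewrite /srect /= H H' !in_itv.
split; first by apply: measurableX; exact: measurable_itv.
by rewrite [LHS](mu2_rect xy xy') yx yx' normrM; congr EFin; ring.
Qed.

Lemma integral2_cst_srect a b a' b' (k : R) : a <= b -> a' <= b' ->
  integral2 (srect a b a' b') (fun=> k) = k * (`|u * w| * ((b - a) * (b' - a'))).
Proof.
move=> ab ab'; have [m e] := srectE ab ab'.
by rewrite /integral2 Rintegral_cst// [X in fine X]e.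
Qed.

(** The triangle is contained in a rectangle of area |u w|. *)
Lemma integral2_cst_le (k : R) : 0 <= k -> integral2 (otri c u w) (fun=> k) <= k * `|u * w|.
Proof.
move=> k0; have [m _] := srectE (@ler01 R) (@ler01 R).
have -> : k * `|u * w| = integral2 (srect 0 1 0 1) (fun=> k).
  by rewrite integral2_cst_srect// !subr0 !mulr1.
have mT := measurable_otri c u w.
have TS : otri c u w `<=` srect 0 1 0 1.
  by move=> p [s t st]; split; rewrite ?s ?t /=; lra.
rewrite /integral2 !Rintegral_cst//; apply: ler_wpM2l => //.
apply: fine_le => //; last by apply: le_measure; rewrite ?inE.
  rewrite ge0_fin_numE//; apply: (@le_lt_trans _ _ (mu2 Omegabar)).
    by apply: le_measure; rewrite ?inE//; exact: measurable_Omegabar.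
  by rewrite [X in (X < _)%E]mu2_Omegabar ltry.
by rewrite [X in X \is a fin_num](srectE (@ler01 R) (@ler01 R)).2.
Qed.

(** Lower bounds for integrals come from axis-parallel rectangles inside the
    triangle, whose area is known without computing that of the triangle. *)
Lemma integral2_ge_sub (f : R * R -> R) (k a b a' b' : R) : bmeasurable f ->
  (forall p, otri c u w p -> 0 <= f p) ->
  a <= b -> a' <= b' -> 0 <= a -> 0 <= a' -> b + b' <= 1 ->
  (forall p, srect a b a' b' p -> k <= f p) ->
  k * (`|u * w| * ((b - a) * (b' - a'))) <= integral2 (otri c u w) f.
Proof.
move=> nf f0 ab ab' a0 a0' bb fk.
have [m _] := srectE ab ab'.
have mT := measurable_otri c u w.
have ST : srect a b a' b' `<=` otri c u w.
  move=> p [/andP[s1 s2] /andP[t1 t2]]; split; lra.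
rewrite -integral2_cst_srect//; apply: (@le_trans _ _ (integral2 (srect a b a' b') f)).
  apply: integral2_le => //; last exact: bmeasurable_cst.
  exact: subset_trans TO.
exact: integral2_subset.
Qed.

Lemma integral2_cst_ge (k : R) : 0 <= k -> k * `|u * w| <= 256 * integral2 (otri c u w) (fun=> k).
Proof.
move=> k0.
have := @integral2_ge_sub (fun=> k) k 0 (1/16) 0 (1/16) (bmeasurable_cst k).
have : 0 <= `|u * w| by [].
move: (`|u * w|) (integral2 _ _) => m j m0 H.
suff : k * (m * ((1 / 16 - 0) * (1 / 16 - 0))) <= j by nra.
by apply: H => //; lra.
Qed.

Lemma bary_large (M x0 x1 x2 l0 l1 l2 : R) : 7/8 <= l0 -> 0 <= l1 -> 0 <= l2 ->
  l0 + l1 + l2 = 1 -> M = `|x0| -> `|x1| <= M -> `|x2| <= M ->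
  3/4 * M <= `|l0 * x0 + (l1 * x1 + l2 * x2)|.
Proof.
move=> l0_ge l1_ge l2_ge l_sum ME x1M x2M.
have M0 : 0 <= M by rewrite ME.
have h1 : `|l1 * x1 + l2 * x2| <= (l1 + l2) * M.
  rewrite (le_trans (ler_normD _ _))// !normrM (ger0_norm l1_ge) (ger0_norm l2_ge) mulrDl.
  by rewrite lerD// ler_wpM2l.
have h0 : `|l0 * x0| = l0 * M by rewrite normrM -ME ger0_norm//; lra.
have := lerB_normD (l0 * x0) (l1 * x1 + l2 * x2).
rewrite h0 => h2; apply: le_trans h2.
move: h1; have -> : l1 + l2 = 1 - l0 by lra.
nra.
Qed.

(** Where the barycentric coordinate of the vertex with the largest value is at
    least 7/8, an affine function keeps three quarters of that value; a
    rectangle with sides |u|/16 and |w|/16 fits into this region. *)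
Lemma vmax_le_integral2 (th : R * R -> R) q (m : R) : bmeasurable th -> 0 <= m ->
  (forall p, otri c u w p -> m <= th p) ->
  `|u * w| * (m * vmax (aff q) ^+ 2) <=
  512 * integral2 (otri c u w) (fun p => th p * aff q p ^+ 2).
Proof.
move=> nth m0 mth; set M := vmax _; set A := `|u * w|.
have A0 : 0 <= A by exact: normr_ge0.
have M0 : 0 <= M by exact: vmax_ge0.
suff [a [a' [a0 a0' aa H]]] : exists a a' : R, [/\ 0 <= a, 0 <= a', a + 1/16 + (a' + 1/16) <= 1 &
    forall p, srect a (a + 1/16) a' (a' + 1/16) p -> 3/4 * M <= `|aff q p|].
  have := @integral2_ge_sub (fun p => th p * aff q p ^+ 2) (m * (3/4 * M) ^+ 2) a (a + 1/16) a' (a' + 1/16).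
  have -> : (a + 1 / 16 - a) * (a' + 1 / 16 - a') = 256^-1 :> R by field.
  rewrite -/A; move: (integral2 _ _) => j Hj.
  suff : m * (3 / 4 * M) ^+ 2 * (A * 256^-1) <= j.
    rewrite exprMn => h; have mM : 0 <= A * (m * M ^+ 2) by rewrite !mulr_ge0// sqr_ge0.
    have -> : A * (m * M ^+ 2) = 16/9 * 256 * (m * ((3 / 4) ^+ 2 * M ^+ 2) * (A * 256^-1)) by field.
    have j0 : 0 <= j.
      apply: le_trans h; rewrite -exprMn; apply: mulr_ge0.
        by apply: mulr_ge0 m0 _; exact: sqr_ge0.
      by apply: mulr_ge0 A0 _; rewrite invr_ge0; exact: ler0n.
    by move: h; clear -j0; lra.
  apply: Hj; rewrite ?lerDl//.
  - by apply: bmeasurableM => //; apply: bmeasurableX; exact: bmeasurable_aff.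
  - by move=> p Tp; rewrite mulr_ge0// ?sqr_ge0// (le_trans m0)// mth.
  - move=> p Sp; rewrite -(real_normK (num_real (aff q p))).
    have [/andP[? ?] /andP[? ?]] := Sp.
    apply: ler_pM => //; first by rewrite sqr_ge0.
      by apply: mth; split; lra.
    by rewrite lerXn2r// ?nnegrE ?H// mulr_ge0//; lra.
have [[h0 h1] h2] := (le_vmax0 (aff q), le_vmax1 (aff q), le_vmax2 (aff q)).
rewrite -/M in h0 h1 h2.
case: (vmax_attained (aff q)) => ME; [exists 0, 0|exists (7/8), 0|exists 0, (7/8)];
  split; rewrite ?lexx//; try lra; move=> p [/andP[s1 s2] /andP[t1 t2]];
  rewrite aff_bary; move: s1 s2 t1 t2; set s := _ / u; set t := _ / w => s1 s2 t1 t2.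
- by rewrite -addrA; apply: bary_large => //; lra.
- by rewrite -addrA addrCA; apply: bary_large => //; lra.
- by rewrite addrC; apply: bary_large => //; lra.
Qed.

End ReferenceTriangle.

(** * The inverse weight *)

Section SliceContinuity.
Context {R : realType}.
Implicit Types (f g : R * R -> R).

(** Continuity on axis-parallel lines is what the fundamental theorem of
    calculus needs on the lines of the integration by parts. *)
Definition slice_continuous f := [/\ bmeasurable f,
  forall y : R, continuous (fun x : R => f (x, y)) &
  forall x : R, continuous (fun y : R => f (x, y))].

Lemma slice_continuous_cst (a : R) : slice_continuous (fun=> a).
Proof. by split; [exact: bmeasurable_cst|move=> y x; exact: cst_continuous..]. Qed.

Lemma slice_continuous_fst : slice_continuous (fun p => p.1).
Proof.
split; first exact: bmeasurable_fst.
  by move=> y x; exact: cvg_id.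
by move=> x y; exact: cst_continuous.
Qed.

Lemma slice_continuous_snd : slice_continuous (fun p => p.2).
Proof.
split; first exact: bmeasurable_snd.
  by move=> x y; exact: cst_continuous.
by move=> y x; exact: cvg_id.
Qed.

Lemma slice_continuousD f g : slice_continuous f -> slice_continuous g -> slice_continuous (fun p => f p + g p).
Proof.
move=> [nf f1 f2] [ng g1 g2]; split; first exact: bmeasurableD.
  by move=> y x; apply: (@continuousD _ _ _ (fun x => f (x, y)) (fun x => g (x, y))); [exact: f1|exact: g1].
by move=> x y; apply: (@continuousD _ _ _ (fun y => f (x, y)) (fun y => g (x, y))); [exact: f2|exact: g2].
Qed.

Lemma slice_continuousM f g : slice_continuous f -> slice_continuous g -> slice_continuous (fun p => f p * g p).
Proof.
move=> [nf f1 f2] [ng g1 g2]; split; first exact: bmeasurableM.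
  by move=> y x; apply: (@continuousM _ _ (fun x => f (x, y)) (fun x => g (x, y))); [exact: f1|exact: g1].
by move=> x y; apply: (@continuousM _ _ (fun y => f (x, y)) (fun y => g (x, y))); [exact: f2|exact: g2].
Qed.

Lemma slice_continuousN f : slice_continuous f -> slice_continuous (fun p => - f p).
Proof.
move=> sf; rewrite (_ : (fun p => _) = (fun p => -1 * f p)).
  by apply: slice_continuousM => //; exact: slice_continuous_cst.
by apply/funext => p; rewrite mulN1r.
Qed.

Lemma slice_continuousB f g : slice_continuous f -> slice_continuous g -> slice_continuous (fun p => f p - g p).
Proof. by move=> sf sg; apply: slice_continuousD => //; exact: slice_continuousN. Qed.

Lemma slice_continuous_expR f : slice_continuous f -> slice_continuous (fun p => expR (f p)).
Proof.
move=> [[mf [M Mf]] f1 f2]; split.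
- split; first by apply: measurableT_comp => //; exact: measurable_expR.
  exists (expR M) => p Op; rewrite ger0_norm ?expR_ge0// ler_expR.
  exact: le_trans (ler_norm _) (Mf _ Op).
- by move=> y x; apply: (@continuous_comp _ _ _ (fun x => f (x, y)) expR); [exact: f1|exact: continuous_expR].
- by move=> x y; apply: (@continuous_comp _ _ _ (fun y => f (x, y)) expR); [exact: f2|exact: continuous_expR].
Qed.

Lemma slice_continuous_aff q : slice_continuous (@aff R q).
Proof.
apply: slice_continuousD; first apply: slice_continuousD; first exact: slice_continuous_cst.
  by apply: slice_continuousM; [exact: slice_continuous_cst|exact: slice_continuous_fst].
by apply: slice_continuousM; [exact: slice_continuous_cst|exact: slice_continuous_snd].
Qed.

Lemma slice_continuous_nice f : slice_continuous f -> bmeasurable f. Proof. by case. Qed.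

Lemma derive_e1 f p : 'D_(1, 0) f p = 'D_1 (fun x : R => f (x, p.2)) p.1.
Proof.
rewrite /derive; set F := (F in lim (F @ _)); set F' := (F in _ = lim (F @ _)).
suff -> : F = F' by [].
rewrite /F /F'; apply/funext => h; case: p {F F'} => x y /=; congr (_ *: (f _ - _)).
by congr pair => /=; rewrite /GRing.scale /= mulr0 add0r.
Qed.

Lemma derive_e2 f p : 'D_(0, 1) f p = 'D_1 (fun y : R => f (p.1, y)) p.2.
Proof.
rewrite /derive; set F := (F in lim (F @ _)); set F' := (F in _ = lim (F @ _)).
suff -> : F = F' by [].
rewrite /F /F'; apply/funext => h; case: p {F F'} => x y /=; congr (_ *: (f _ - _)).
by congr pair => /=; rewrite /GRing.scale /= mulr0 add0r.
Qed.

End SliceContinuity.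

Section ExpBounds.
Context {R : realType}.
Implicit Types s t r : R.

Lemma expR_half_le s : s <= 1/2 -> expR s <= 2.
Proof.
move=> s2; have := expR_ge1Dx (- s); rewrite expRN => h.
have e0 := expR_gt0 s.
have := ler_wpM2l (ltW e0) h; rewrite divff ?lt0r_neq0// => {}h.
nra.
Qed.

Lemma expR_taylor s : `|s| <= 1/2 -> `|expR s - 1 - s| <= 2 * s ^+ 2.
Proof.
rewrite ler_norml => /andP[s1 s2].
have lo := expR_ge1Dx s.
rewrite ger0_norm; last lra.
have := expR_ge1Dx (- s); rewrite expRN => h.
have e0 := expR_gt0 s.
have := ler_wpM2l (ltW e0) h; rewrite divff ?lt0r_neq0// => {}h.
nra.
Qed.

(** With g(r) = 2 / (1 + e^r), the inverse weight is Afac(r) Bfac(q), where Afac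
    = 1/g and Bfac(q) = 1 / (g(q) g(-q)); dAfac and dBfac are their derivatives. *)
Definition Afac r : R := (1 + expR r) / 2.
Definition Bfac r : R := (2 + expR r + expR (- r)) / 4.
Definition dAfac r : R := expR r / 2.
Definition dBfac r : R := (expR r - expR (- r)) / 4.

Lemma dAfac_gt0 r : 0 < dAfac r. Proof. by rewrite /dAfac divr_gt0// expR_gt0. Qed.
Lemma dAfac_le r : dAfac r <= Afac r. Proof. by rewrite /dAfac /Afac; lra. Qed.
Lemma Afac_gt0 r : 0 < Afac r. Proof. exact: lt_le_trans (dAfac_gt0 r) (dAfac_le r). Qed.
Lemma Afac_ge r : 1/2 <= Afac r. Proof. by have := expR_gt0 r; rewrite /Afac; lra. Qed.

Lemma Bfac_ge r : 1/2 <= Bfac r.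
Proof. by have := expR_gt0 r; have := expR_gt0 (- r); rewrite /Bfac; lra. Qed.

Lemma Bfac_ge1 r : 1 <= Bfac r.
Proof.
have := expR_ge1Dx r; have := expR_ge1Dx (- r); rewrite /Bfac.
lra.
Qed.

Lemma Bfac_gt0 r : 0 < Bfac r.
Proof. by have := Bfac_ge r; lra. Qed.

Lemma dBfac_le r : `|dBfac r| <= Bfac r.
Proof.
have := expR_gt0 r; have := expR_gt0 (- r); rewrite /dBfac /Bfac ler_norml => ? ?.
by apply/andP; split; lra.
Qed.

Lemma Afac_taylor r s : `|s| <= 1/2 ->
  `|Afac (r + s) - Afac r - dAfac r * s| <= 2 * dAfac r * s ^+ 2.
Proof.
move=> s2; rewrite /Afac /dAfac expRD.
have -> : (1 + expR r * expR s) / 2 - (1 + expR r) / 2 - expR r / 2 * s =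
   expR r / 2 * (expR s - 1 - s) by field.
rewrite normrM ger0_norm; last by rewrite divr_ge0// expR_ge0.
rewrite [leRHS](_ : _ = expR r / 2 * (2 * s ^+ 2)); last by field.
by rewrite ler_wpM2l ?expR_taylor// divr_ge0// expR_ge0.
Qed.

Lemma Bfac_taylor r t : `|t| <= 1/2 ->
  `|Bfac (r + t) - Bfac r - dBfac r * t| <= 2 * Bfac r * t ^+ 2.
Proof.
move=> t2; rewrite /Bfac /dBfac opprD !expRD.
have -> : (2 + expR r * expR t + expR (- r) * expR (- t)) / 4 -
    (2 + expR r + expR (- r)) / 4 - (expR r - expR (- r)) / 4 * t =
    (expR r * (expR t - 1 - t) + expR (- r) * (expR (- t) - 1 - - t)) / 4 by field.
have h1 := expR_taylor t2; have h2 := @expR_taylor (- t); rewrite normrN sqrrN in h2.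
have e1 := expR_gt0 r; have e2 := expR_gt0 (- r).
rewrite normrM [X in _ * X]ger0_norm; last lra.
apply: (@le_trans _ _ ((expR r * (2 * t ^+ 2) + expR (- r) * (2 * t ^+ 2)) / 4)).
  rewrite ler_pM2r; last lra.
  apply: (le_trans (ler_normD _ _)); rewrite !normrM (gtr0_norm e1) (gtr0_norm e2).
  by apply: lerD; rewrite ler_pM2l//; exact: h2.
have := sqr_ge0 t; nra.
Qed.

Lemma Afac_harnack r s : Afac (r + s) <= expR `|s| * Afac r.
Proof.
have h : expR s <= expR `|s| by rewrite ler_expR ler_norm.
have h1 : 1 <= expR `|s| by rewrite -expR0 ler_expR.
rewrite /Afac expRD; have := expR_gt0 r; nra.
Qed.

Lemma dAfac_harnack r s : dAfac (r + s) <= expR `|s| * dAfac r.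
Proof.
have h : expR s <= expR `|s| by rewrite ler_expR ler_norm.
rewrite /dAfac expRD; have := expR_gt0 r; nra.
Qed.

Lemma Bfac_harnack r s : Bfac (r + s) <= expR `|s| * Bfac r.
Proof.
have h : expR s <= expR `|s| by rewrite ler_expR ler_norm.
have h' : expR (- s) <= expR `|s| by rewrite ler_expR -normrN ler_norm.
have h1 : 1 <= expR `|s| by rewrite -expR0 ler_expR.
rewrite /Bfac opprD !expRD; have := expR_gt0 r; have := expR_gt0 (- r); nra.
Qed.

(** The streamline factor enters the remainder only through its derivative, and
    linearly in s: this is what allows the term (Theta_beta G, G) of the
    weighted norm to control it, whereas the crosswind factor is expanded to
    second order. *)
Lemma AB_taylor r q s t : `|s| <= 1/4 -> `|t| <= 1/4 ->
  `|Afac (r + s) * Bfac (q + t) - Afac r * Bfac q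
    - (dAfac r * s * Bfac q + Afac r * (dBfac q * t))| <=
  2 * (Afac r * Bfac q) * t ^+ 2 + 2 * (dAfac r * Bfac q) * `|s|.
Proof.
move=> s4 t4.
have ha : `|Afac (r + s) - Afac r - dAfac r * s| <= 2 * dAfac r * s ^+ 2.
  by apply: Afac_taylor; lra.
have hb : `|Bfac (q + t) - Bfac q - dBfac q * t| <= 2 * Bfac q * t ^+ 2.
  by apply: Bfac_taylor; lra.
have hB : `|Bfac (q + t)| <= 2 * Bfac q.
  rewrite gtr0_norm ?Bfac_gt0//; apply: (le_trans (Bfac_harnack _ _)).
  by rewrite ler_wpM2r ?(ltW (Bfac_gt0 _))// expR_half_le//; lra.
have hdB := dBfac_le q; have A0 := Afac_gt0 r; have B0 := Bfac_gt0 q.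
have dA0 := dAfac_gt0 r.
move: ha hb hB hdB A0 B0 dA0.
set ra := _ - _ - _ * s; set rb := _ - _ - _ * t.
set A := Afac r; set B := Bfac q; set a := dAfac r; set b := dBfac q.
set B' := Bfac (q + t) => ha hb hB hdB A0 B0 a0.
have -> : Afac (r + s) * B' - A * B - (a * s * B + A * (b * t)) =
    A * rb + (a * s * (b * t + rb) + ra * B').
  by rewrite /ra /rb -/A -/B -/a -/b -/B'; ring.
clearbody ra rb A B a b B'.
have t2 : `|t| ^+ 2 = t ^+ 2 by rewrite real_normK// num_real.
have s2 : `|s| ^+ 2 = s ^+ 2 by rewrite real_normK// num_real.
have n1 : `|A * rb| <= 2 * (A * B) * t ^+ 2.
  by rewrite normrM gtr0_norm//; have := ler_wpM2l (ltW A0) hb; lra.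
have n2 : `|b * t + rb| <= B / 2.
  apply: (le_trans (ler_normD _ _)); rewrite normrM.
  have : `|b| * `|t| <= B * `|t| by rewrite ler_wpM2r.
  move: t4 t2 hb; have := normr_ge0 t; move: (`|t|) (`|b|) (`|rb|) (t ^+ 2) => x y z x2.
  move=> x0 x4 <- hz hy.
  have xx : x ^+ 2 <= 1 / 8 by nra.
  have h1 := ler_wpM2l (ltW B0) xx; have h2 := ler_wpM2l (ltW B0) x4.
  by lra.
have n3 : `|a * s * (b * t + rb)| <= a * `|s| * (B / 2).
  by rewrite !normrM (gtr0_norm a0) ler_wpM2l// mulr_ge0// ltW.
have n4 : `|ra * B'| <= a * B * `|s|.
  rewrite normrM; apply: (@le_trans _ _ (2 * a * s ^+ 2 * (2 * B))).
    by apply: ler_pM.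
  rewrite -s2 expr2.
  have : 0 <= a * B * `|s| by rewrite !mulr_ge0// ltW.
  move: s4; move: (`|s|) => x; nra.
apply: (le_trans (ler_normD _ _)); have := ler_normD (a * s * (b * t + rb)) (ra * B').
have : 0 <= a * B * `|s| by rewrite !mulr_ge0// ltW.
lra.
Qed.

End ExpBounds.

Section Weight.
Context {R : realType}.
Variables (be et xst : R * R) (sb se : R).
Hypotheses (sb0 : 0 < sb) (se0 : 0 < se).

Definition arg_beta (p : R * R) : R := dot (p - xst) be / sb.
Definition arg_eta (p : R * R) : R := dot (p - xst) et / se.

(** The inverse weight, its derivatives in the directions beta and eta, and its
    partial derivatives. *)
Definition Theta p : R := Afac (arg_beta p) * Bfac (arg_eta p).
Definition Theta_beta p : R := dAfac (arg_beta p) * Bfac (arg_eta p) / sb.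
Definition Theta_eta p : R := Afac (arg_beta p) * dBfac (arg_eta p) / se.
Definition Theta_x p : R := be.1 * Theta_beta p + et.1 * Theta_eta p.
Definition Theta_y p : R := be.2 * Theta_beta p + et.2 * Theta_eta p.

Lemma omega_inv p :
  (g (arg_beta p) * g (arg_eta p) * g (- arg_eta p))^-1 = Theta p.
Proof.
rewrite /g /Theta /Afac /Bfac expRN.
have a := expR_gt0 (arg_beta p); have b := expR_gt0 (arg_eta p).
by field; do !(apply/andP; split); apply: lt0r_neq0; lra.
Qed.

Lemma slice_continuous_arg_beta : slice_continuous arg_beta.
Proof.
apply: slice_continuousM; last exact: slice_continuous_cst.
by apply: slice_continuousD; apply: slice_continuousM; try exact: slice_continuous_cst; apply: slice_continuousB;
  try exact: slice_continuous_cst; [exact: slice_continuous_fst|exact: slice_continuous_snd].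
Qed.

Lemma slice_continuous_arg_eta : slice_continuous arg_eta.
Proof.
apply: slice_continuousM; last exact: slice_continuous_cst.
by apply: slice_continuousD; apply: slice_continuousM; try exact: slice_continuous_cst; apply: slice_continuousB;
  try exact: slice_continuous_cst; [exact: slice_continuous_fst|exact: slice_continuous_snd].
Qed.

Let slice_continuous_e1 : slice_continuous (fun p => expR (arg_beta p)). Proof. exact/slice_continuous_expR/slice_continuous_arg_beta. Qed.
Let slice_continuous_e2 : slice_continuous (fun p => expR (arg_eta p)). Proof. exact/slice_continuous_expR/slice_continuous_arg_eta. Qed.
Let slice_continuous_e3 : slice_continuous (fun p => expR (- arg_eta p)).
Proof. exact/slice_continuous_expR/slice_continuousN/slice_continuous_arg_eta. Qed.

Let slice_continuous_A : slice_continuous (fun p => Afac (arg_beta p)).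
Proof. by apply: slice_continuousM; [apply: slice_continuousD|]; try exact: slice_continuous_cst. Qed.
Let slice_continuous_dA : slice_continuous (fun p => dAfac (arg_beta p)).
Proof. by apply: slice_continuousM => //; exact: slice_continuous_cst. Qed.
Let slice_continuous_B : slice_continuous (fun p => Bfac (arg_eta p)).
Proof.
apply: slice_continuousM; last exact: slice_continuous_cst.
by do !apply: slice_continuousD => //; exact: slice_continuous_cst.
Qed.
Let slice_continuous_dB : slice_continuous (fun p => dBfac (arg_eta p)).
Proof. by apply: slice_continuousM; [exact: slice_continuousB|exact: slice_continuous_cst]. Qed.

Lemma slice_continuous_Theta : slice_continuous Theta. Proof. exact: slice_continuousM. Qed.
Lemma slice_continuous_Theta_beta : slice_continuous Theta_beta.
Proof. by apply: slice_continuousM; [exact: slice_continuousM|exact: slice_continuous_cst]. Qed.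
Lemma slice_continuous_Theta_eta : slice_continuous Theta_eta.
Proof. by apply: slice_continuousM; [exact: slice_continuousM|exact: slice_continuous_cst]. Qed.
Lemma slice_continuous_Theta_x : slice_continuous Theta_x.
Proof.
by apply: slice_continuousD; apply: slice_continuousM; try exact: slice_continuous_cst; [exact: slice_continuous_Theta_beta|exact: slice_continuous_Theta_eta].
Qed.
Lemma slice_continuous_Theta_y : slice_continuous Theta_y.
Proof.
by apply: slice_continuousD; apply: slice_continuousM; try exact: slice_continuous_cst; [exact: slice_continuous_Theta_beta|exact: slice_continuous_Theta_eta].
Qed.

Let is_derive_AB (f h : R -> R) (x f' h' : R) :
  is_derive x 1 f f' -> is_derive x 1 h h' ->
  is_derive x 1 (fun x => Afac (f x) * Bfac (h x))
    (dAfac (f x) * Bfac (h x) * f' + Afac (f x) * dBfac (h x) * h').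
Proof.
move=> df dh.
have d1 : is_derive x 1 (fun x => expR (f x)) (expR (f x) * f').
    exact: (@is_derive1_comp _ expR f).
have d2 : is_derive x 1 (fun x => expR (h x)) (expR (h x) * h').
    exact: (@is_derive1_comp _ expR h).
have d3 : is_derive x 1 (fun x => expR (- h x)) (expR (- h x) * - h').
  exact: (@is_derive1_comp _ expR (fun x => - h x)).
rewrite /Afac /Bfac /dAfac /dBfac.
apply: is_derive_eq.
by rewrite /GRing.scale /=; field.
Qed.

Let is_derive_r (d1 d2 a b e : R) (x s : R) :
  is_derive x 1 (fun x : R => (((x - a) * d1 + b * d2) / s)) (d1 / s).
Proof.
apply: is_derive_eq.
by rewrite /GRing.scale /=; ring.
Qed.

Lemma is_derive_Theta_x (x y : R) : is_derive x 1 (fun x : R => Theta (x, y)) (Theta_x (x, y)).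
Proof.
have d1 := @is_derive_r be.1 be.2 xst.1 (y - xst.2) 0 x sb.
have d2 := @is_derive_r et.1 et.2 xst.1 (y - xst.2) 0 x se.
apply: (is_derive_eq (is_derive_AB d1 d2)).
by rewrite /Theta_x /Theta_beta /Theta_eta /arg_beta /arg_eta /dot /=; field; rewrite !lt0r_neq0.
Qed.

Lemma is_derive_Theta_y (x y : R) : is_derive y 1 (fun y : R => Theta (x, y)) (Theta_y (x, y)).
Proof.
have d1 := @is_derive_r be.2 be.1 xst.2 (x - xst.1) 0 y sb.
have d2 := @is_derive_r et.2 et.1 xst.2 (x - xst.1) 0 y se.
have := (is_derive_AB d1 d2).
rewrite (_ : (fun _ => _) = (fun y : R => Theta (x, y))); last first.
  by apply/funext => z; rewrite /Theta /arg_beta /arg_eta /dot /= addrC [X in Bfac (X / _)]addrC.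
move=> h; apply: (is_derive_eq h).
rewrite /Theta_y /Theta_beta /Theta_eta /arg_beta /arg_eta /dot /=.
rewrite ![_ + (x - xst.1) * _]addrC.
by field; rewrite !lt0r_neq0.
Qed.

Lemma grad_Theta p : grad Theta p = (Theta_x p, Theta_y p).
Proof.
case: p => x y; rewrite /grad derive_e1 derive_e2 /=.
by congr pair; apply: derive_val; [exact: is_derive_Theta_x|exact: is_derive_Theta_y].
Qed.

Lemma Theta_ge p : 1/2 <= Theta p.
Proof.
by rewrite /Theta; have := Afac_ge (arg_beta p); have := Bfac_ge1 (arg_eta p); nra.
Qed.
Lemma Theta_gt0 p : 0 < Theta p. Proof. by have := Theta_ge p; lra. Qed.

Lemma Theta_beta_gt0 p : 0 < Theta_beta p.
Proof. by rewrite /Theta_beta divr_gt0// mulr_gt0// ?dAfac_gt0// Bfac_gt0. Qed.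

Lemma Theta_beta_le p : sb * Theta_beta p <= Theta p.
Proof.
rewrite /Theta_beta mulrC divfK ?lt0r_neq0// /Theta ler_wpM2r ?dAfac_le//.
exact/ltW/Bfac_gt0.
Qed.

Lemma Theta_eta_le p : se * `|Theta_eta p| <= Theta p.
Proof.
rewrite /Theta_eta /Theta normrM [X in _ * (_ * X)]gtr0_norm ?invr_gt0// mulrC divfK ?lt0r_neq0//.
by rewrite normrM gtr0_norm ?Afac_gt0// ler_wpM2l ?dBfac_le//; exact/ltW/Afac_gt0.
Qed.

Lemma arg_betaD p d : arg_beta (p + d) = arg_beta p + dot d be / sb.
Proof. by rewrite /arg_beta /dot /= -mulrDl; congr (_ / _); ring. Qed.

Lemma arg_etaD p d : arg_eta (p + d) = arg_eta p + dot d et / se.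
Proof. by rewrite /arg_eta /dot /= -mulrDl; congr (_ / _); ring. Qed.

(** A displacement of at most half a decay length changes the exponentials by a
    factor at most e^(1/2) < 2. *)
Lemma Theta_harnack p d : `|dot d be / sb| + `|dot d et / se| <= 1/2 ->
  Theta (p + d) <= 2 * Theta p.
Proof.
move=> h; apply: (@le_trans _ _ (expR (`|dot d be / sb| + `|dot d et / se|) * Theta p)).
  rewrite expRD /Theta arg_betaD arg_etaD [leRHS]mulrACA; apply: ler_pM.
  - exact/ltW/Afac_gt0.
  - exact/ltW/Bfac_gt0.
  - exact: Afac_harnack.
  - exact: Bfac_harnack.
by rewrite ler_pM2r ?Theta_gt0// expR_half_le.
Qed.

Lemma Theta_beta_harnack p d : `|dot d be / sb| + `|dot d et / se| <= 1/2 ->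
  Theta_beta (p + d) <= 2 * Theta_beta p.
Proof.
move=> h; apply: (@le_trans _ _ (expR (`|dot d be / sb| + `|dot d et / se|) * Theta_beta p)).
  rewrite expRD /Theta_beta arg_betaD arg_etaD [leRHS]mulrA ler_pM2r ?invr_gt0// [leRHS]mulrACA; apply: ler_pM.
  - exact/ltW/dAfac_gt0.
  - exact/ltW/Bfac_gt0.
  - exact: dAfac_harnack.
  - exact: Bfac_harnack.
by rewrite ler_pM2r ?Theta_beta_gt0// expR_half_le.
Qed.

Lemma Theta_increment p d :
  Theta_x p * d.1 + Theta_y p * d.2 = dot d be * Theta_beta p + dot d et * Theta_eta p.
Proof. by rewrite /Theta_x /Theta_y /dot; ring. Qed.

Lemma Theta_taylor p d : `|dot d be / sb| <= 1/4 -> `|dot d et / se| <= 1/4 ->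
  `|Theta (p + d) - Theta p - (Theta_x p * d.1 + Theta_y p * d.2)| <=
  2 * Theta p * (dot d et / se) ^+ 2 + 2 * Theta_beta p * `|dot d be|.
Proof.
move=> h1 h2; have := @AB_taylor _ (arg_beta p) (arg_eta p) _ _ h1 h2.
rewrite -arg_betaD -arg_etaD -!/(Theta _) Theta_increment.
have -> : dAfac (arg_beta p) * (dot d be / sb) * Bfac (arg_eta p) = dot d be * Theta_beta p.
  by rewrite /Theta_beta; ring.
have -> : Afac (arg_beta p) * (dBfac (arg_eta p) * (dot d et / se)) = dot d et * Theta_eta p.
  by rewrite /Theta_eta; ring.
move=> h; apply: (le_trans h); rewrite lerD2l.
have sbV : 0 < sb^-1 by rewrite invr_gt0.
rewrite normrM (gtr0_norm sbV) /Theta_beta.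
by rewrite le_eqVlt; apply/orP; left; apply/eqP; ring.
Qed.

End Weight.

(** * Local interpolation error *)

Lemma norm_le1_of_sqr (R : realType) (x : R) : x ^+ 2 <= 1 -> `|x| <= 1.
Proof. by move=> h; rewrite ler_norml; apply/andP; split; nra. Qed.

Section LocalInterpolation.
Context {R : realType}.
Variables (be et xst : R * R) (sb se : R).
Hypotheses (sb0 : 0 < sb) (se0 : 0 < se).
Hypothesis unit_be : be.1 ^+ 2 + be.2 ^+ 2 = 1.
Hypothesis etE : et = (- be.2, be.1).
Variables (c : R * R) (u w n : R).
Hypotheses (u0 : u != 0) (w0 : w != 0) (n0 : 0 < n).
Hypotheses (un : `|u| <= 2 / n) (wn : `|w| <= 2 / n).
Hypotheses (sbn : 16 <= n * sb) (sen : 16 <= n * se).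

Local Notation Theta := (Theta be et xst sb se).
Local Notation Theta_beta := (Theta_beta be et xst sb se).
Local Notation Theta_eta := (Theta_eta be et xst sb se).
Local Notation Theta_x := (Theta_x be et xst sb se).
Local Notation Theta_y := (Theta_y be et xst sb se).
Local Notation T := (Theta c).
Local Notation S := (Theta_beta c).
Local Notation v1 := (vtx1 c u).
Local Notation v2 := (vtx2 c w).

Lemma be_le1 : `|be.1| <= 1 /\ `|be.2| <= 1.
Proof.
have h1 := sqr_ge0 be.1; have h2 := sqr_ge0 be.2; have h3 := unit_be.
by split; apply: norm_le1_of_sqr; lra.
Qed.

Lemma dot_be_le d : `|dot d be| <= `|d.1| + `|d.2|.
Proof.
have [h1 h2] := be_le1; rewrite /dot (le_trans (ler_normD _ _))// !normrM.
by rewrite lerD// ler_piMr.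
Qed.

Lemma dot_et_le d : `|dot d et| <= `|d.1| + `|d.2|.
Proof.
have [h1 h2] := be_le1; rewrite /dot etE /= (le_trans (ler_normD _ _))// !normrM normrN.
by rewrite lerD// ler_piMr.
Qed.

(** Displacements within a cell: by the lower bounds on sigma they are at most a
    quarter of a decay length in either direction. *)
Definition small (d : R * R) := `|d.1| <= 2 / n /\ `|d.2| <= 2 / n.

Lemma small_be d : small d -> `|dot d be| <= 4 / n.
Proof. by move=> [h1 h2]; apply: (le_trans (dot_be_le d)); lra. Qed.

Lemma small_et d : small d -> `|dot d et| <= 4 / n.
Proof. by move=> [h1 h2]; apply: (le_trans (dot_et_le d)); lra. Qed.

Lemma small_arg_beta d : small d -> `|dot d be / sb| <= 1/4.
Proof.
move=> /small_be h; rewrite normrM (gtr0_norm (_ : 0 < sb^-1)) ?invr_gt0// ler_pdivrMr//.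
apply: (le_trans h); rewrite ler_pdivrMr//; have := sbn; have := sen; lra.
Qed.

Lemma small_arg_eta d : small d -> `|dot d et / se| <= 1/4.
Proof.
move=> /small_et h; rewrite normrM (gtr0_norm (_ : 0 < se^-1)) ?invr_gt0// ler_pdivrMr//.
apply: (le_trans h); rewrite ler_pdivrMr//; have := sbn; have := sen; lra.
Qed.

Lemma smallN d : small d -> small (- d).
Proof. by case: d => x y [/= h1 h2]; split; rewrite /= normrN. Qed.

Lemma small_harnack p d : small d -> Theta (p + d) <= 2 * Theta p /\ Theta_beta (p + d) <= 2 * Theta_beta p.
Proof.
move=> sd; have h1 := small_arg_beta sd; have h2 := small_arg_eta sd.
by split; [apply: Theta_harnack|apply: Theta_beta_harnack] => //; lra.
Qed.

Lemma small_in_cell p : ctri c u w p ->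
  [/\ small (c - p), small (v1 - p) & small (v2 - p)].
Proof.
have aux (a e z : R) : e != 0 -> `|e| <= 2 / n -> 0 <= (z - a) / e <= 1 ->
    `|a - z| <= 2 / n /\ `|a + e - z| <= 2 / n.
  move=> e0 en /andP[h1 h2].
  have E : a - z = - (e * ((z - a) / e)) by rewrite mulrC divfK// opprB.
  have E' : a + e - z = e * (1 - (z - a) / e) by rewrite mulrBr mulr1 [e * (_ / e)]mulrC divfK//; ring.
  split; apply: le_trans en.
    by rewrite E normrN normrM ler_piMr// ger0_norm.
  by rewrite E' normrM ler_piMr// ger0_norm//; lra.
move=> [s t st].
have [a1 a2] : `|c.1 - p.1| <= 2 / n /\ `|c.1 + u - p.1| <= 2 / n.
  by apply: aux => //; rewrite s /=; lra.
have [b1 b2] : `|c.2 - p.2| <= 2 / n /\ `|c.2 + w - p.2| <= 2 / n.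
  by apply: aux => //; rewrite t /=; lra.
by split; split.
Qed.

Lemma T_comparable p : ctri c u w p ->
  [/\ Theta p <= 2 * T, T <= 2 * Theta p, Theta_beta p <= 2 * S & S <= 2 * Theta_beta p].
Proof.
move=> /small_in_cell[sc _ _].
have [h1 h2] := small_harnack p sc; have [h3 h4] := small_harnack c (smallN sc).
have e1 : p + (c - p) = c by rewrite addrC subrK.
have e2 : c - (c - p) = p by rewrite opprB addrC subrK.
by move: h1 h2 h3 h4; rewrite e1 e2.
Qed.

Variable q : R * R * R.
Local Notation G := (aff q).
Local Notation M := (vmax c u w G).
Definition gbeta : R := be.1 * q.1.2 + be.2 * q.2.
Definition geta : R := et.1 * q.1.2 + et.2 * q.2.

Lemma dq_dir d : q.1.2 * d.1 + q.2 * d.2 = gbeta * dot d be + geta * dot d et.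
Proof.
transitivity ((be.1 ^+ 2 + be.2 ^+ 2) * (q.1.2 * d.1 + q.2 * d.2)).
  by rewrite unit_be mul1r.
by rewrite /gbeta /geta /dot etE /=; ring.
Qed.

Lemma sqr_gradient : gbeta ^+ 2 + geta ^+ 2 = q.1.2 ^+ 2 + q.2 ^+ 2.
Proof.
transitivity ((be.1 ^+ 2 + be.2 ^+ 2) * (q.1.2 ^+ 2 + q.2 ^+ 2)).
  by rewrite /gbeta /geta etE /=; ring.
by rewrite unit_be mul1r.
Qed.

(** The second order Taylor remainder at the vertex v of the product of the
    inverse weight with the affine function G, expanded at p. The first order
    Taylor polynomial at p differs from the interpolant by the affine function
    with these vertex values. *)
Definition taylor_rem p v : R := Theta v * G v -
  (Theta p * G p + (Theta_x p * G p + Theta p * q.1.2) * (v - p).1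
              + (Theta_y p * G p + Theta p * q.2) * (v - p).2).

Lemma affD p d : G (p + d) = G p + (q.1.2 * d.1 + q.2 * d.2).
Proof. by rewrite /aff /=; ring. Qed.

(** As G is affine, the remainder consists of the product of the two increments
    and of G times the Taylor remainder of the inverse weight alone. *)
Lemma taylor_rem_le p v : small (v - p) ->
  `|taylor_rem p v| <= `|dot (v - p) be * Theta_beta p + dot (v - p) et * Theta_eta p| *
                `|q.1.2 * (v - p).1 + q.2 * (v - p).2|
   + (2 * Theta p * (dot (v - p) et / se) ^+ 2 + 2 * Theta_beta p * `|dot (v - p) be|) * `|G v|.
Proof.
move=> sd; set d := v - p; have vE : v = p + d by rewrite /d addrC subrK.
have ht := Theta_taylor xst sb0 p (small_arg_beta sd) (small_arg_eta sd).
rewrite -!/d in ht.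
have -> : taylor_rem p v = (Theta_x p * d.1 + Theta_y p * d.2) * (q.1.2 * d.1 + q.2 * d.2) +
    (Theta (p + d) - Theta p - (Theta_x p * d.1 + Theta_y p * d.2)) * G v.
  by rewrite /taylor_rem -/d; clearbody d; rewrite vE affD; ring.
apply: (le_trans (ler_normD _ _)); rewrite !normrM Theta_increment lerD// ler_wpM2r//.
by rewrite -Theta_increment.
Qed.

Section AtPoint.
Variable p : R * R.
Hypothesis Tp : ctri c u w p.

Lemma dq_le v : `|G v| <= M -> small (v - p) ->
  `|q.1.2 * (v - p).1 + q.2 * (v - p).2| <= 2 * M /\
  `|q.1.2 * (v - p).1 + q.2 * (v - p).2| <= 4 / n * (`|gbeta| + `|geta|).
Proof.
move=> Gv sd; split.
  have -> : q.1.2 * (v - p).1 + q.2 * (v - p).2 = G v - G p.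
    have {3}-> : v = p + (v - p) by rewrite addrC subrK.
    by rewrite affD; ring.
  have := aff_le_vmax u0 w0 q Tp; have := ler_normB (G v) (G p); lra.
rewrite dq_dir (le_trans (ler_normD _ _))// !normrM mulrDr.
by apply: lerD; rewrite mulrC ler_wpM2r// (small_be sd, small_et sd).
Qed.

(** The three terms come from the streamline variation of the weight, from its
    crosswind variation times the gradient of G, and from its second crosswind
    derivative. *)
Definition second_order_size : R := S * M / n + T * (`|gbeta| + `|geta|) / (n ^+ 2 * se) +
  T * M / (n ^+ 2 * se ^+ 2).

Lemma taylor_rem_coarse v : `|G v| <= M -> small (v - p) -> `|taylor_rem p v| <= 64 * second_order_size.
Proof.
move=> Gv sd; apply: (le_trans (taylor_rem_le sd)).
have [q1 q2] := dq_le Gv sd.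
have [T1 _ S1 _] := T_comparable Tp.
have hb := small_be sd; have he := small_et sd.
have M0 := vmax_ge0 c u w G.
have Tp0 := Theta_gt0 be et xst sb se p; have Sp0 := Theta_beta_gt0 be et xst se sb0 p.
have eh : `|Theta_eta p| <= Theta p / se by rewrite ler_pdivlMr// mulrC; exact: Theta_eta_le.
move: q1 q2; set Q := `|q.1.2 * _ + _|; set gg := `|gbeta| + _ => q1 q2.
have gg0 : 0 <= gg by rewrite addr_ge0.
have Q0 : 0 <= Q by exact: normr_ge0.
have n1 : 0 < 4 / n by rewrite divr_gt0.
have s1 : `|dot (v - p) be * Theta_beta p| * Q <= (4 / n * Theta_beta p) * (2 * M).
  rewrite normrM (gtr0_norm Sp0); apply: ler_pM => //.
    by rewrite mulr_ge0// ltW.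
  by rewrite ler_pM2r.
have s2 : `|dot (v - p) et * Theta_eta p| * Q <= (4 / n * (Theta p / se)) * (4 / n * gg).
  rewrite normrM; apply: ler_pM => //.
  by apply: ler_pM.
have s3 : (dot (v - p) et / se) ^+ 2 <= (4 / n / se) ^+ 2.
  rewrite -[leLHS]real_normK ?num_real// lerXn2r// ?nnegrE ?divr_ge0//; try exact: ltW.
  rewrite normrM (gtr0_norm (_ : 0 < se^-1)) ?invr_gt0//.
  by rewrite ler_wpM2r// invr_ge0 ltW.
have s4 : 2 * Theta p * (dot (v - p) et / se) ^+ 2 + 2 * Theta_beta p * `|dot (v - p) be| <=
    2 * Theta p * (4 / n / se) ^+ 2 + 2 * Theta_beta p * (4 / n).
  by apply: lerD; apply: ler_wpM2l => //; rewrite mulr_ge0// ltW.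
have s5 : (2 * Theta p * (dot (v - p) et / se) ^+ 2 + 2 * Theta_beta p * `|dot (v - p) be|) * `|G v| <=
    (2 * Theta p * (4 / n / se) ^+ 2 + 2 * Theta_beta p * (4 / n)) * M.
  apply: ler_pM => //.
  by apply: addr_ge0; apply: mulr_ge0 => //; rewrite ?sqr_ge0// mulr_ge0// ltW.
have s6 : `|dot (v - p) be * Theta_beta p + dot (v - p) et * Theta_eta p| * Q <=
   (4 / n * Theta_beta p) * (2 * M) + (4 / n * (Theta p / se)) * (4 / n * gg).
  apply: (@le_trans _ _ ((`|dot (v - p) be * Theta_beta p| + `|dot (v - p) et * Theta_eta p|) * Q)).
    by rewrite ler_wpM2r// ler_normD.
  by rewrite mulrDl lerD.
apply: (le_trans (lerD s6 s5)).
set a := M / n; set b := gg / (n ^+ 2 * se); set d := M / (n ^+ 2 * se ^+ 2).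
have a0 : 0 <= a by rewrite divr_ge0// ltW.
have b0 : 0 <= b by rewrite divr_ge0// ltW// mulr_gt0// exprn_gt0.
have d0 : 0 <= d by rewrite divr_ge0// ltW// mulr_gt0// exprn_gt0.
have -> : second_order_size = S * a + T * b + T * d by rewrite /second_order_size /a /b /d -/gg !mulrA.
have -> : 4 / n * Theta_beta p * (2 * M) + 4 / n * (Theta p / se) * (4 / n * gg) +
  (2 * Theta p * (4 / n / se) ^+ 2 + 2 * Theta_beta p * (4 / n)) * M =
  16 * (Theta_beta p * a) + 16 * (Theta p * b) + 32 * (Theta p * d).
  by rewrite /a /b /d; field; rewrite !lt0r_neq0.
have h1 := ler_wpM2r a0 S1; have h2 := ler_wpM2r b0 T1; have h3 := ler_wpM2r d0 T1.
have h4 : 0 <= Theta_beta p * a by rewrite mulr_ge0// ltW.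
have h5 : 0 <= Theta p * b by rewrite mulr_ge0// ltW.
lra.
Qed.

(** Nothing is gained here from the increment of G, which is bounded by twice
    its maximum, so that no mesh size appears. *)
Lemma taylor_rem_layer (kp : R) v : `|G v| <= M -> small (v - p) ->
  1 <= kp * (n * sb) -> 1 <= kp * (n * se) -> kp <= 1/16 ->
  `|taylor_rem p v| <= 52 * (kp * T * M).
Proof.
move=> Gv sd kb ke k16; apply: (le_trans (taylor_rem_le sd)).
have [q1 _] := dq_le Gv sd.
have [T1 _ _ _] := T_comparable Tp.
have hb := small_be sd; have he := small_et sd.
have M0 := vmax_ge0 c u w G.
have Tp0 := Theta_gt0 be et xst sb se p; have Sp0 := Theta_beta_gt0 be et xst se sb0 p.
have kp0 : 0 < kp by rewrite -(pmulr_lgt0 _ (mulr_gt0 n0 sb0)); lra.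
have ib : 4 / n / sb <= 4 * kp by rewrite !ler_pdivrMr//; lra.
have ie : 4 / n / se <= 4 * kp by rewrite !ler_pdivrMr//; lra.
have eh : `|Theta_eta p| <= Theta p / se by rewrite ler_pdivlMr// mulrC; exact: Theta_eta_le.
have bh : Theta_beta p <= Theta p / sb by rewrite ler_pdivlMr// mulrC; exact: Theta_beta_le.
move: q1; set Q := `|q.1.2 * _ + _| => q1.
have Q0 : 0 <= Q by exact: normr_ge0.
have n1 : 0 < 4 / n by rewrite divr_gt0.
have r1 : `|dot (v - p) be| * Theta_beta p <= 4 * kp * Theta p.
  apply: (@le_trans _ _ (4 / n * (Theta p / sb))).
    by apply: ler_pM => //; exact: ltW.
  rewrite [leLHS](_ : _ = 4 / n / sb * Theta p); last by field; rewrite !lt0r_neq0.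
  by rewrite ler_pM2r.
have r2 : `|dot (v - p) et| * `|Theta_eta p| <= 4 * kp * Theta p.
  apply: (@le_trans _ _ (4 / n * (Theta p / se))).
    by apply: ler_pM.
  rewrite [leLHS](_ : _ = 4 / n / se * Theta p); last by field; rewrite !lt0r_neq0.
  by rewrite ler_pM2r.
have s6 : `|dot (v - p) be * Theta_beta p + dot (v - p) et * Theta_eta p| <= 8 * kp * Theta p.
  apply: (le_trans (ler_normD _ _)).
  rewrite [`|dot (v - p) be * _|]normrM [`|dot (v - p) et * _|]normrM (gtr0_norm Sp0); lra.
have s3 : (dot (v - p) et / se) ^+ 2 <= kp.
  apply: (@le_trans _ _ ((4 * kp) ^+ 2)).
    rewrite -[leLHS]real_normK ?num_real// lerXn2r// ?nnegrE ?divr_ge0//.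
      by rewrite mulr_ge0// ltW.
    apply: le_trans ie; rewrite normrM (gtr0_norm (_ : 0 < se^-1)) ?invr_gt0//.
    by rewrite ler_wpM2r// invr_ge0 ltW.
  nra.
have s7 : (2 * Theta p * (dot (v - p) et / se) ^+ 2 + 2 * Theta_beta p * `|dot (v - p) be|) <=
   10 * kp * Theta p.
  have := ler_wpM2l (ltW Tp0) s3; lra.
apply: (@le_trans _ _ (8 * kp * Theta p * (2 * M) + 10 * kp * Theta p * M)).
  apply: lerD; apply: ler_pM => //.
  by apply: addr_ge0; apply: mulr_ge0 => //; rewrite ?sqr_ge0// mulr_ge0// ltW.
have := ler_wpM2r (mulr_ge0 (ltW kp0) M0) T1; lra.
Qed.

Lemma Theta_diff (kp : R) v : small (v - p) ->
  1 <= kp * (n * sb) -> 1 <= kp * (n * se) -> kp <= 1/16 ->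
  `|Theta v - Theta p| <= 18 * kp * Theta p.
Proof.
move=> sd kb ke k16.
have hb := small_be sd; have he := small_et sd.
have Tp0 := Theta_gt0 be et xst sb se p; have Sp0 := Theta_beta_gt0 be et xst se sb0 p.
have kp0 : 0 < kp by rewrite -(pmulr_lgt0 _ (mulr_gt0 n0 sb0)); lra.
have ib : 4 / n / sb <= 4 * kp by rewrite !ler_pdivrMr//; lra.
have ie : 4 / n / se <= 4 * kp by rewrite !ler_pdivrMr//; lra.
have eh : `|Theta_eta p| <= Theta p / se by rewrite ler_pdivlMr// mulrC; exact: Theta_eta_le.
have bh : Theta_beta p <= Theta p / sb by rewrite ler_pdivlMr// mulrC; exact: Theta_beta_le.
have n1 : 0 < 4 / n by rewrite divr_gt0.
have r1 : `|dot (v - p) be| * Theta_beta p <= 4 * kp * Theta p.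
  apply: (@le_trans _ _ (4 / n * (Theta p / sb))).
    by apply: ler_pM => //; exact: ltW.
  rewrite [leLHS](_ : _ = 4 / n / sb * Theta p); last by field; rewrite !lt0r_neq0.
  by rewrite ler_pM2r.
have r2 : `|dot (v - p) et| * `|Theta_eta p| <= 4 * kp * Theta p.
  apply: (@le_trans _ _ (4 / n * (Theta p / se))).
    by apply: ler_pM.
  rewrite [leLHS](_ : _ = 4 / n / se * Theta p); last by field; rewrite !lt0r_neq0.
  by rewrite ler_pM2r.
have s3 : (dot (v - p) et / se) ^+ 2 <= kp.
  apply: (@le_trans _ _ ((4 * kp) ^+ 2)).
    rewrite -[leLHS]real_normK ?num_real// lerXn2r// ?nnegrE ?divr_ge0//.
      by rewrite mulr_ge0// ltW.
    apply: le_trans ie; rewrite normrM (gtr0_norm (_ : 0 < se^-1)) ?invr_gt0//.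
    by rewrite ler_wpM2r// invr_ge0 ltW.
  nra.
have ht := Theta_taylor xst sb0 p (small_arg_beta sd) (small_arg_eta sd).
rewrite (addrC p) subrK Theta_increment in ht.
have s7 := ler_wpM2l (ltW Tp0) s3.
have h1 := ler_normD (Theta v - Theta p - (dot (v - p) be * Theta_beta p + dot (v - p) et * Theta_eta p))
  (dot (v - p) be * Theta_beta p + dot (v - p) et * Theta_eta p).
rewrite subrK in h1.
have h2 := ler_normD (dot (v - p) be * Theta_beta p) (dot (v - p) et * Theta_eta p).
rewrite [`|dot (v - p) be * _|]normrM [`|dot (v - p) et * _|]normrM (gtr0_norm Sp0) in h2.
lra.
Qed.

Variable q' : R * R * R.
Local Notation I := (aff q').
Hypotheses (I0 : I c = Theta c * G c) (I1 : I v1 = Theta v1 * G v1) (I2 : I v2 = Theta v2 * G v2).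

Definition interp_err : R := Theta p * G p - I p.
Definition interp_err_x : R := Theta_x p * G p + Theta p * q.1.2 - q'.1.2.
Definition interp_err_y : R := Theta_y p * G p + Theta p * q.2 - q'.2.

(** Up to sign, the interpolation error at p and its gradient are the value and
    the gradient at p of the affine function whose vertex values are the three
    remainders, since the interpolant agrees with the product at the vertices. *)
Lemma interp_err_le X : `|taylor_rem p c| <= X -> `|taylor_rem p v1| <= X -> `|taylor_rem p v2| <= X ->
  [/\ `|interp_err| <= 5 * X, `|interp_err_x| * `|u| <= 2 * X & `|interp_err_y| * `|w| <= 2 * X].
Proof.
move=> h0 h1 h2; have [s t st] := Tp.
have e1 : interp_err_x * u = taylor_rem p c - taylor_rem p v1.
  by rewrite /taylor_rem -I0 -I1 /interp_err_x /aff /=; ring.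
have e2 : interp_err_y * w = taylor_rem p c - taylor_rem p v2.
  by rewrite /taylor_rem -I0 -I2 /interp_err_y /aff /=; ring.
have n1 : `|interp_err_x| * `|u| <= 2 * X.
  by rewrite -normrM e1; apply: (le_trans (ler_normB _ _)); lra.
have n2 : `|interp_err_y| * `|w| <= 2 * X.
  by rewrite -normrM e2; apply: (le_trans (ler_normB _ _)); lra.
split=> //.
have -> : interp_err = - taylor_rem p c + ((p.1 - c.1) / u * (interp_err_x * u) + (p.2 - c.2) / w * (interp_err_y * w)).
  by rewrite /taylor_rem -I0 /interp_err /interp_err_x /interp_err_y /aff /=; field; rewrite u0 w0.
apply: (le_trans (ler_normD _ _)); rewrite normrN.
have := ler_normD ((p.1 - c.1) / u * (interp_err_x * u)) ((p.2 - c.2) / w * (interp_err_y * w)).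
rewrite [in X in _ <= X]normrM [in X in _ <= _ + X]normrM (ger0_norm s) (ger0_norm t).
rewrite normrM [in X in _ <= _ + _ * X]normrM.
have a1 : (p.1 - c.1) / u * (`|interp_err_x| * `|u|) <= 2 * X.
  by apply: le_trans n1; apply: ler_piMl; [rewrite mulr_ge0|lra].
have a2 : (p.2 - c.2) / w * (`|interp_err_y| * `|w|) <= 2 * X.
  by apply: le_trans n2; apply: ler_piMl; [rewrite mulr_ge0|lra].
lra.
Qed.

Lemma interp_err_coarse : [/\ `|interp_err| <= 320 * second_order_size, `|interp_err_x| * `|u| <= 128 * second_order_size &
  `|interp_err_y| * `|w| <= 128 * second_order_size].
Proof.
have [s0 s1 s2] := small_in_cell Tp.
have [h1 h2 h3] := interp_err_le (taylor_rem_coarse (le_vmax0 c u w G) s0)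
  (taylor_rem_coarse (le_vmax1 c u w G) s1) (taylor_rem_coarse (le_vmax2 c u w G) s2).
by split; lra.
Qed.

End AtPoint.

Section Layer.
Variable kp : R.
Hypotheses (kb : 1 <= kp * (n * sb)) (ke : 1 <= kp * (n * se)) (k16 : kp <= 1/16).

Lemma kp_gt0 : 0 < kp.
Proof. by rewrite -(pmulr_lgt0 _ (mulr_gt0 n0 sb0)); have := kb; lra. Qed.

Lemma Theta_grad_le p : `|Theta_x p| <= 2 * kp * n * Theta p /\ `|Theta_y p| <= 2 * kp * n * Theta p.
Proof.
have [b1 b2] := be_le1; have kb' := kb; have ke' := ke.
have Tp0 := Theta_gt0 be et xst sb se p; have Sp0 := Theta_beta_gt0 be et xst se sb0 p.
have h1 : Theta_beta p <= kp * n * Theta p.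
  have := Theta_beta_le be et xst se sb0 p; rewrite mulrC -ler_pdivlMr// => h.
  apply: (le_trans h); rewrite ler_pdivrMr//.
  have := ler_wpM2l (ltW Tp0) kb'; lra.
have h2 : `|Theta_eta p| <= kp * n * Theta p.
  have := Theta_eta_le be et xst sb se0 p; rewrite mulrC -ler_pdivlMr// => h.
  apply: (le_trans h); rewrite ler_pdivrMr//.
  have := ler_wpM2l (ltW Tp0) ke'; lra.
have aux (x y : R) : `|x| <= 1 -> `|y| <= 1 -> `|x * Theta_beta p + y * Theta_eta p| <= 2 * kp * n * Theta p.
  move=> x1 y1; apply: (le_trans (ler_normD _ _)).
  have -> : `|x * Theta_beta p| = `|x| * Theta_beta p by rewrite normrM (gtr0_norm Sp0).
  have -> : `|y * Theta_eta p| = `|y| * `|Theta_eta p| by rewrite normrM.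
  have a1 : `|x| * Theta_beta p <= Theta_beta p by rewrite ler_piMl// ltW.
  have a2 : `|y| * `|Theta_eta p| <= `|Theta_eta p| by rewrite ler_piMl.
  lra.
by split; apply: aux; rewrite ?etE //= normrN.
Qed.

(** The bound is proportional to the length of the edge, so that the difference
    quotient along a short edge stays bounded. *)
Lemma Theta_edge a d : small d -> (d.1 = 0 \/ d.2 = 0) ->
  `|Theta (a + d) - Theta a| <= 6 * kp * n * (`|d.1| + `|d.2|) * Theta a.
Proof.
move=> sd d0; set l := `|d.1| + `|d.2|.
have kb' := kb; have ke' := ke; have kp0 := kp_gt0.
have Tp0 := Theta_gt0 be et xst sb se a; have Sp0 := Theta_beta_gt0 be et xst se sb0 a.
have l0 : 0 <= l by rewrite addr_ge0.
have h1 : Theta_beta a <= kp * n * Theta a.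
  have := Theta_beta_le be et xst se sb0 a; rewrite mulrC -ler_pdivlMr// => h.
  apply: (le_trans h); rewrite ler_pdivrMr//.
  have := ler_wpM2l (ltW Tp0) kb'; lra.
have h2 : `|Theta_eta a| <= kp * n * Theta a.
  have := Theta_eta_le be et xst sb se0 a; rewrite mulrC -ler_pdivlMr// => h.
  apply: (le_trans h); rewrite ler_pdivrMr//.
  have := ler_wpM2l (ltW Tp0) ke'; lra.
have hb : `|dot d be| <= l by exact: dot_be_le.
have he : `|dot d et| <= l by exact: dot_et_le.
have hes : `|dot d et / se| <= kp * n * l.
  rewrite normrM (gtr0_norm (_ : 0 < se^-1)) ?invr_gt0// ler_pdivrMr//.
  apply: (le_trans he); have := ler_wpM2l l0 ke'; lra.
have hs : (dot d et / se) ^+ 2 <= kp * n * l.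
  rewrite -real_normK ?num_real// expr2.
  apply: le_trans hes; rewrite ler_piMl//.
  by apply: (le_trans (small_arg_eta sd)); lra.
have ht := Theta_taylor xst sb0 a (small_arg_beta sd) (small_arg_eta sd).
rewrite Theta_increment in ht.
have h := ler_normD (Theta (a + d) - Theta a - (dot d be * Theta_beta a + dot d et * Theta_eta a))
  (dot d be * Theta_beta a + dot d et * Theta_eta a).
rewrite subrK in h.
have h' := ler_normD (dot d be * Theta_beta a) (dot d et * Theta_eta a).
rewrite [`|dot d be * _|]normrM [`|dot d et * _|]normrM (gtr0_norm Sp0) in h'.
have r1 : `|dot d be| * Theta_beta a <= l * (kp * n * Theta a) by apply: ler_pM => //; exact: ltW.
have r2 : `|dot d et| * `|Theta_eta a| <= l * (kp * n * Theta a) by apply: ler_pM.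
have r3 := ler_wpM2l (ltW Tp0) hs.
lra.
Qed.

Variables (p : R * R) (q' : R * R * R).
Hypothesis Tp : ctri c u w p.
Local Notation I := (aff q').
Hypotheses (I0 : I c = Theta c * G c) (I1 : I v1 = Theta v1 * G v1) (I2 : I v2 = Theta v2 * G v2).

(** The slope of the interpolant along an edge is that of G times the weight at
    the far end, plus G at the corner times the difference quotient of the
    weight; comparison with the product rule never divides a remainder by the
    fine mesh size. *)
Lemma interp_err_layer :
  [/\ `|interp_err p q'| <= 260 * (kp * T * M),
      `|interp_err_x p q'| <= 10 * (kp * n * T * M) + 36 * (kp * T * `|q.1.2|) &
      `|interp_err_y p q'| <= 10 * (kp * n * T * M) + 36 * (kp * T * `|q.2|)].
Proof.
have [s0 s1 s2] := small_in_cell Tp.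
have kp0 := kp_gt0; have M0 := vmax_ge0 c u w G.
have h v Gv sv := @taylor_rem_layer p Tp kp v Gv sv kb ke k16.
have [h1 _ _] := interp_err_le Tp I0 I1 I2 (h _ (le_vmax0 c u w G) s0)
  (h _ (le_vmax1 c u w G) s1) (h _ (le_vmax2 c u w G) s2).
have [T1 _ _ _] := T_comparable Tp.
have T0 := Theta_gt0 be et xst sb se c.
have [g1 g2] := Theta_grad_le p.
have Gp := aff_le_vmax u0 w0 q Tp.
have Gc := le_vmax0 c u w G.
have f1 : `|Theta p - Theta v1| <= 18 * kp * Theta p by rewrite distrC; exact: Theta_diff.
have f2 : `|Theta p - Theta v2| <= 18 * kp * Theta p by rewrite distrC; exact: Theta_diff.
have e1 : `|Theta v1 - T| <= 6 * kp * n * `|u| * T.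
  have := @Theta_edge c (u, 0); rewrite /small /= normr0 addr0 => H.
  have -> : v1 = c + (u, 0) by rewrite /vtx1; case: (c) => a b; congr pair; rewrite /= addr0.
  by apply: H; [split=> //; rewrite divr_ge0// ltW|right].
have e2 : `|Theta v2 - T| <= 6 * kp * n * `|w| * T.
  have := @Theta_edge c (0, w); rewrite /small /= normr0 add0r => H.
  have -> : v2 = c + (0, w) by rewrite /vtx2; case: (c) => a b; congr pair; rewrite /= addr0.
  by apply: H; [split=> //; rewrite divr_ge0// ltW|left].
have kn0 : 0 <= kp * n by rewrite mulr_ge0// ltW.
have fin (z dTh dif edge qz : R) : z != 0 -> `|dTh| <= 2 * kp * n * Theta p ->
    `|dif| <= 18 * kp * Theta p -> `|edge| <= 6 * kp * n * `|z| * T ->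
    `|dTh * G p + dif * qz - G c * (edge / z)| <=
      10 * (kp * n * T * M) + 36 * (kp * T * `|qz|).
  move=> z0 a1 a2 a3.
  have b1 : `|dTh * G p| <= 2 * kp * n * (2 * T) * M.
    rewrite normrM; apply: ler_pM => //; apply: (le_trans a1).
    by have := ler_wpM2l kn0 T1; lra.
  have b2 : `|dif * qz| <= 18 * kp * (2 * T) * `|qz|.
    by rewrite normrM ler_wpM2r//; apply: (le_trans a2); have := ler_wpM2l (ltW kp0) T1; lra.
  have b3 : `|G c * (edge / z)| <= M * (6 * kp * n * T).
    rewrite normrM; apply: ler_pM => //.
    rewrite normrM normfV ler_pdivrMr ?normr_gt0//.
    by apply: (le_trans a3); rewrite mulrAC.
  have := ler_normB (dTh * G p + dif * qz) (G c * (edge / z)).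
  have := ler_normD (dTh * G p) (dif * qz).
  lra.
split; first by apply: (le_trans h1); lra.
- have -> : interp_err_x p q' = Theta_x p * G p + (Theta p - Theta v1) * q.1.2 - G c * ((Theta v1 - T) / u).
    have : q'.1.2 * u = Theta v1 * G v1 - Theta c * G c by rewrite -I0 -I1 /aff /=; ring.
    have -> : G v1 = G c + q.1.2 * u by rewrite /aff /=; ring.
    move=> e; have -> : interp_err_x p q' = Theta_x p * G p + Theta p * q.1.2 - (q'.1.2 * u) / u.
      by rewrite mulfK.
    by rewrite e; field.
  exact: fin.
- have -> : interp_err_y p q' = Theta_y p * G p + (Theta p - Theta v2) * q.2 - G c * ((Theta v2 - T) / w).
    have : q'.2 * w = Theta v2 * G v2 - Theta c * G c by rewrite -I0 -I2 /aff /=; ring.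
    have -> : G v2 = G c + q.2 * w by rewrite /aff /=; ring.
    move=> e; have -> : interp_err_y p q' = Theta_y p * G p + Theta p * q.2 - (q'.2 * w) / w.
      by rewrite mulfK.
    by rewrite e; field.
  exact: fin.
Qed.

End Layer.

End LocalInterpolation.

(** * The Shishkin mesh and its nodal interpolant *)

Section MeshFacts.
Context {R : realType}.
Variables (N : nat) (lam : R).
Hypotheses (N0 : (0 < N)%N) (evN : ~~ odd N) (lam0 : 0 < lam) (lam2 : lam <= 1/2).
Local Notation n := (N%:R : R).
Local Notation mp := (mesh_point N lam).

Definition coarse_h : R := 2 * (1 - lam) / n.
Definition fine_h : R := 2 * lam / n.

Lemma n_gt0 : 0 < n. Proof. by rewrite ltr0n. Qed.

Lemma half_nat : (N./2 + N./2)%N = N.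
Proof. by have := odd_double_half N; rewrite (negbTE evN) add0n addnn. Qed.

Lemma half_R : (N./2)%:R = n / 2 :> R.
Proof. by rewrite -[in RHS]half_nat natrD; field. Qed.

Lemma coarse_h_gt0 : 0 < coarse_h.
Proof. by rewrite divr_gt0 ?n_gt0// mulr_gt0//; have := lam2; lra. Qed.

Lemma fine_h_gt0 : 0 < fine_h.
Proof. by rewrite divr_gt0 ?n_gt0// mulr_gt0. Qed.

Lemma fine_h_le : fine_h <= coarse_h.
Proof. by rewrite ler_pM2r ?invr_gt0 ?n_gt0//; have := lam2; lra. Qed.

Lemma coarse_h_le : coarse_h <= 2 / n.
Proof. by rewrite ler_pM2r ?invr_gt0 ?n_gt0//; have := lam0; lra. Qed.

Lemma coarse_h_ge : n^-1 <= coarse_h.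
Proof.
rewrite /coarse_h -[leLHS]mul1r ler_pM2r ?invr_gt0 ?n_gt0//; have := lam2; lra.
Qed.

Lemma mesh_coarse i : (i <= N./2)%N -> mp i = i%:R * coarse_h.
Proof. by move=> h; rewrite /mesh_point h /coarse_h; ring. Qed.

Lemma mesh_fine i : (N./2 <= i)%N -> mp i = 1 - (n - i%:R) * fine_h.
Proof.
move=> h; rewrite /mesh_point; case: ifPn => [h'|_]; last by rewrite /fine_h; ring.
have -> : i = N./2 by apply/eqP; rewrite eqn_leq h h'.
by rewrite half_R /fine_h; field; rewrite lt0r_neq0// n_gt0.
Qed.

Lemma mesh_step i : mp i.+1 - mp i = if (i < N./2)%N then coarse_h else fine_h.
Proof.
case: ltnP => h.
  by rewrite !mesh_coarse// ?(ltnW h)// -natr1; ring.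
by rewrite !mesh_fine// ?(leq_trans h)// -natr1; ring.
Qed.

Lemma mesh_lt i : mp i < mp i.+1.
Proof.
by rewrite -subr_gt0 mesh_step; case: ifP => _; rewrite ?coarse_h_gt0// fine_h_gt0.
Qed.

Lemma mesh_mono i j : (i <= j)%N -> mp i <= mp j.
Proof.
elim: j => [|j ih]; first by rewrite leqn0 => /eqP ->.
rewrite leq_eqVlt => /orP[/eqP -> //|ij].
exact: le_trans (ih ij) (ltW (mesh_lt j)).
Qed.

Lemma mesh_0 : mp 0 = 0. Proof. by rewrite mesh_coarse// mul0r. Qed.
Lemma mesh_N : mp N = 1.
Proof. by rewrite mesh_fine ?subrr ?mul0r ?subr0// -[leqRHS]half_nat leq_addr. Qed.
Lemma mesh_half : mp N./2 = 1 - lam.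
Proof.
by rewrite mesh_coarse// half_R /coarse_h; field; rewrite lt0r_neq0// n_gt0.
Qed.

(** The piecewise affine inverse of the mesh function, which is convex because
    the mesh is finer on the right; hence it is a maximum of two affine
    functions. *)
Definition mesh_idx (x : R) : R := Num.max (x / coarse_h) (n - (1 - x) / fine_h).

Lemma mesh_idx_cell i x : (i < N)%N -> mp i <= x <= mp i.+1 ->
  mesh_idx x = i%:R + (x - mp i) / (mp i.+1 - mp i).
Proof.
move=> iN /andP[x0 x1].
have c0 := coarse_h_gt0; have f0 := fine_h_gt0; have fc := fine_h_le.
have ic : 0 < coarse_h^-1 by rewrite invr_gt0.
have icf : coarse_h^-1 <= fine_h^-1 by rewrite lef_pV2.
have eh : n / 2 * coarse_h = 1 - lam.
  by rewrite /coarse_h; field; rewrite lt0r_neq0// n_gt0.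
have ef : n / 2 * fine_h = lam.
  by rewrite /fine_h; field; rewrite lt0r_neq0// n_gt0.
have e1 : x / coarse_h = n / 2 + (x - (1 - lam)) / coarse_h.
  by rewrite -eh; field; rewrite lt0r_neq0.
have e2 : n - (1 - x) / fine_h = n / 2 + (x - (1 - lam)) / fine_h.
  rewrite -[X in x - (1 - X)]ef; field; rewrite lt0r_neq0//.
rewrite mesh_step /mesh_idx; case: ltnP => h.
  rewrite max_l.
    by rewrite mesh_coarse ?(ltnW h)//; field; rewrite lt0r_neq0.
  rewrite e1 e2 lerD2l.
  have : x <= 1 - lam by rewrite (le_trans x1)// -mesh_half; exact: mesh_mono.
  by rewrite -subr_le0 => xl; rewrite ler_wnM2l.
rewrite max_r.
  by rewrite mesh_fine//; field; rewrite lt0r_neq0.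
rewrite e1 e2 lerD2l.
have : 1 - lam <= x by rewrite (le_trans _ x0)// -mesh_half; exact: mesh_mono.
by rewrite -subr_ge0 => xl; rewrite ler_wpM2l.
Qed.

Lemma mesh_idx_node i : (i <= N)%N -> mesh_idx (mp i) = i%:R.
Proof.
rewrite leq_eqVlt => /orP[/eqP ->|iN]; last first.
  by rewrite (mesh_idx_cell iN) ?lexx ?subrr ?mul0r ?addr0//= ltW// mesh_lt.
have N1 : (N.-1 < N)%N by rewrite prednK.
rewrite (mesh_idx_cell N1) prednK// ?lexx ?andbT.
  rewrite divff ?natr1 ?prednK// subr_eq0 gt_eqF//.
  by have := mesh_lt N.-1; rewrite prednK.
by apply: mesh_mono; rewrite leq_pred.
Qed.

Lemma continuous_mesh_idx : continuous mesh_idx.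
Proof.
move=> x; apply: (@continuous_max _ _ (fun x : R => x / coarse_h) (fun x : R => n - (1 - x) / fine_h)).
  by apply: continuousM; [exact: cvg_id|exact: cst_continuous].
apply: continuousB; first exact: cst_continuous.
apply: continuousM; last exact: cst_continuous.
by apply: continuousB; [exact: cst_continuous|exact: cvg_id].
Qed.

End MeshFacts.

Section Hat.
Context {R : realType}.

(** The nodal basis function at the origin for the triangulation of the plane by
    the lines s, t, s + t integer: its support is the hexagon formed by the six
    triangles around the origin. *)
Definition hat (s t : R) : R :=
  Num.max 0 (1 - Num.max `|s| (Num.max `|t| `|s + t|)).

Lemma hat_sym s t : hat (- s) (- t) = hat s t.
Proof. by rewrite /hat -opprD !normrN. Qed.

Lemma hat_le0 s t : (1 <= `|s|) || (1 <= `|t|) -> hat s t = 0.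
Proof.
move=> h; rewrite /hat max_l// subr_le0 !le_max.
by case/orP: h => ->; rewrite ?orbT.
Qed.

Lemma hat0 : hat 0 0 = 1.
Proof. by rewrite /hat addr0 normr0 !maxxx subr0 max_r. Qed.

Lemma normr_intr_ge1 (a : int) : a != 0 -> 1 <= `|a%:~R : R|.
Proof. by move=> a0; rewrite -intr_norm ler1z; lia. Qed.

Lemma hat_int (a b : int) : hat a%:~R b%:~R = ((a == 0) && (b == 0))%:R.
Proof.
have [->|a0] := eqVneq a 0; last by rewrite hat_le0// normr_intr_ge1.
have [->|b0] := eqVneq b 0; first by rewrite hat0.
by rewrite hat_le0// (normr_intr_ge1 b0) orbT.
Qed.

Lemma hatE_max (s t v : R) : `|s| <= v -> `|t| <= v -> `|s + t| <= v -> v <= 1 ->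
  (v == `|s|) || ((v == `|t|) || (v == `|s + t|)) -> hat s t = 1 - v.
Proof.
move=> h1 h2 h3 v1 hv; rewrite /hat.
have -> : Num.max `|s| (Num.max `|t| `|s + t|) = v.
  apply/eqP; rewrite eq_le !ge_max h1 h2 h3 /= !le_max.
  by case/orP: hv => [/eqP ->|/orP[]/eqP ->]; rewrite lexx ?orbT.
by rewrite max_r// subr_ge0.
Qed.

(** Only three translates of the unit triangle meet the interior of the support;
    on each of them one of |s|, |t|, |s + t| is the largest. *)
Lemma hat_affine (a b : int) : exists k0 k1 k2 : R, forall s t : R,
  0 <= s -> 0 <= t -> s + t <= 1 ->
  hat (s + a%:~R) (t + b%:~R) = k0 + k1 * s + k2 * t.
Proof.
have far (d : int) (s : R) : 0 <= s -> s <= 1 -> (1 <= d) || (d <= -2) ->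
    1 <= `|s + d%:~R|.
  move=> s0 s1 /orP[d1|d2]; rewrite ler_normr; apply/orP; [left|right].
    have : (1 : R) <= d%:~R by rewrite -(ler_int R) in d1.
    lra.
  have : (d%:~R : R) <= -2 by rewrite -(ler_int R) in d2.
  lra.
have [ha|ha] := boolP ((1 <= a) || (a <= -2)).
  exists 0, 0, 0; move=> s t s0 t0 st; rewrite hat_le0; first by ring.
  by apply/orP; left; apply: far => //; lra.
have [hb|hb] := boolP ((1 <= b) || (b <= -2)).
  exists 0, 0, 0; move=> s t s0 t0 st; rewrite hat_le0; first by ring.
  by apply/orP; right; apply: far => //; lra.
have int01 (d : int) : ~~ ((1 <= d) || (d <= -2)) -> d = 0 \/ d = -1.
  by move=> h; lia.
have [->|->] := int01 _ ha; have [->|->] := int01 _ hb; rewrite ?mulr0z ?mulrN1z.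
- exists 1, (-1), (-1); move=> s t s0 t0 st.
  rewrite !addr0 (@hatE_max _ _ (s + t)) ?ger0_norm ?eqxx ?orbT//; lra.
- exists 0, 0, 1; move=> s t s0 t0 st.
  rewrite addr0 (@hatE_max _ _ (1 - t)); first lra.
  + by rewrite ger0_norm//; lra.
  + by rewrite ler0_norm; lra.
  + by rewrite ler0_norm; lra.
  + lra.
  + by rewrite [X in _ || (X || _)](_ : _ = true) ?orbT// ler0_norm; [rewrite opprB eqxx|lra].
- exists 0, 1, 0; move=> s t s0 t0 st.
  rewrite addr0 (@hatE_max _ _ (1 - s)); first lra.
  + by rewrite ler0_norm; lra.
  + by rewrite ger0_norm//; lra.
  + by rewrite ler0_norm; lra.
  + lra.
  + by rewrite ler0_norm; [rewrite opprB eqxx|lra].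
- exists 0, 0, 0; move=> s t s0 t0 st; rewrite /hat max_l; first by ring.
  rewrite subr_le0 !le_max; apply/orP; right; apply/orP; right.
  by rewrite ler0_norm; lra.
Qed.

Lemma continuous_hat_comp (T : topologicalType) (f g : T -> R) :
  continuous f -> continuous g -> continuous (fun x => hat (f x) (g x)).
Proof.
move=> cf cg.
have cn (h : T -> R) : continuous h -> continuous (fun x => `|h x|).
  by move=> ch x; apply: continuous_comp; [exact: ch|exact: norm_continuous].
have cm (h h' : T -> R) : continuous h -> continuous h' ->
    continuous (fun x => Num.max (h x) (h' x)).
  by move=> ch ch' x; apply: continuous_max; [exact: ch|exact: ch'].
have cs (h : T -> R) : continuous h -> continuous (fun x => 1 - h x).
  by move=> ch x; apply: cvgB; [exact: cvg_cst|exact: ch].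
have ca (h h' : T -> R) : continuous h -> continuous h' ->
    continuous (fun x => h x + h' x).
  by move=> ch ch' x; apply: cvgD; [exact: ch|exact: ch'].
apply: (cm (fun=> 0)); first by move=> x; exact: cst_continuous.
exact: (cs _ (cm _ _ (cn _ cf) (cm _ _ (cn _ cg) (cn _ (ca _ _ cf cg))))).
Qed.

End Hat.

(** Index coordinates relative to the opposite corner of a cell, in which its
    upper triangle becomes a translate of the lower one. *)
Lemma cell_coord_flip (R : realType) (k i x X Y : R) : Y - X != 0 ->
  - (k + (x - X) / (Y - X) - i) = (x - Y) / - (Y - X) + (i - (k + 1)).
Proof. by move=> h; field. Qed.

Section Interpolant.
Context {R : realType}.
Variables (N : nat) (lx ly : R).
Hypotheses (N0 : (0 < N)%N) (evN : ~~ odd N).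
Hypotheses (lx0 : 0 < lx) (lx2 : lx <= 1/2) (ly0 : 0 < ly) (ly2 : ly <= 1/2).
Local Notation xs := (mesh_point N lx).
Local Notation ys := (mesh_point N ly).

Lemma closed_tri_cell (K : tri_index N) p : closed_tri xs ys K p ->
  [/\ xs K.1.1 <= p.1 <= xs K.1.1.+1 & ys K.1.2 <= p.2 <= ys K.1.2.+1].
Proof. by move=> Kp; apply: (closed_tri_box _ _ Kp) => i _; exact: mesh_lt. Qed.

Lemma vertices_closed_tri (K : tri_index N) : [/\ closed_tri xs ys K (corner xs ys K),
  closed_tri xs ys K (vtx1 (corner xs ys K) (signed_width xs K)) &
  closed_tri xs ys K (vtx2 (corner xs ys K) (signed_height ys K))].
Proof.
have s1 := @signed_width_neq0 _ N xs (fun i _ => mesh_lt N0 evN lx0 lx2 i) K.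
have s2 := @signed_width_neq0 _ N ys (fun i _ => mesh_lt N0 evN ly0 ly2 i) (swapK K).
have {}s2 : signed_height ys K != 0 by [].
rewrite /closed_tri /ctri /vtx1 /vtx2 /=; split; split => /=;
  rewrite ?(addrC (xs _) (signed_width _ _)) ?(addrC (ys _) (signed_height _ _)) ?addrK ?subrr ?mul0r ?divff//;
  lra.
Qed.

(** Sums of hat functions in index coordinates, so that continuity is inherited
    from the hat function and needs no gluing along the edges. *)
Definition interp (u : R * R -> R) (p : R * R) : R :=
  \sum_(i < N.+1) \sum_(j < N.+1) u (xs i, ys j) *
    hat (mesh_idx N lx p.1 - i%:R) (mesh_idx N ly p.2 - j%:R).

Lemma interp_node u i j : (i <= N)%N -> (j <= N)%N ->
  interp u (xs i, ys j) = u (xs i, ys j).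
Proof.
move=> iN jN; rewrite /interp /=.
rewrite !mesh_idx_node//.
have H (k l : nat) : hat (i%:R - k%:R) (j%:R - l%:R : R) = ((k == i) && (l == j))%:R.
  rewrite !pmulrn -!intrB hat_int !subr_eq0 !eqz_nat.
  by rewrite (eq_sym i) (eq_sym j).
rewrite (bigD1 (Ordinal (iN : (i < N.+1)%N)))//= (bigD1 (Ordinal (jN : (j < N.+1)%N)))//=.
rewrite H !eqxx mulr1 big1 ?addr0; last first.
  move=> l; rewrite -val_eqE /= => lj; rewrite H (negbTE lj) andbF mulr0//.
rewrite big1 ?addr0// => k; rewrite -val_eqE /= => ki.
by rewrite big1// => l _; rewrite H (negbTE ki) mulr0.
Qed.

Lemma continuous_interp u : continuous (interp u).
Proof.
have csum (I : Type) (s : seq I) (F : I -> R * R -> R) :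
    (forall i, continuous (F i)) -> continuous (fun p => \sum_(i <- s) F i p).
  move=> cF; elim: s => [|i s ih] p.
    by under eq_fun do rewrite big_nil; exact: cvg_cst.
  under eq_fun do rewrite big_cons.
  by apply: (@continuousD _ _ _ (F i) (fun p => \sum_(i <- s) F i p)); [exact: cF|exact: ih].
apply: (csum _ _ _) => i; apply: (csum _ _ _) => j p; apply: cvgM; first exact: cvg_cst.
have cx (l : R) (h : R * R -> R) k : continuous h ->
    continuous (fun p => mesh_idx N l (h p) - k).
  move=> ch q; apply: cvgB; last exact: cvg_cst.
  by apply: continuous_comp; [exact: ch|exact: continuous_mesh_idx].
apply: (@continuous_hat_comp R _ (fun p : R * R => mesh_idx N lx p.1 - i%:R)
  (fun p : R * R => mesh_idx N ly p.2 - j%:R)).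
  by apply: (cx _ (fun p => p.1)) => q; exact: cvg_fst.
by apply: (cx _ (fun p => p.2)) => q; exact: cvg_snd.
Qed.

Lemma interp_P1 u (K : tri_index N) : P1_on (closed_tri xs ys K) (interp u).
Proof.
have Psum (I : Type) (s : seq I) (F : I -> R * R -> R) (D : set (R * R)) :
    (forall i, P1_on D (F i)) -> P1_on D (fun p => \sum_(i <- s) F i p).
  move=> PF; elim: s => [|i s [p0 [p1 [p2 ih]]]].
    by exists 0, 0, 0; move=> p _; rewrite big_nil !mul0r !addr0.
  have [q0 [q1 [q2 hq]]] := PF i.
  exists (q0 + p0), (q1 + p1), (q2 + p2); move=> p Dp.
  by rewrite big_cons ih// hq//; ring.
apply: (Psum _ _ _) => i; apply: (Psum _ _ _) => j.
set U := u _.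
have hx := mesh_lt N0 evN lx0 lx2 K.1.1; have hy := mesh_lt N0 evN ly0 ly2 K.1.2.
case: K hx hy => -[I J] a /= hx hy.
have dx0 : xs I.+1 - xs I != 0 by rewrite subr_eq0 gt_eqF.
have dy0 : ys J.+1 - ys J != 0 by rewrite subr_eq0 gt_eqF.
case: a.
- have [k0 [k1 [k2 hk]]] := @hat_affine R ((i : nat)%:Z - I.+1%:Z) ((j : nat)%:Z - J.+1%:Z).
  set c := corner xs ys (I, J, true).
  set e1 := signed_width xs (I, J, true); set e2 := signed_height ys (I, J, true).
  exists (U * (k0 - k1 * c.1 / e1 - k2 * c.2 / e2)), (U * k1 / e1), (U * k2 / e2).
  move=> p Tp; have [px py] := closed_tri_cell Tp.
  have [s t st] := Tp.
  rewrite (mesh_idx_cell N0 evN lx0 lx2 (ltn_ord I) px).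
  rewrite (mesh_idx_cell N0 evN ly0 ly2 (ltn_ord J) py) -hat_sym.
  have -> : - (I%:R + (p.1 - xs I) / (xs I.+1 - xs I) - i%:R) =
      (p.1 - c.1) / e1 + ((i : nat)%:Z - I.+1%:Z)%:~R.
    rewrite /c /e1 /signed_width /corner /= signed_step_true addn1 intrB -!pmulrn -natr1.
    exact: cell_coord_flip.
  have -> : - (J%:R + (p.2 - ys J) / (ys J.+1 - ys J) - j%:R) =
      (p.2 - c.2) / e2 + ((j : nat)%:Z - J.+1%:Z)%:~R.
    rewrite /c /e2 /signed_height /corner /= signed_step_true addn1 intrB -!pmulrn -natr1.
    exact: cell_coord_flip.
  by rewrite hk//; ring.
- have [k0 [k1 [k2 hk]]] := @hat_affine R (I%:Z - (i : nat)%:Z) (J%:Z - (j : nat)%:Z).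
  set c := corner xs ys (I, J, false).
  set e1 := signed_width xs (I, J, false); set e2 := signed_height ys (I, J, false).
  exists (U * (k0 - k1 * c.1 / e1 - k2 * c.2 / e2)), (U * k1 / e1), (U * k2 / e2).
  move=> p Tp; have [px py] := closed_tri_cell Tp.
  have [s t st] := Tp.
  rewrite (mesh_idx_cell N0 evN lx0 lx2 (ltn_ord I) px).
  rewrite (mesh_idx_cell N0 evN ly0 ly2 (ltn_ord J) py).
  have -> : I%:R + (p.1 - xs I) / (xs I.+1 - xs I) - i%:R =
      (p.1 - c.1) / e1 + (I%:Z - (i : nat)%:Z)%:~R.
    by rewrite /c /e1 /signed_width /corner /= signed_step_false addn0 intrB -!pmulrn [LHS]addrAC [LHS]addrC.
  have -> : J%:R + (p.2 - ys J) / (ys J.+1 - ys J) - j%:R =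
      (p.2 - c.2) / e2 + (J%:Z - (j : nat)%:Z)%:~R.
    by rewrite /c /e2 /signed_height /corner /= signed_step_false addn0 intrB -!pmulrn [LHS]addrAC [LHS]addrC.
  by rewrite hk//; ring.
Qed.

Lemma interp_boundary u p :
  (forall i j, (i <= N)%N -> (j <= N)%N ->
    [|| i == 0, i == N, j == 0 | j == N]%N -> u (xs i, ys j) = 0) ->
  (Omegabar `\` Omega) p -> interp u p = 0.
Proof.
move=> u0 [[/= x01 y01] nO]; rewrite /interp big1// => i _; rewrite big1// => j _.
have [b|] := boolP [|| (i : nat) == 0, (i : nat) == N, (j : nat) == 0 | (j : nat) == N]%N.
  by rewrite u0 ?mul0r// -ltnS.
rewrite !negb_or => /and4P[i0 iN j0 jN].
have far (l z : R) (k : 'I_N.+1) : 0 < l -> l <= 1/2 -> k != 0%N :> nat ->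
    k != N :> nat -> z = 0 \/ z = 1 -> 1 <= `|mesh_idx N l z - k%:R|.
  move=> l0 l2 k0 kN.
  have E0 := mesh_idx_node N0 evN l0 l2 (leq0n N); rewrite mesh_0 in E0.
  have E1 := mesh_idx_node N0 evN l0 l2 (leqnn N); rewrite mesh_N// in E1.
  case=> ->; first by rewrite E0 sub0r normrN normr_nat ler1n lt0n.
  have kN' : (k <= N)%N by rewrite -ltnS.
  by rewrite E1 -natrB// normr_nat ler1n subn_gt0 ltn_neqAle kN.
have [e|xb] : (p.1 = 0 \/ p.1 = 1) \/ (p.2 = 0 \/ p.2 = 1).
- move: x01 y01; rewrite !in_itv /= => /andP[x0 x1] /andP[y0 y1].
  apply: contrapT => H; apply: nO; split; rewrite /= in_itv /= !lt_neqAle.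
    rewrite x0 x1 !andbT; apply/andP; split; apply/eqP => e; apply: H; left; [left|right] => //.
  rewrite y0 y1 !andbT; apply/andP; split; apply/eqP => e; apply: H; right; [left|right] => //.
- rewrite hat_le0 ?mulr0//; apply/orP; left; exact: far.
- rewrite hat_le0 ?mulr0//; apply/orP; right; exact: far.
Qed.

End Interpolant.

Section OpenTriangle.
Context {R : realType}.

Lemma open_gt0_set (f : R * R -> R) : continuous f -> open [set p | 0 < f p].
Proof.
move=> cf; rewrite (_ : [set _ | _] = f @^-1` `]0, +oo[%classic).
  by apply: open_comp => // p _; exact: cf.
by apply/seteqP; split => p /=; rewrite in_itv /= andbT.
Qed.

Lemma open_otri (c : R * R) (u w : R) : open (otri c u w).
Proof.
have c1 : continuous (fun p : R * R => (p.1 - c.1) / u).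
  by move=> p; apply: cvgM; [apply: cvgB; [exact: cvg_fst|exact: cvg_cst]|exact: cvg_cst].
have c2 : continuous (fun p : R * R => (p.2 - c.2) / w).
  by move=> p; apply: cvgM; [apply: cvgB; [exact: cvg_snd|exact: cvg_cst]|exact: cvg_cst].
rewrite (_ : otri c u w = [set p | 0 < (p.1 - c.1) / u] `&`
   ([set p | 0 < (p.2 - c.2) / w] `&`
    [set p | 0 < 1 - ((p.1 - c.1) / u + (p.2 - c.2) / w)])).
  apply: openI; first exact: open_gt0_set.
  apply: openI; apply: open_gt0_set => // p.
  by apply: cvgB; [exact: cvg_cst|apply: cvgD; [exact: c1|exact: c2]].
apply/seteqP; split => p /=; rewrite subr_gt0; first by case=> s1 s2 s3; split.
by case=> ? [].
Qed.

Lemma grad_otri (v : R * R -> R) q c u w p :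
  (forall p, otri c u w p -> v p = aff q p) -> otri c u w p ->
  grad v p = (q.1.2, q.2).
Proof.
move=> vq Tp.
have nv : \near p, v p = aff q p.
  have nT : nbhs p (otri c u w).
    by apply: open_nbhs_nbhs; split; [exact: open_otri|exact: Tp].
  by apply: filterS nT => x; exact: vq.
rewrite /grad !(near_eq_derive _ nv) derive_e1 derive_e2 /aff /=.
congr pair.
- have d : is_derive p.1 1 (fun x : R => q.1.1 + q.1.2 * x + q.2 * p.2) q.1.2.
    by apply: is_derive_eq; rewrite /GRing.scale /=; ring.
  by rewrite derive_val.
- have d : is_derive p.2 1 (fun x : R => q.1.1 + q.1.2 * p.1 + q.2 * x) q.2.
    by apply: is_derive_eq; rewrite /GRing.scale /=; ring.
  by rewrite derive_val.
Qed.

End OpenTriangle.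

(** * Bilinear form and norms as sums over triangles *)

Ltac nonneg_tac := repeat (first [assumption | exact: sqr_ge0 | apply: addr_ge0 |
  apply: mulr_ge0 | rewrite invr_ge0 | exact: ler0n]).

Ltac bmeasurable_tac := repeat (first [assumption | exact: bmeasurable_cst | exact: bmeasurable_aff | apply: bmeasurableX |
  apply: bmeasurableD | apply: bmeasurableM]).

Section SumForms.
Context {R : realType}.
Variables (P : data R) (N : nat) (eps : R) (modified : bool).
Hypotheses (N0 : (0 < N)%N) (evN : ~~ odd N) (eps0 : 0 < eps).
Local Notation lx := (lambda_x P N eps).
Local Notation ly := (lambda_y P N eps).
Hypotheses (lx0 : 0 < lx) (lx2 : lx <= 1/2) (ly0 : 0 < ly) (ly2 : ly <= 1/2).
Hypotheses (b0 : 0 < bnorm P) (c0 : 0 < c P) (Cs0 : 0 < Cstar P).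
Local Notation xs := (mesh_point N lx).
Local Notation ys := (mesh_point N ly).
Local Notation b := (bnorm P).
Local Notation be := (beta_dir P).
Local Notation et := (eta_dir P).
Local Notation oK := (@open_tri R N xs ys).
Local Notation cK := (@closed_tri R N xs ys).

Lemma ltxs i : (i < N)%N -> xs i < xs i.+1. Proof. by move=> _; exact: mesh_lt. Qed.
Lemma ltys i : (i < N)%N -> ys i < ys i.+1. Proof. by move=> _; exact: mesh_lt. Qed.

Lemma triangleE (K : tri_index N) : triangle P eps K = cK K.
Proof.
case: K => -[i j] a; have hx := ltxs (ltn_ord i); have hy := ltys (ltn_ord j).
have dx : 0 < xs i.+1 - xs i by rewrite subr_gt0.
have dy : 0 < ys j.+1 - ys j by rewrite subr_gt0.
apply/seteqP; rewrite /triangle /mesh_x /mesh_y /closed_tri /ctri /signed_width /signed_height /=.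
suff H p : (if a then [set x | [/\ x.1 <= xs i.+1, x.2 <= ys j.+1 &
      1 <= (x.1 - xs i) / (xs i.+1 - xs i) + (x.2 - ys j) / (ys j.+1 - ys j)]]
    else [set x | [/\ xs i <= x.1, ys j <= x.2 &
      (x.1 - xs i) / (xs i.+1 - xs i) + (x.2 - ys j) / (ys j.+1 - ys j) <= 1]]) p <->
   [/\ 0 <= (p.1 - xs (i + a)%N) / signed_step xs i a, 0 <= (p.2 - ys (j + a)%N) / signed_step ys j a
      & (p.1 - xs (i + a)%N) / signed_step xs i a + (p.2 - ys (j + a)%N) / signed_step ys j a <= 1].
  by split=> p /H.
case: a; rewrite ?(coord_true _ hx) ?(coord_true _ hy) ?signed_step_false ?addn0 /=.
  have e1 : (p.1 <= xs i.+1) = ((p.1 - xs i) / (xs i.+1 - xs i) <= 1).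
    by rewrite ler_pdivrMr// mul1r lerD2r.
  have e2 : (p.2 <= ys j.+1) = ((p.2 - ys j) / (ys j.+1 - ys j) <= 1).
    by rewrite ler_pdivrMr// mul1r lerD2r.
  by rewrite e1 e2; split=> -[h1 h2 h3]; split; lra.
have e1 : (xs i <= p.1) = (0 <= (p.1 - xs i) / (xs i.+1 - xs i)).
  by rewrite pmulr_lge0 ?invr_gt0// subr_ge0.
have e2 : (ys j <= p.2) = (0 <= (p.2 - ys j) / (ys j.+1 - ys j)).
  by rewrite pmulr_lge0 ?invr_gt0// subr_ge0.
by rewrite e1 e2; split=> -[h1 h2 h3]; split; lra.
Qed.

Definition coarse (K : tri_index N) := (K.1.1 < N./2)%N && (K.1.2 < N./2)%N.
Definition tri_delta (K : tri_index N) : R := if coarse K then Cstar P * N%:R^-1 else 0.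
Definition tri_epshat (K : tri_index N) : R :=
  if coarse K then epshat_s N eps modified else eps.

Lemma coarse_sub K : coarse K -> cK K `<=` Omega_s P N eps.
Proof.
move=> /andP[h1 h2] p Tp.
have [/andP[x0 x1] /andP[y0 y1]] := closed_tri_cell N0 evN lx0 lx2 ly0 ly2 Tp.
have m (l : R) i : 0 < l -> l <= 1/2 -> (i < N./2)%N -> mesh_point N l i.+1 <= 1 - l.
  by move=> l0 l2 hi; rewrite -(mesh_half _ N0 evN); apply: mesh_mono.
have m0 (l : R) i : 0 < l -> l <= 1/2 -> 0 <= mesh_point N l i.
  by move=> l0 l2; rewrite -(mesh_0 N l); apply: mesh_mono.
split; rewrite /= in_itv /=.
  by rewrite (le_trans _ x0) ?m0//= (le_trans x1)// m.
by rewrite (le_trans _ y0) ?m0//= (le_trans y1)// m.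
Qed.

(** Only open triangles are disjoint from the coarse region: a closed triangle
    of a layer can have an edge in common with it. *)
Lemma fine_disj K p : ~~ coarse K -> oK K p -> ~ Omega_s P N eps p.
Proof.
move=> nc Tp [/=]; rewrite !in_itv /= => /andP[_ hx] /andP[_ hy].
have [/andP[x0 x1] /andP[y0 y1]] := open_tri_cell ltxs ltys Tp.
have m (l : R) i : 0 < l -> l <= 1/2 -> (N./2 <= i)%N -> 1 - l <= mesh_point N l i.
  by move=> l0 l2 hi; rewrite -(mesh_half _ N0 evN); apply: mesh_mono.
move: nc; rewrite negb_and -!leqNgt => /orP[h|h].
  by have := m _ _ lx0 lx2 h; lra.
by have := m _ _ ly0 ly2 h; lra.
Qed.

Lemma mesh_width_neq0 (K : tri_index N) : signed_width xs K != 0. Proof. exact: signed_width_neq0 ltxs K. Qed.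
Lemma mesh_height_neq0 (K : tri_index N) : signed_height ys K != 0. Proof. exact: signed_height_neq0 ltys K. Qed.

Lemma open_tri_nonempty (K : tri_index N) : exists p, oK K p.
Proof.
have u0 := mesh_width_neq0 K; have w0 := mesh_height_neq0 K.
exists ((corner xs ys K).1 + signed_width xs K / 4, (corner xs ys K).2 + signed_height ys K / 4).
rewrite /open_tri /otri /= !(addrC _ (_ / 4)) !addrK.
have -> : signed_width xs K / 4 / signed_width xs K = 1/4 by field.
have -> : signed_height ys K / 4 / signed_height ys K = 1/4 by field.
by split; lra.
Qed.

(** An inclusion of sets becomes a condition on indices: a triangle outside the
    coarse index range has interior points outside Omega_s. *)
Lemma delta_K_tri K : delta_K P eps K = tri_delta K.
Proof.
rewrite /delta_K /tri_delta; case: asboolP => h; case: ifPn => // h'.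
  have [p Tp] := open_tri_nonempty K.
  by exfalso; apply: (fine_disj h' Tp); apply: h; rewrite triangleE; exact: otri_ctri.
by exfalso; apply: h; rewrite triangleE; exact: coarse_sub.
Qed.

Lemma epshat_tri K p : oK K p -> epshat P N eps modified p = tri_epshat K.
Proof.
move=> Tp; rewrite /epshat /tri_epshat; case: ifPn => h.
  case: ifPn => // h'; exfalso; apply: (fine_disj h' Tp); exact: set_mem.
case: ifPn => // h'; move/negP: h; case; apply/mem_set/(coarse_sub h').
exact: otri_ctri.
Qed.

Lemma epshat_s_ge : eps <= epshat_s N eps modified.
Proof. by rewrite /epshat_s; case: (modified); rewrite ?le_max lexx. Qed.

Lemma tri_epshat_ge K : eps <= tri_epshat K.
Proof. by rewrite /tri_epshat; case: ifP => // _; exact: epshat_s_ge. Qed.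

Lemma tri_delta_ge0 K : 0 <= tri_delta K.
Proof. by rewrite /tri_delta; case: ifP => // _; rewrite divr_ge0// ltW. Qed.

Lemma unit_be : be.1 ^+ 2 + be.2 ^+ 2 = 1.
Proof.
rewrite /beta_dir /= !exprMn -mulrDl exprVn.
have -> : b1 P ^+ 2 + b2 P ^+ 2 = b ^+ 2 by rewrite sqr_sqrtr// addr_ge0// sqr_ge0.
by rewrite divff// expf_neq0// lt0r_neq0.
Qed.

Lemma etE : et = (- be.2, be.1). Proof. by rewrite /eta_dir /beta_dir /= mulNr. Qed.

Definition pieces (v : R * R -> R) (q : tri_index N -> R * R * R) :=
  forall K p, cK K p -> v p = aff (q K) p.

Lemma in_VN_pieces v : in_VN P N eps v -> exists q, pieces v q.
Proof.
move=> [_ _ Pv]; have H : forall K : tri_index N, exists q : R * R * R,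
    forall p, cK K p -> v p = aff q p.
  move=> K; have [p0 [p1 [p2 H]]] := Pv K; rewrite triangleE in H.
  by exists (p0, p1, p2) => p Tp; exact: H.
by have [q Hq] := choice H; exists q.
Qed.

Lemma ddirE v q d K p : pieces v q -> oK K p ->
  ddir d v p = d.1 * (q K).1.2 + d.2 * (q K).2.
Proof.
move=> vq Tp; rewrite /ddir (@grad_otri _ v (q K) (corner xs ys K) (signed_width xs K) (signed_height ys K))//.
by move=> r Tr; apply: vq; exact: otri_ctri.
Qed.

Local Notation gb q K := (gbeta be (q K)).
Local Notation ge q K := (geta et (q K)).

Lemma L2dot_Omega f g (F : tri_index N -> R * R -> R) :
  (forall K p, oK K p -> f p * g p = F K p) -> (forall K, bmeasurable (F K)) ->
  L2dot Omega f g = \sum_K integral2 (oK K) (F K).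
Proof.
move=> h nF; apply: (integral2_Omega ltxs ltys) => //; first exact: mesh_0.
- exact: mesh_N.
- exact: mesh_0.
- exact: mesh_N.
Qed.

Lemma L2dot_triangle K f g F :
  (forall p, oK K p -> f p * g p = F p) -> bmeasurable F ->
  L2dot (triangle P eps K) f g = integral2 (oK K) F.
Proof.
move=> h nF; rewrite triangleE; apply: (integral2_closed_tri ltxs ltys) => //; first exact: mesh_0.
- exact: mesh_N.
- exact: mesh_0.
- exact: mesh_N.
Qed.

Lemma L2norm_sqr (D : set (R * R)) f : L2norm D f ^+ 2 = L2dot D f f.
Proof.
rewrite sqr_sqrtr// /L2dot; apply: integral2_ge0 => p _.
by rewrite -expr2 sqr_ge0.
Qed.

Lemma open_tri_sub (K : tri_index N) : oK K `<=` Omegabar.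
Proof.
apply: (open_tri_Omegabar ltxs ltys); [exact: mesh_0|exact: mesh_N|exact: mesh_0|exact: mesh_N].
Qed.

Lemma integral2_lin2 K (F1 F2 : R * R -> R) (k1 k2 : R) : bmeasurable F1 -> bmeasurable F2 ->
  integral2 (oK K) (fun p => k1 * F1 p + k2 * F2 p) = k1 * integral2 (oK K) F1 + k2 * integral2 (oK K) F2.
Proof.
move=> n1 n2; have mT := measurable_open_tri xs ys K; have sT := @open_tri_sub K.
by rewrite integral2D// ?integral2Z//; apply: bmeasurableM => //; exact: bmeasurable_cst.
Qed.

Definition bilinear_density (u v : tri_index N -> R * R * R) K p : R :=
  eps * (gb u K * gb v K) + tri_epshat K * (ge u K * ge v K) +
  (b * gb u K + c P * aff (u K) p) * (aff (v K) p + tri_delta K * b * gb v K).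

Lemma a_MSD_sum u v qu qv : pieces u qu -> pieces v qv ->
  a_MSD P N eps modified u v = \sum_K integral2 (oK K) (bilinear_density qu qv K).
Proof.
move=> uq vq; rewrite /a_MSD.
have na q : bmeasurable (aff q) by exact: bmeasurable_aff.
have ncst (k : R) := @bmeasurable_cst R k.
rewrite (L2dot_Omega (F := fun K _ => gb qu K * gb qv K)); last 2 first.
- by move=> K p Tp; rewrite (ddirE _ uq Tp) (ddirE _ vq Tp).
- by [].
rewrite (L2dot_Omega (F := fun K _ => tri_epshat K * (ge qu K * ge qv K))); last 2 first.
- by move=> K p Tp; rewrite (epshat_tri Tp) (ddirE _ uq Tp) (ddirE _ vq Tp) mulrA.
- by [].
rewrite (L2dot_Omega (F := fun K p => (b * gb qu K + c P * aff (qu K) p) * aff (qv K) p));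
  last 2 first.
- by move=> K p Tp; rewrite (ddirE _ uq Tp) (uq K) ?(vq K)//; exact: otri_ctri.
- by move=> K; apply: bmeasurableM => //; apply: bmeasurableD => //; apply: bmeasurableM.
under [X in _ + X]eq_bigr => K _.
  rewrite (L2dot_triangle (F := fun p =>
    (b * gb qu K + c P * aff (qu K) p) * (tri_delta K * b * gb qv K))); last 2 first.
  - move=> p Tp; rewrite (ddirE _ uq Tp) (ddirE _ vq Tp) (uq K) ?delta_K_tri//.
    exact: otri_ctri.
  - by apply: bmeasurableM => //; apply: bmeasurableD => //; apply: bmeasurableM.
  over.
rewrite mulr_sumr -!big_split; apply: eq_bigr => K _ /=.
have mT := measurable_open_tri xs ys K; have sT := @open_tri_sub K.
rewrite -integral2Z// -!integral2D//; try by bmeasurable_tac.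
by apply: integral2_eq => p _; rewrite /bilinear_density; ring.
Qed.

Lemma norm_MSD_sum v q : pieces v q ->
  norm_MSD P N eps modified v ^+ 2 = \sum_K integral2 (oK K) (fun p =>
    eps * gb q K ^+ 2 + tri_epshat K * ge q K ^+ 2 + c P * aff (q K) p ^+ 2 +
    b ^+ 2 * tri_delta K * gb q K ^+ 2).
Proof.
move=> vq; rewrite /norm_MSD.
have na q' : bmeasurable (aff q') by exact: bmeasurable_aff.
have ncst (k : R) := @bmeasurable_cst R k.
rewrite !L2norm_sqr.
rewrite (L2dot_Omega (F := fun K _ => gb q K ^+ 2)); last 2 first.
- by move=> K p Tp; rewrite (ddirE _ vq Tp).
- by [].
rewrite (L2dot_Omega (F := fun K _ => tri_epshat K * ge q K ^+ 2)); last 2 first.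
- move=> K p Tp; rewrite (epshat_tri Tp) (ddirE _ vq Tp) mulrACA -expr2 sqr_sqrtr//.
  exact: le_trans (ltW eps0) (tri_epshat_ge K).
- by [].
rewrite (L2dot_Omega (F := fun K p => aff (q K) p ^+ 2)); last 2 first.
- by move=> K p Tp; rewrite (vq K)//; exact: otri_ctri.
- by move=> K; exact: bmeasurableX.
under [X in _ + X]eq_bigr => K _.
  rewrite L2norm_sqr (L2dot_triangle (F := fun p => b ^+ 2 * gb q K ^+ 2)); last 2 first.
  - by move=> p Tp; rewrite (ddirE _ vq Tp) -exprMn.
  - by [].
  rewrite delta_K_tri; over.
set X := (X in Num.sqrt X).
have -> : X = \sum_K integral2 (oK K) (fun p => eps * gb q K ^+ 2 + tri_epshat K * ge q K ^+ 2 + c P * aff (q K) p ^+ 2 +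
    b ^+ 2 * tri_delta K * gb q K ^+ 2).
  rewrite /X !mulr_sumr -!big_split; apply: eq_bigr => K _ /=.
  have mT := measurable_open_tri xs ys K; have sT := @open_tri_sub K.
  have n1 : bmeasurable (fun p => aff (q K) p ^+ 2) by exact: bmeasurableX.
  have n2 : bmeasurable (fun p => c P * aff (q K) p ^+ 2) by exact: bmeasurableM.
  rewrite -!integral2Z// -!integral2D//; try by bmeasurable_tac.
  by apply: integral2_eq => p _; ring.
rewrite sqr_sqrtr//; apply: sumr_ge0 => K _; apply: integral2_ge0 => p _.
have e := le_trans (ltW eps0) (tri_epshat_ge K); have d := tri_delta_ge0 K.
have e0 := ltW eps0; have c0' := ltW c0.
by nonneg_tac.
Qed.

Section Weighted.
Variables (xst : R * R) (sb se : R).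
Hypotheses (sb0 : 0 < sb) (se0 : 0 < se).
Local Notation TH := (Theta be et xst sb se).
Local Notation THb := (Theta_beta be et xst sb se).

Definition weighted_density (q : tri_index N -> R * R * R) K p : R :=
  eps * (TH p * gb q K ^+ 2) + tri_epshat K * (TH p * ge q K ^+ 2) +
  b / 2 * (THb p * aff (q K) p ^+ 2) + c P * (TH p * aff (q K) p ^+ 2) +
  b ^+ 2 * tri_delta K * (TH p * gb q K ^+ 2).

Lemma omega_invE : (fun x => (omega P sb se xst x)^-1) = TH.
Proof. by apply/funext => p; exact: omega_inv. Qed.

Lemma omega_half p : (Num.sqrt (omega P sb se xst p))^-1 * (Num.sqrt (omega P sb se xst p))^-1 = TH p.
Proof.
rewrite -expr2 exprVn sqr_sqrtr; first exact: (congr1 (fun f => f p) omega_invE).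
by rewrite -[omega _ _ _ _ _]invrK (congr1 (fun f => f p) omega_invE) invr_ge0 ltW// Theta_gt0.
Qed.

Lemma ddir_Theta_beta p : ddir be TH p = THb p.
Proof.
rewrite /ddir grad_Theta//; have := unit_be; have := etE.
move: (beta_dir P) (eta_dir P) => B E -> u; rewrite /dot /Theta_x /Theta_y /=.
transitivity ((B.1 ^+ 2 + B.2 ^+ 2) * Theta_beta B (- B.2, B.1) xst sb se p); first by ring.
by rewrite u mul1r.
Qed.

Lemma weighted_density_ge0 q K p : 0 <= weighted_density q K p.
Proof.
have e := le_trans (ltW eps0) (tri_epshat_ge K); have d := tri_delta_ge0 K.
have t := ltW (Theta_gt0 be et xst sb se p); have t' := ltW (Theta_beta_gt0 be et xst se sb0 p).
have e0 := ltW eps0; have c0' := ltW c0; have b0' := ltW b0.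
by rewrite /weighted_density; nonneg_tac.
Qed.

Lemma bmeasurable_Theta : bmeasurable TH. Proof. exact/slice_continuous_nice/slice_continuous_Theta. Qed.
Lemma bmeasurable_Theta_beta : bmeasurable THb. Proof. exact/slice_continuous_nice/slice_continuous_Theta_beta. Qed.

Lemma bmeasurable_weighted_density q K : bmeasurable (weighted_density q K).
Proof.
have n1 := bmeasurable_Theta; have n2 := bmeasurable_Theta_beta; have n3 : bmeasurable (aff (q K)) by exact: bmeasurable_aff.
have n4 := @bmeasurable_cst R.
by bmeasurable_tac.
Qed.

Lemma norm_weighted_sum v q : pieces v q ->
  norm_weighted P N eps modified (omega P sb se xst) v ^+ 2 = \sum_K integral2 (oK K) (weighted_density q K).
Proof.
move=> vq; rewrite /norm_weighted.
have na q' : bmeasurable (aff q') by exact: bmeasurable_aff.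
have ncst (k : R) := @bmeasurable_cst R k.
have n1 := bmeasurable_Theta; have n2 := bmeasurable_Theta_beta.
rewrite !L2norm_sqr.
rewrite (L2dot_Omega (F := fun K p => TH p * gb q K ^+ 2)); last 2 first.
- by move=> K p Tp; rewrite (ddirE _ vq Tp) mulrACA omega_half.
- by move=> K; apply: bmeasurableM.
rewrite (L2dot_Omega (F := fun K p => tri_epshat K * (TH p * ge q K ^+ 2))); last 2 first.
- move=> K p Tp; rewrite (epshat_tri Tp) (ddirE _ vq Tp) mulrACA -expr2 sqr_sqrtr.
    by rewrite mulrACA omega_half.
  exact: le_trans (ltW eps0) (tri_epshat_ge K).
- by move=> K; do ![apply: bmeasurableM => //].
rewrite (L2dot_Omega (F := fun K p => THb p * aff (q K) p ^+ 2)); last 2 first.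
- move=> K p Tp; rewrite (vq K)//; last exact: otri_ctri.
  rewrite mulrACA omega_invE ddir_Theta_beta -!expr2 sqr_sqrtr//.
  exact/ltW/Theta_beta_gt0.
- by move=> K; apply: bmeasurableM => //; exact: bmeasurableX.
rewrite (L2dot_Omega (F := fun K p => TH p * aff (q K) p ^+ 2)); last 2 first.
- move=> K p Tp; rewrite (vq K)//; last exact: otri_ctri.
  by rewrite mulrACA omega_half.
- by move=> K; apply: bmeasurableM => //; exact: bmeasurableX.
under [X in _ + X]eq_bigr => K _.
  rewrite L2norm_sqr (L2dot_triangle (F := fun p => TH p * gb q K ^+ 2)); last 2 first.
  - by move=> p Tp; rewrite (ddirE _ vq Tp) mulrACA omega_half.
  - by apply: bmeasurableM.
  rewrite delta_K_tri; over.
set X := (X in Num.sqrt X).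
have -> : X = \sum_K integral2 (oK K) (weighted_density q K).
  rewrite /X !mulr_sumr -!big_split; apply: eq_bigr => K _ /=.
  have mT := measurable_open_tri xs ys K; have sT := @open_tri_sub K.
  have m1 : bmeasurable (fun p => THb p * aff (q K) p ^+ 2) by apply: bmeasurableM => //; exact: bmeasurableX.
  have m2 : bmeasurable (fun p => TH p * aff (q K) p ^+ 2) by apply: bmeasurableM => //; exact: bmeasurableX.
  have m3 : bmeasurable (fun p => TH p * gb q K ^+ 2) by apply: bmeasurableM.
  have m4 : bmeasurable (fun p => TH p * ge q K ^+ 2) by apply: bmeasurableM.
  by rewrite -!integral2Z// -?integral2D//; bmeasurable_tac.
rewrite sqr_sqrtr//; apply: sumr_ge0 => K _; apply: integral2_ge0 => p _.
exact: weighted_density_ge0.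
Qed.

(** The bound holds term by term, because the inverse weight is at least 1/2. *)
Lemma norm_MSD_le v q : pieces v q ->
  norm_MSD P N eps modified v <=
  Num.sqrt 8 * norm_weighted P N eps modified (omega P sb se xst) v.
Proof.
move=> vq; rewrite -ler_sqr ?nnegrE ?sqrtr_ge0 ?mulr_ge0 ?sqrtr_ge0//.
rewrite (norm_MSD_sum vq) exprMn (norm_weighted_sum vq) (@sqr_sqrtr _ 8)// mulr_sumr.
apply: ler_sum => K _.
have mT := measurable_open_tri xs ys K; have sT := @open_tri_sub K.
have nd := bmeasurable_weighted_density q K.
have na : bmeasurable (aff (q K)) by exact: bmeasurable_aff.
have ncst (k : R) := @bmeasurable_cst R k.
rewrite -integral2Z//; apply: integral2_le => //.
- by bmeasurable_tac.
- by apply: bmeasurableM.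
move=> p _; rewrite /weighted_density.
have e := le_trans (ltW eps0) (tri_epshat_ge K); have d := tri_delta_ge0 K.
have t := Theta_ge be et xst sb se p; have t' := ltW (Theta_beta_gt0 be et xst se sb0 p).
have := sqr_ge0 (gb q K); have := sqr_ge0 (ge q K); have := sqr_ge0 (aff (q K) p).
move: (aff _ _ ^+ 2) (gb q K ^+ 2) (ge q K ^+ 2) => A B C A0 C0 B0.
have h (k x : R) : 0 <= k -> 0 <= x -> k * x <= 8 * (k * (TH p * x)).
  move=> k0 x0; have : 0 <= k * x by rewrite mulr_ge0.
  move=> kx0; have := ler_wpM2l kx0 t; lra.
have := h eps B (ltW eps0) B0; have := h _ C e C0; have := h _ A (ltW c0) A0.
have := h _ B (mulr_ge0 (sqr_ge0 b) d) B0.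
have b0' := ltW b0.
have : 0 <= b / 2 * (THb p * A) by nonneg_tac.
lra.
Qed.

End Weighted.

End SumForms.

(** * Coercivity and the energy identity *)

Section Coercivity.
Context {R : realType}.

(** The coercive terms are the squares weighted with T. The three cross terms
    are absorbed by weighted Young inequalities: Tb G gb costs a share of Tb G^2
    because sigma_beta is large compared with eps + delta, Te G ge costs a share
    of c T G^2 because sigma_eta^2 is large compared with epshat, and the
    stabilisation term uses c delta <= 1/2. The last line on the right is the
    part of the convection term that integrates to zero. *)
Lemma coercive_pointwise (T Tb Te sb se eps eh dl b c G gb ge : R) :
  0 < T -> 0 < Tb -> 0 < sb -> 0 < se -> 0 <= eps -> 0 <= eh -> 0 <= dl ->
  0 < b -> 0 < c -> sb * Tb <= T -> se * `|Te| <= T -> c * dl <= 1/2 ->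
  eps + dl * b ^+ 2 <= b / 4 * sb -> 4 * eh <= c * se ^+ 2 ->
  (eps * (T * gb ^+ 2) + eh * (T * ge ^+ 2) + b / 2 * (Tb * G ^+ 2) +
   c * (T * G ^+ 2) + b ^+ 2 * dl * (T * gb ^+ 2)) / 4 <=
  eps * ((Tb * G + T * gb) * gb) + eh * ((Te * G + T * ge) * ge) +
  (b * (Tb * G + T * gb) + c * (T * G)) * (G + dl * b * gb)
  - b / 2 * (2 * (T * G * gb) + Tb * G ^+ 2).
Proof.
move=> T0 Tb0 sb0 se0 e0 h0 d0 b0 c0 hTb hTe hcd hs1 hs2.
have ia : - (Tb * G * gb) <= T * gb ^+ 2 / 4 + Tb * G ^+ 2 / sb.
  have sq : 0 <= T * (gb / 2 + Tb * G / T) ^+ 2 by rewrite mulr_ge0 ?sqr_ge0// ltW.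
  have E : T * (gb / 2 + Tb * G / T) ^+ 2 = T * gb ^+ 2 / 4 + Tb * G * gb + Tb * G ^+ 2 * (Tb / T).
    by field; rewrite lt0r_neq0.
  have le : Tb / T <= sb^-1.
    by rewrite ler_pdivrMr// mulrC ler_pdivlMr// mulrC.
  have := ler_wpM2l (mulr_ge0 (ltW Tb0) (sqr_ge0 G)) le.
  by rewrite E in sq; lra.
have ib : - (Te * G * ge) <= T * ge ^+ 2 / 2 + T * G ^+ 2 / (2 * se ^+ 2).
  have sq : 0 <= T * (ge + Te * G / T) ^+ 2 by rewrite mulr_ge0 ?sqr_ge0// ltW.
  have E : T * (ge + Te * G / T) ^+ 2 = T * ge ^+ 2 + 2 * (Te * G * ge) + T * G ^+ 2 * (Te / T) ^+ 2.
    by field; rewrite lt0r_neq0.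
  have le : (Te / T) ^+ 2 <= (se ^+ 2)^-1.
    have le1 : `|Te / T| <= se^-1.
      by rewrite normrM normfV (gtr0_norm T0) ler_pdivrMr// mulrC ler_pdivlMr// mulrC.
    have se1 : 0 <= se^-1 by rewrite invr_ge0 ltW.
    rewrite -exprVn -(real_normK (num_real (Te / T))).
    by apply: lerXn2r; rewrite ?nnegrE.
  have := ler_wpM2l (mulr_ge0 (ltW T0) (sqr_ge0 G)) le.
  rewrite invfM; rewrite E in sq; lra.
have ic : - (b * c * (T * G * gb)) <= b ^+ 2 * (T * gb ^+ 2) / 4 + c ^+ 2 * (T * G ^+ 2).
  have sq : 0 <= T * (b * gb / 2 + c * G) ^+ 2 by rewrite mulr_ge0 ?sqr_ge0// ltW.
  have E : T * (b * gb / 2 + c * G) ^+ 2 = b ^+ 2 * (T * gb ^+ 2) / 4 + c ^+ 2 * (T * G ^+ 2)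
     + b * c * (T * G * gb) by field.
  by rewrite E in sq; lra.
have A0 : 0 <= T * gb ^+ 2 by rewrite mulr_ge0 ?sqr_ge0// ltW.
have B0 : 0 <= T * ge ^+ 2 by rewrite mulr_ge0 ?sqr_ge0// ltW.
have C0 : 0 <= T * G ^+ 2 by rewrite mulr_ge0 ?sqr_ge0// ltW.
have D0 : 0 <= Tb * G ^+ 2 by rewrite mulr_ge0 ?sqr_ge0// ltW.
have db0 : 0 <= dl * b ^+ 2 by rewrite mulr_ge0 ?sqr_ge0.
have i1 := ler_wpM2l (addr_ge0 e0 db0) ia.
have i2 := ler_wpM2l h0 ib.
have i3 := ler_wpM2l d0 ic.
have j1 : (eps + dl * b ^+ 2) * (Tb * G ^+ 2 / sb) <= b / 4 * (Tb * G ^+ 2).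
  by rewrite [leLHS]mulrA ler_pdivrMr// [leRHS]mulrAC ler_wpM2r.
have j2 : eh * (T * G ^+ 2 / (2 * se ^+ 2)) <= c / 8 * (T * G ^+ 2).
  rewrite [leLHS]mulrA ler_pdivrMr ?mulr_gt0 ?exprn_gt0//.
  have := ler_wpM2r C0 hs2; lra.
have j3 : dl * (c ^+ 2 * (T * G ^+ 2)) <= c / 2 * (T * G ^+ 2).
  have := ler_wpM2r (mulr_ge0 (ltW c0) C0) hcd; rewrite -mulrA; lra.
have p1 : 0 <= eps * (T * gb ^+ 2) by rewrite mulr_ge0.
have p2 : 0 <= eh * (T * ge ^+ 2) by rewrite mulr_ge0.
have p3 : 0 <= b * (Tb * G ^+ 2) by rewrite mulr_ge0// ltW.
have p4 : 0 <= c * (T * G ^+ 2) by rewrite mulr_ge0// ltW.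
have p5 : 0 <= dl * b ^+ 2 * (T * gb ^+ 2) by rewrite mulr_ge0.
lra.
Qed.

End Coercivity.

Section EnergyBound.
Context {R : realType}.
Variables (P : data R) (N : nat) (eps : R) (modified : bool).
Hypotheses (N0 : (0 < N)%N) (evN : ~~ odd N) (eps0 : 0 < eps).
Local Notation lx := (lambda_x P N eps).
Local Notation ly := (lambda_y P N eps).
Hypotheses (lx0 : 0 < lx) (lx2 : lx <= 1/2) (ly0 : 0 < ly) (ly2 : ly <= 1/2).
Hypotheses (b0 : 0 < bnorm P) (c0 : 0 < c P) (Cs0 : 0 < Cstar P).
Local Notation xs := (mesh_point N lx).
Local Notation ys := (mesh_point N ly).
Local Notation b := (bnorm P).
Local Notation be := (beta_dir P).
Local Notation et := (eta_dir P).
Local Notation oK := (@open_tri R N xs ys).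
Local Notation cK := (@closed_tri R N xs ys).
Variables (xst : R * R) (sb se : R).
Hypotheses (sb0 : 0 < sb) (se0 : 0 < se).
Local Notation TH := (Theta be et xst sb se).
Local Notation THb := (Theta_beta be et xst sb se).
Local Notation THe := (Theta_eta be et xst sb se).
Local Notation TH1 := (Theta_x be et xst sb se).
Local Notation TH2 := (Theta_y be et xst sb se).
Implicit Types (q qi : tri_index N -> R * R * R).

(** The interpolation error and, by the product rule, its derivatives in the
    directions beta and eta. *)
Definition err_value q qi (K : tri_index N) p : R := TH p * aff (q K) p - aff (qi K) p.
Definition err_beta q qi (K : tri_index N) p : R :=
  THb p * aff (q K) p + TH p * gbeta be (q K) - gbeta be (qi K).
Definition err_eta q qi (K : tri_index N) p : R :=
  THe p * aff (q K) p + TH p * geta et (q K) - geta et (qi K).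

Lemma Theta_beta_grad p : be.1 * TH1 p + be.2 * TH2 p = THb p.
Proof. by have := ddir_Theta_beta b0 xst sb0 se0 p; rewrite /ddir grad_Theta. Qed.

(** The derivative along beta of (Theta G - I) G integrates to zero over the
    square, as G vanishes on the boundary. *)
Lemma sum_integral2_directional (G I : R * R -> R) q qi :
  pieces P eps G q -> pieces P eps I qi ->
  (forall p, (Omegabar `\` Omega) p -> G p = 0) ->
  \sum_K integral2 (oK K) (fun p => err_value q qi K p * gbeta be (q K) + err_beta q qi K p * aff (q K) p) = 0.
Proof.
move=> Gq Iqi GO.
pose H p := (TH p * G p - I p) * G p.
pose F (K : tri_index N) p := err_value q qi K p * aff (q K) p.
pose D1 (K : tri_index N) p := (TH1 p * aff (q K) p + TH p * (q K).1.2 - (qi K).1.2) * aff (q K) p +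
   err_value q qi K p * (q K).1.2.
pose D2 (K : tri_index N) p := (TH2 p * aff (q K) p + TH p * (q K).2 - (qi K).2) * aff (q K) p +
   err_value q qi K p * (q K).2.
have sT : slice_continuous TH := slice_continuous_Theta be et xst sb se.
have sT1 : slice_continuous TH1 := slice_continuous_Theta_x be et xst sb se.
have sT2 : slice_continuous TH2 := slice_continuous_Theta_y be et xst sb se.
have sa (q' : R * R * R) : slice_continuous (@aff R q') := slice_continuous_aff q'.
have sc (k : R) := @slice_continuous_cst R k.
have sE (K : tri_index N) : slice_continuous (err_value q qi K) by apply: slice_continuousB => //; exact: slice_continuousM.
have sD1 (K : tri_index N) : slice_continuous (D1 K).
  apply: slice_continuousD; last exact: slice_continuousM.
  by apply: slice_continuousM => //; apply: slice_continuousB => //; apply: slice_continuousD; apply: slice_continuousM.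
have sD2 (K : tri_index N) : slice_continuous (D2 K).
  apply: slice_continuousD; last exact: slice_continuousM.
  by apply: slice_continuousM => //; apply: slice_continuousB => //; apply: slice_continuousD; apply: slice_continuousM.
have HF (K : tri_index N) p : cK K p -> H p = F K p by move=> Tp; rewrite /H /F (Gq K)// (Iqi K).
have GB x y : Omegabar (x, y) -> (x = 0 \/ x = 1) \/ (y = 0 \/ y = 1) -> G (x, y) = 0.
  move=> O h; apply: GO; split=> // -[/= ]; rewrite !in_itv /=.
  by case: h => -[] ->; rewrite ltxx ?andbF.
have S1 : \sum_K integral2 (oK K) (D1 K) = 0.
  apply: (@sum_integral2_derive_x _ _ xs ys (ltxs N0 evN lx0 lx2) (ltys N0 evN ly0 ly2)
    (mesh_0 N lx) (mesh_N lx N0 evN) (mesh_0 N ly) (mesh_N ly N0 evN) F D1 H HF).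
  - move=> y /andP[y0 y1]; rewrite /H.
    have -> : G (0, y) = 0.
      by apply: GB; [split; rewrite /= in_itv /= ?lexx ?ler01 ?ltW|left; left].
    have -> : G (1, y) = 0.
      by apply: GB; [split; rewrite /= in_itv /= ?lexx ?ler01 ?ltW|left; right].
    by rewrite !mulr0.
  - by move=> K; exact: slice_continuous_nice.
  - move=> K y x; have dT := is_derive_Theta_x be et xst sb0 se0 x y.
    have dA (q' : R * R * R) : is_derive x 1 (fun x : R => aff q' (x, y)) q'.1.2.
      by rewrite /aff /=; apply: is_derive_eq; rewrite /GRing.scale /=; ring.
    have dG := dA (q K); have dI := dA (qi K).
    rewrite /F /err_value; apply: is_derive_eq.
    by rewrite /D1 /err_value /GRing.scale /=; ring.
  - by move=> K y; have [_ h _] := sD1 K; exact: h.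
have S2 : \sum_K integral2 (oK K) (D2 K) = 0.
  apply: (@sum_integral2_derive_y _ _ xs ys (ltxs N0 evN lx0 lx2) (ltys N0 evN ly0 ly2)
    (mesh_0 N lx) (mesh_N lx N0 evN) (mesh_0 N ly) (mesh_N ly N0 evN) F D2 H HF).
  - move=> x /andP[x0 x1]; rewrite /H.
    have -> : G (x, 0) = 0.
      by apply: GB; [split; rewrite /= in_itv /= ?lexx ?ler01 ?ltW|right; left].
    have -> : G (x, 1) = 0.
      by apply: GB; [split; rewrite /= in_itv /= ?lexx ?ler01 ?ltW|right; right].
    by rewrite !mulr0.
  - by move=> K; exact: slice_continuous_nice.
  - move=> K x y; have dT := is_derive_Theta_y be et xst sb0 se0 x y.
    have dA (q' : R * R * R) : is_derive y 1 (fun y : R => aff q' (x, y)) q'.2.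
      by rewrite /aff /=; apply: is_derive_eq; rewrite /GRing.scale /=; ring.
    have dG := dA (q K); have dI := dA (qi K).
    rewrite /F /err_value; apply: is_derive_eq.
    by rewrite /D2 /err_value /GRing.scale /=; ring.
  - by move=> K x; have [_ _ h] := sD2 K; exact: h.
have nD1 (K : tri_index N) : bmeasurable (D1 K) by exact: slice_continuous_nice.
have nD2 (K : tri_index N) : bmeasurable (D2 K) by exact: slice_continuous_nice.
transitivity (be.1 * \sum_K integral2 (oK K) (D1 K) + be.2 * \sum_K integral2 (oK K) (D2 K)).
  rewrite !mulr_sumr -big_split; apply: eq_bigr => K _ /=.
  rewrite -integral2_lin2//; apply: integral2_eq => p _.
  rewrite -[b1 P / b]/(be.1) -[b2 P / b]/(be.2).
  by rewrite /err_beta -Theta_beta_grad /D1 /D2 /err_value /gbeta; ring.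
by rewrite S1 S2 !mulr0 addr0.
Qed.

(** The integrand of the bilinear form at (Theta G, G), minus one half of the
    exact derivative b (Theta G^2)_beta; this leaves (b/2) Theta_beta G^2 from
    the convection term. *)
Definition energy_main q (K : tri_index N) p : R :=
  eps * ((THb p * aff (q K) p + TH p * gbeta be (q K)) * gbeta be (q K))
  + tri_epshat eps modified K * ((THe p * aff (q K) p + TH p * geta et (q K)) * geta et (q K))
  + (b * (THb p * aff (q K) p + TH p * gbeta be (q K)) + c P * (TH p * aff (q K) p))
    * (aff (q K) p + tri_delta P K * b * gbeta be (q K))
  - b / 2 * (2 * (TH p * aff (q K) p * gbeta be (q K)) + THb p * aff (q K) p ^+ 2).

(** The bilinear form at (Theta G - I, G), except that the convection term has
    been integrated by parts so that the error itself, not its derivative,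
    multiplies the streamline derivative of G. *)
Definition energy_err q qi (K : tri_index N) p : R :=
  eps * (err_beta q qi K p * gbeta be (q K)) + tri_epshat eps modified K * (err_eta q qi K p * geta et (q K))
  + c P * err_value q qi K p * aff (q K) p - b * (err_value q qi K p * gbeta be (q K))
  + (b * err_beta q qi K p + c P * err_value q qi K p) * (tri_delta P K * b * gbeta be (q K)).

Let nTH : bmeasurable TH. Proof. exact: bmeasurable_Theta. Qed.
Let nTHb : bmeasurable THb. Proof. exact: bmeasurable_Theta_beta. Qed.
Let nTHe : bmeasurable THe. Proof. exact/slice_continuous_nice/slice_continuous_Theta_eta. Qed.

Lemma bmeasurable_energy_main q K : bmeasurable (energy_main q K).
Proof.
rewrite /energy_main; apply: bmeasurableB; bmeasurable_tac.
Qed.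

Lemma bmeasurable_err_value q qi K : bmeasurable (err_value q qi K). Proof. by apply: bmeasurableB; bmeasurable_tac. Qed.
Lemma bmeasurable_err_beta q qi K : bmeasurable (err_beta q qi K). Proof. by apply: bmeasurableB; bmeasurable_tac. Qed.
Lemma bmeasurable_err_eta q qi K : bmeasurable (err_eta q qi K). Proof. by apply: bmeasurableB; bmeasurable_tac. Qed.

Lemma bmeasurable_energy_err q qi K : bmeasurable (energy_err q qi K).
Proof.
have n0 := bmeasurable_err_value q qi K; have n1 := bmeasurable_err_beta q qi K; have n2 := bmeasurable_err_eta q qi K.
apply: bmeasurableD; last by bmeasurable_tac.
by apply: bmeasurableB; bmeasurable_tac.
Qed.

(** Both integrations by parts are instances of the same identity: for the
    error, and for Theta G alone, that is with interpolant zero. *)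
Lemma energy_identity (G I : R * R -> R) q qi :
  pieces P eps G q -> pieces P eps I qi ->
  (forall p, (Omegabar `\` Omega) p -> G p = 0) ->
  \sum_K integral2 (oK K) (energy_main q K) =
  a_MSD P N eps modified I G + \sum_K integral2 (oK K) (energy_err q qi K).
Proof.
move=> Gq Iqi GO.
have S1 := sum_integral2_directional Gq Iqi GO.
have p0 : @pieces R P N eps (fun=> 0) (fun=> (0, 0, 0)).
  by move=> K p Tp; rewrite /aff /= !mul0r !addr0.
have S2 := sum_integral2_directional Gq p0 GO.
rewrite (a_MSD_sum modified N0 evN lx0 lx2 ly0 ly2 Iqi Gq).
set A := (A in _ = A + _); set B := (B in _ = A + B).
suff : A = \sum_K integral2 (oK K) (energy_main q K) - B - b * 0 + b / 2 * 0 by lra.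
rewrite -[X in b * X]S1 -[X in b / 2 * X]S2 /A /B !mulr_sumr -sumrB -sumrB -big_split.
apply: eq_bigr => K _ /=.
have mT := measurable_open_tri xs ys K.
have sT := open_tri_sub N0 evN lx0 lx2 ly0 ly2 (K := K).
have n0 := bmeasurable_err_value q qi K; have n1 := bmeasurable_err_beta q qi K; have n2 := bmeasurable_err_eta q qi K.
have n0' := bmeasurable_err_value q (fun=> (0, 0, 0)) K; have n1' := bmeasurable_err_beta q (fun=> (0, 0, 0)) K.
have m1 := bmeasurable_energy_main q K; have m2 := bmeasurable_energy_err q qi K.
have m3 : bmeasurable (fun p => err_value q qi K p * gbeta be (q K) + err_beta q qi K p * aff (q K) p) by bmeasurable_tac.
have m4 : bmeasurable (fun p => err_value q (fun=> (0, 0, 0)) K p * gbeta be (q K) +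
   err_beta q (fun=> (0, 0, 0)) K p * aff (q K) p) by bmeasurable_tac.
have m5 : bmeasurable (fun p => b * (err_value q qi K p * gbeta be (q K) + err_beta q qi K p * aff (q K) p)) by bmeasurable_tac.
have m6 : bmeasurable (fun p => b / 2 * (err_value q (fun=> (0, 0, 0)) K p * gbeta be (q K) +
   err_beta q (fun=> (0, 0, 0)) K p * aff (q K) p)) by bmeasurable_tac.
have m7 : bmeasurable (fun p => energy_main q K p - energy_err q qi K p) by exact: bmeasurableB.
rewrite -!integral2Z// -!integral2B// -integral2D//; last exact: bmeasurableB.
apply: integral2_eq => p _.
have z0 : aff ((0, 0, 0) : R * R * R) p = 0 by rewrite /aff /= !mul0r !addr0.
have zb : gbeta be ((0, 0, 0) : R * R * R) = 0 by rewrite /gbeta !mulr0 addr0.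
by rewrite /bilinear_density /energy_main /energy_err /err_value /err_beta /err_eta z0 zb; field.
Qed.

End EnergyBound.

(** * Error on the cells of the coarse region *)

Section CoarsePure.
Context {R : realType}.

Lemma sqrt_ge1 (x : R) : 1 <= x -> 1 <= Num.sqrt x.
Proof.
move=> x1; rewrite -[leLHS]sqrtr1; apply: ler_wsqrtr; exact: x1.
Qed.

Lemma sqrt_le1 (x : R) : x <= 1 -> Num.sqrt x <= 1.
Proof. by move=> x1; rewrite -[leRHS]sqrtr1; apply: ler_wsqrtr. Qed.

(** The scalar inequality behind the estimate on isotropic cells, after division
    by the weight; kap stands for the quotient Theta_beta / Theta at the corner.
    The right-hand factor is the local energy D^2; each of the three terms of
    the first factor is at most a multiple of D / sqrt(k n), and the second
    factor is at most 4 D sqrt n. For the term with ge there are two ways: when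
    epshat is at most n^(-2) the inverse estimate ge <= 4 n M is used, otherwise
    ge <= D / sqrt epshat; these are the two alternatives of the last
    hypothesis, and they match the two definitions of the lower bound on
    sigma_eta. *)
Lemma coarse_scalar_bound (n k s kap M gb ge eps eh : R) :
  1 <= n -> 1 <= k -> 0 < s -> 0 <= kap -> 0 <= M -> 0 <= gb -> 0 <= ge ->
  0 < eps -> eps <= eh -> n * eh <= 1 -> k * kap <= n -> ge <= 4 * n * M ->
  k <= n * s -> k <= n * Num.sqrt n * s ^+ 2 ->
  (k <= Num.sqrt n * s) \/ (k <= Num.sqrt eh * (n * Num.sqrt n) * s) ->
  (kap * M / n + (gb + ge) / (n ^+ 2 * s) + M / (n ^+ 2 * s ^+ 2)) *
    (eps * n * gb + eh * n * ge + M + gb) <=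
  28 / Num.sqrt k * (eps * gb ^+ 2 + eh * ge ^+ 2 + kap * M ^+ 2 + M ^+ 2 + gb ^+ 2 / n).
Proof.
move=> n1 k1 s0 kap0 M0 gb0 ge0 e0 eeh neh kkap geM kns knns hcase.
have eh0 : 0 < eh by exact: lt_le_trans e0 eeh.
have n0 : 0 < n by lra.
have k0 : 0 < k by lra.
set r := Num.sqrt n; set sk := Num.sqrt k.
have r0 : 0 < r by rewrite sqrtr_gt0.
have sk0 : 0 < sk by rewrite sqrtr_gt0.
have rr : r ^+ 2 = n by rewrite sqr_sqrtr// ltW.
have sksk : sk ^+ 2 = k by rewrite sqr_sqrtr// ltW.
have r1 : 1 <= r by apply: sqrt_ge1.
have sk1 : 1 <= sk by apply: sqrt_ge1.
have ksk : k^-1 <= sk^-1.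
  by rewrite lef_pV2// -sksk expr2; rewrite ler_peMl// ltW.
set D2 := (X in _ <= _ * X).
have D20 : 0 <= D2.
  rewrite /D2; have [[e' h'] n'] := (ltW e0, ltW eh0, ltW n0).
  by nonneg_tac.
set D := Num.sqrt D2.
have D0 : 0 <= D by exact: sqrtr_ge0.
have DD : D ^+ 2 = D2 by rewrite sqr_sqrtr.
have leD x : 0 <= x -> x ^+ 2 <= D2 -> x <= D.
  by move=> x0 h; rewrite -ler_sqr ?nnegrE// DD.
have q1 : 0 <= eps * gb ^+ 2 by rewrite mulr_ge0 ?sqr_ge0// ltW.
have q2 : 0 <= eh * ge ^+ 2 by rewrite mulr_ge0 ?sqr_ge0// ltW.
have q3 : 0 <= kap * M ^+ 2 by rewrite mulr_ge0 ?sqr_ge0.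
have q4 := sqr_ge0 M.
have q5 : 0 <= gb ^+ 2 / n by rewrite divr_ge0 ?sqr_ge0// ltW.
have sq (x : R) : 0 <= x -> Num.sqrt x ^+ 2 = x by exact: sqr_sqrtr.
have d1 : Num.sqrt eps * gb <= D.
  by apply: leD; [rewrite mulr_ge0// sqrtr_ge0|rewrite exprMn sq ?(ltW e0)// /D2; lra].
have d2 : Num.sqrt eh * ge <= D.
  by apply: leD; [rewrite mulr_ge0// sqrtr_ge0|rewrite exprMn sq ?(ltW eh0)// /D2; lra].
have d3 : Num.sqrt kap * M <= D.
  by apply: leD; [rewrite mulr_ge0// sqrtr_ge0|rewrite exprMn sq// /D2; lra].
have d4 : M <= D by apply: leD => //; rewrite /D2; lra.
have d5 : gb <= r * D.
  have : gb / r <= D.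
    by apply: leD; [rewrite divr_ge0// ltW|rewrite expr_div_n rr /D2 [leRHS]addrC lerDl; nonneg_tac].
  by rewrite ler_pdivrMr// mulrC.
have x1 : kap * M / n * r <= D / sk.
  have h : Num.sqrt kap <= r / sk.
    by rewrite ler_pdivlMr// /r /sk -sqrtrM//; apply: ler_wsqrtr; lra.
  have -> : kap * M / n * r = (Num.sqrt kap * M) * (Num.sqrt kap / r).
    rewrite -[in LHS](sq _ kap0) -rr; field; exact: lt0r_neq0.
  apply: ler_pM.
  - by rewrite mulr_ge0// sqrtr_ge0.
  - by apply: divr_ge0; [exact: sqrtr_ge0|exact: ltW].
  - exact: d3.
  - by rewrite ler_pdivrMr// mulrC.
have x2 : gb / (n ^+ 2 * s) * r <= D / sk.
  apply: (@le_trans _ _ (D / k)); last by rewrite ler_wpM2l.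
  have -> : gb / (n ^+ 2 * s) * r = (gb * r / n) / (n * s).
    by field; rewrite !lt0r_neq0.
  rewrite ler_pdivrMr ?mulr_gt0// [leRHS]mulrAC ler_pdivlMr//.
  apply: ler_pM => //; try lra.
    by rewrite divr_ge0 ?mulr_ge0// ltW.
  by rewrite ler_pdivrMr// -rr expr2; have := ler_wpM2r (ltW r0) d5; lra.
have x3 : ge / (n ^+ 2 * s) * r <= 4 * (D / sk).
  apply: (@le_trans _ _ (4 * (D / k))); last by rewrite ler_wpM2l ?ler_wpM2l.
  case: hcase => hc.
    apply: (@le_trans _ _ (4 * n * M / (n ^+ 2 * s) * r)).
      by rewrite ler_wpM2r ?ler_wpM2r ?invr_ge0 ?mulr_ge0 ?sqr_ge0// ltW.
    have -> : 4 * n * M / (n ^+ 2 * s) * r = 4 * (M / (r * s)).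
      by rewrite -rr; field; rewrite !lt0r_neq0.
    rewrite ler_wpM2l// ler_pdivrMr ?mulr_gt0// [leRHS]mulrAC ler_pdivlMr//.
    by apply: ler_pM => //; exact: ltW.
  apply: (@le_trans _ _ (D / k)); last by have : 0 <= D / k by [rewrite divr_ge0// ltW]; lra.
  have -> : ge / (n ^+ 2 * s) * r = ge / (n * r * s).
    by rewrite -rr; field; rewrite !lt0r_neq0.
  rewrite ler_pdivrMr ?mulr_gt0// [leRHS]mulrAC ler_pdivlMr//.
  apply: (@le_trans _ _ (ge * (Num.sqrt eh * (n * r) * s))).
    by rewrite ler_wpM2l.
  have := ler_wpM2r (mulr_ge0 (mulr_ge0 (ltW n0) (ltW r0)) (ltW s0)) d2; lra.
have x4 : M / (n ^+ 2 * s ^+ 2) * r <= D / sk.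
  apply: (@le_trans _ _ (D / k)); last by rewrite ler_wpM2l.
  have -> : M / (n ^+ 2 * s ^+ 2) * r = M / (n * r * s ^+ 2).
    by rewrite -rr; field; rewrite !lt0r_neq0.
  rewrite ler_pdivrMr ?mulr_gt0 ?exprn_gt0// [leRHS]mulrAC ler_pdivlMr//.
  by apply: ler_pM => //; exact: ltW.
set X0 := kap * M / n + _ + _.
have X00 : 0 <= X0.
  have [n' s'] := (ltW n0, ltW s0).
  by rewrite /X0 !addr_ge0 ?divr_ge0 ?mulr_ge0 ?addr_ge0 ?sqr_ge0.
have X0r : X0 * r <= 7 * (D / sk).
  by rewrite /X0 !mulrDl; have := x1; lra.
have er : Num.sqrt eps * r <= 1.
  rewrite /r -sqrtrM ?(ltW e0)//; apply: sqrt_le1.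
  have := ler_wpM2r (ltW n0) eeh; lra.
have hr : Num.sqrt eh * r <= 1.
  by rewrite /r -sqrtrM ?(ltW eh0)//; apply: sqrt_le1; lra.
have y1 : eps * n * gb <= r * D.
  have -> : eps * n * gb = r * ((Num.sqrt eps * r) * (Num.sqrt eps * gb)).
    by rewrite -[in LHS](sq _ (ltW e0)) -rr; ring.
  rewrite ler_wpM2l ?(ltW r0)//; apply: le_trans d1.
  by rewrite ler_piMl// mulr_ge0// sqrtr_ge0.
have y2 : eh * n * ge <= r * D.
  have -> : eh * n * ge = r * ((Num.sqrt eh * r) * (Num.sqrt eh * ge)).
    by rewrite -[in LHS](sq _ (ltW eh0)) -rr; ring.
  rewrite ler_wpM2l ?(ltW r0)//; apply: le_trans d2.
  by rewrite ler_piMl// mulr_ge0// sqrtr_ge0.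
have y3 : M <= r * D.
  by apply: (le_trans d4); rewrite ler_peMl.
set Y := _ + gb.
have Y4 : Y <= 4 * (r * D) by rewrite /Y; lra.
have -> : 28 / sk * D2 = 7 * (D / sk) / r * (4 * (r * D)).
  by rewrite -DD; field; rewrite !lt0r_neq0.
apply: ler_pM => //.
  have [n' [e' h']] := (ltW n0, (ltW e0, ltW eh0)).
  by rewrite /Y; nonneg_tac.
by rewrite ler_pdivlMr.
Qed.

End CoarsePure.

Section LocalBounds.
Context {R : realType}.
Variables (P : data R) (N : nat) (eps : R) (modified : bool).
Hypotheses (N0 : (0 < N)%N) (evN : ~~ odd N) (eps0 : 0 < eps).
Local Notation lx := (lambda_x P N eps).
Local Notation ly := (lambda_y P N eps).
Hypotheses (lx0 : 0 < lx) (lx2 : lx <= 1/2) (ly0 : 0 < ly) (ly2 : ly <= 1/2).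
Hypotheses (b0 : 0 < bnorm P) (c0 : 0 < c P) (Cs0 : 0 < Cstar P).
Local Notation xs := (mesh_point N lx).
Local Notation ys := (mesh_point N ly).
Local Notation b := (bnorm P).
Local Notation be := (beta_dir P).
Local Notation et := (eta_dir P).
Local Notation oK := (@open_tri R N xs ys).
Local Notation cK := (@closed_tri R N xs ys).
Local Notation n := (N%:R : R).
Variables (xst : R * R) (sb se : R).
Hypotheses (sb0 : 0 < sb) (se0 : 0 < se).
Hypotheses (sbn : 16 <= n * sb) (sen : 16 <= n * se).
Local Notation TH := (Theta be et xst sb se).
Local Notation THb := (Theta_beta be et xst sb se).
Local Notation THe := (Theta_eta be et xst sb se).
Implicit Types (q qi : tri_index N -> R * R * R) (K : tri_index N).

Local Notation ck K := (corner xs ys K).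
Local Notation uk K := (signed_width xs K).
Local Notation wk K := (signed_height ys K).
Definition area K : R := `|uk K * wk K|.
Definition corner_weight K : R := TH (ck K).
Definition corner_dweight K : R := THb (ck K).
Definition vertex_max q K : R := vmax (ck K) (uk K) (wk K) (aff (q K)).

Let n0 : 0 < n. Proof. by rewrite ltr0n. Qed.

Lemma mesh_widthE K : `|uk K| = if (K.1.1 < N./2)%N then coarse_h N lx else fine_h N lx.
Proof.
have h := mesh_lt N0 evN lx0 lx2 K.1.1.
rewrite -mesh_step// /signed_width; case: (K.2); rewrite ?signed_step_true ?signed_step_false ?normrN;
  by rewrite gtr0_norm// subr_gt0.
Qed.

Lemma mesh_heightE K : `|wk K| = if (K.1.2 < N./2)%N then coarse_h N ly else fine_h N ly.
Proof.
have h := mesh_lt N0 evN ly0 ly2 K.1.2.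
rewrite -mesh_step// /signed_height; case: (K.2); rewrite ?signed_step_true ?signed_step_false ?normrN;
  by rewrite gtr0_norm// subr_gt0.
Qed.

Lemma mesh_width_le K : `|uk K| <= 2 / n.
Proof.
rewrite mesh_widthE; have h := coarse_h_le N0 lx0; case: ifP => // _.
exact: le_trans (fine_h_le N0 lx2) h.
Qed.

Lemma mesh_height_le K : `|wk K| <= 2 / n.
Proof.
rewrite mesh_heightE; have h := coarse_h_le N0 ly0; case: ifP => // _.
exact: le_trans (fine_h_le N0 ly2) h.
Qed.

Let u0 K : uk K != 0. Proof. exact: mesh_width_neq0. Qed.
Let w0 K : wk K != 0. Proof. exact: mesh_height_neq0. Qed.
Let ub : be.1 ^+ 2 + be.2 ^+ 2 = 1. Proof. exact: unit_be. Qed.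

Lemma corner_weight_gt0 K : 0 < corner_weight K. Proof. exact: Theta_gt0. Qed.
Lemma corner_dweight_gt0 K : 0 < corner_dweight K. Proof. exact: Theta_beta_gt0. Qed.
Lemma vertex_max_ge0 q K : 0 <= vertex_max q K. Proof. exact: vmax_ge0. Qed.
Lemma area_ge0 K : 0 <= area K. Proof. exact: normr_ge0. Qed.

Lemma corner_weight_comparable K p : cK K p ->
  [/\ TH p <= 2 * corner_weight K, corner_weight K <= 2 * TH p, THb p <= 2 * corner_dweight K & corner_dweight K <= 2 * THb p].
Proof.
exact: (T_comparable xst sb0 se0 ub (etE P) (u0 K) (w0 K) n0 (mesh_width_le K) (mesh_height_le K) sbn sen).
Qed.

(** The weighted energy density with the weight evaluated at the corner and the
    function replaced by its maximal vertex value; times the area it is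
    comparable with the weighted energy of the triangle. *)
Definition local_energy q K : R :=
  corner_weight K * (eps * gbeta be (q K) ^+ 2 + tri_epshat eps modified K * geta et (q K) ^+ 2 +
   vertex_max q K ^+ 2 + tri_delta P K / Cstar P * gbeta be (q K) ^+ 2) + corner_dweight K * vertex_max q K ^+ 2.

Definition energy_const : R := 1 + 2 / b + 1 / c P + 1 / (b ^+ 2 * Cstar P).

Lemma energy_const_parts : [/\ 1 <= energy_const, 2 / b <= energy_const, 1 / c P <= energy_const & 1 / (b ^+ 2 * Cstar P) <= energy_const].
Proof.
have k1 : 0 <= 2 / b by apply: divr_ge0 => //; exact: ltW.
have k2 : 0 <= 1 / c P by apply: divr_ge0 => //; exact: ltW.
have k3 : 0 <= 1 / (b ^+ 2 * Cstar P).
  by apply: divr_ge0 => //; apply: mulr_ge0; [exact: sqr_ge0|exact: ltW].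
rewrite /energy_const; move: (2 / b) (1 / c P) (1 / _) k1 k2 k3 => x y z x0 y0 z0.
by split; lra.
Qed.

Lemma energy_const_ge0 : 0 <= energy_const.
Proof. by have [h _ _ _] := energy_const_parts; apply: le_trans h. Qed.

Lemma local_energy_le q K : area K * local_energy q K <= 1024 * energy_const * integral2 (oK K) (weighted_density P eps modified xst sb se q K).
Proof.
have mT := measurable_open_tri xs ys K.
have sT := open_tri_sub N0 evN lx0 lx2 ly0 ly2 (K := K).
have nT : bmeasurable TH := bmeasurable_Theta P xst sb se.
have nTb : bmeasurable THb := bmeasurable_Theta_beta P xst sb se.
have cmp p : oK K p -> _ := fun Tp => corner_weight_comparable (otri_ctri Tp).
have T0 := ltW (corner_weight_gt0 K); have S0 := ltW (corner_dweight_gt0 K).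
set gb2 := gbeta be (q K) ^+ 2; set ge2 := geta et (q K) ^+ 2.
have gb20 : 0 <= gb2 by exact: sqr_ge0.
have ge20 : 0 <= ge2 by exact: sqr_ge0.
have h1 : area K * (corner_weight K * vertex_max q K ^+ 2) <= 1024 * integral2 (oK K) (fun p => TH p * aff (q K) p ^+ 2).
  have := vmax_le_integral2 (u0 K) (w0 K) sT (q K) (m := corner_weight K / 2) nT.
  rewrite -/(area K) -/(vertex_max q K) => H.
  suff : area K * (corner_weight K / 2 * vertex_max q K ^+ 2) <= 512 * integral2 (oK K) (fun p => TH p * aff (q K) p ^+ 2) by lra.
  by apply: H => [|p /cmp[]]; lra.
have h2 : area K * (corner_dweight K * vertex_max q K ^+ 2) <= 1024 * integral2 (oK K) (fun p => THb p * aff (q K) p ^+ 2).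
  have := vmax_le_integral2 (u0 K) (w0 K) sT (q K) (m := corner_dweight K / 2) nTb.
  rewrite -/(area K) -/(vertex_max q K) => H.
  suff : area K * (corner_dweight K / 2 * vertex_max q K ^+ 2) <= 512 * integral2 (oK K) (fun p => THb p * aff (q K) p ^+ 2) by lra.
  by apply: H => [|p /cmp[]]; lra.
have h3 (x : R) : 0 <= x -> area K * (corner_weight K * x) <= 1024 * integral2 (oK K) (fun p => TH p * x).
  move=> x0; have Tx : 0 <= corner_weight K * x by rewrite mulr_ge0.
  have e1 := integral2_cst_ge (u0 K) (w0 K) sT Tx; rewrite -/(area K) in e1.
  have e2 : integral2 (oK K) (fun=> corner_weight K * x) <= 2 * integral2 (oK K) (fun p => TH p * x).
    rewrite -integral2Z//; last by bmeasurable_tac.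
    apply: integral2_le => //; try by bmeasurable_tac.
    by move=> p /cmp[_ h _ _]; have := ler_wpM2r x0 h; lra.
  have e3 : 0 <= integral2 (oK K) (fun p => TH p * x).
    by apply: integral2_ge0 => p _; rewrite mulr_ge0// ltW// Theta_gt0.
  lra.
have eh0 : 0 <= tri_epshat eps modified K by exact: le_trans (ltW eps0) (tri_epshat_ge eps modified K).
have d0 : 0 <= tri_delta P K by exact: tri_delta_ge0.
have ds0 : 0 <= tri_delta P K / Cstar P by rewrite divr_ge0// ltW.
have -> : area K * local_energy q K = eps * (area K * (corner_weight K * gb2)) +
   tri_epshat eps modified K * (area K * (corner_weight K * ge2)) + area K * (corner_weight K * vertex_max q K ^+ 2) +
   tri_delta P K / Cstar P * (area K * (corner_weight K * gb2)) + area K * (corner_dweight K * vertex_max q K ^+ 2).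
  by rewrite /local_energy -/gb2 -/ge2; ring.
have i1 := ler_wpM2l (ltW eps0) (h3 _ gb20); have i2 := ler_wpM2l eh0 (h3 _ ge20).
have i3 := ler_wpM2l ds0 (h3 _ gb20).
set j1 := integral2 _ _ in h1; set j2 := integral2 _ _ in h2; set j3 := integral2 _ _ in i1; set j4 := integral2 _ _ in i2.
rewrite -/j3 in i3.
suff : eps * j3 + tri_epshat eps modified K * j4 + j1 + tri_delta P K / Cstar P * j3 + j2 <=
  energy_const * integral2 (oK K) (weighted_density P eps modified xst sb se q K) by lra.
rewrite /j1 /j2 /j3 /j4 -!integral2Z//; try by bmeasurable_tac.
rewrite -!integral2D//; try by bmeasurable_tac.
have nd := bmeasurable_weighted_density P eps modified xst sb se q K.
apply: integral2_le => //; try by bmeasurable_tac.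
move=> p _; rewrite /weighted_density -/gb2 -/ge2.
have t := ltW (Theta_gt0 be et xst sb se p); have t' := ltW (Theta_beta_gt0 be et xst se sb0 p).
set X := TH p * gb2; set Y := TH p * ge2; set Z := THb p * _; set V := TH p * _ ^+ 2.
have X0 : 0 <= X by exact: mulr_ge0.
have Y0 : 0 <= Y by exact: mulr_ge0.
have Z0 : 0 <= Z by rewrite mulr_ge0// sqr_ge0.
have V0 : 0 <= V by rewrite mulr_ge0// sqr_ge0.
have [[b' c'] s'] := (ltW b0, ltW c0, ltW Cs0).
have [a1 a2 a3 a4] := energy_const_parts.
have f1 : eps * X <= energy_const * (eps * X) by rewrite ler_peMl// mulr_ge0// ltW.
have f2 : tri_epshat eps modified K * Y <= energy_const * (tri_epshat eps modified K * Y).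
  by rewrite ler_peMl// mulr_ge0.
have f3 : Z <= energy_const * (b / 2 * Z).
  have bz : 0 <= b / 2 * Z by nonneg_tac.
  apply: le_trans (ler_wpM2r bz a2); rewrite mulrA.
  have e : 2 / b * (b / 2) = 1 by field; rewrite lt0r_neq0.
  by rewrite e mul1r.
have f4 : V <= energy_const * (c P * V).
  apply: le_trans (ler_wpM2r (mulr_ge0 c' V0) a3); rewrite mulrA.
  by rewrite div1r mulVf ?lt0r_neq0// mul1r.
have f5 : tri_delta P K / Cstar P * X <= energy_const * (b ^+ 2 * tri_delta P K * X).
  have bz : 0 <= b ^+ 2 * tri_delta P K * X by nonneg_tac.
  apply: le_trans (ler_wpM2r bz a4).
  rewrite le_eqVlt; apply/orP; left; apply/eqP; field.
  by rewrite !lt0r_neq0.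
clear h1 h2 i1 i2 i3 a1 a2 a3 a4 t t'; lra.
Qed.

Variables (q qi : tri_index N -> R * R * R).
Hypothesis Hv : forall K, [/\ aff (qi K) (ck K) = TH (ck K) * aff (q K) (ck K),
  aff (qi K) (vtx1 (ck K) (uk K)) = TH (vtx1 (ck K) (uk K)) * aff (q K) (vtx1 (ck K) (uk K)) &
  aff (qi K) (vtx2 (ck K) (wk K)) = TH (vtx2 (ck K) (wk K)) * aff (q K) (vtx2 (ck K) (wk K))].

Local Notation ER1 K p := (interp_err_x be et xst sb se (q K) p (qi K)).
Local Notation ER2 K p := (interp_err_y be et xst sb se (q K) p (qi K)).

Lemma err_betaE K p : err_beta P xst sb se q qi K p = be.1 * ER1 K p + be.2 * ER2 K p.
Proof. by rewrite /err_beta -(Theta_beta_grad b0 xst sb0 se0) /interp_err_x /interp_err_y /gbeta; ring. Qed.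

Lemma err_etaE K p : err_eta P xst sb se q qi K p = et.1 * ER1 K p + et.2 * ER2 K p.
Proof.
rewrite /err_eta.
have -> : THe p = et.1 * Theta_x be et xst sb se p + et.2 * Theta_y be et xst sb se p.
  have := ub; rewrite /Theta_x /Theta_y (etE P); move: (be) => B u /=.
  transitivity ((B.1 ^+ 2 + B.2 ^+ 2) * Theta_eta B (- B.2, B.1) xst sb se p); last by ring.
  by rewrite u mul1r.
by rewrite /interp_err_x /interp_err_y /geta; ring.
Qed.

Lemma et_le1 : `|et.1| <= 1 /\ `|et.2| <= 1.
Proof. by have [h1 h2] := be_le1 ub; rewrite (etE P) /= normrN. Qed.

Lemma err_value_interp_err K p : err_value P xst sb se q qi K p = interp_err be et xst sb se (q K) p (qi K).
Proof. by []. Qed.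

Section CoarseCell.
Variable k : R.
Hypotheses (k1 : 1 <= k) (eps_eh : n * epshat_s N eps modified <= 1).
Hypotheses (kb : k <= n * sb) (ke : k <= n * se) (kee : k <= n * Num.sqrt n * se ^+ 2).
Hypothesis hcase : (k <= Num.sqrt n * se) \/
  (k <= Num.sqrt (epshat_s N eps modified) * (n * Num.sqrt n) * se).
Hypothesis hcd : c P * (Cstar P * n^-1) <= 1 / 2.

Definition coarse_const : R := 480 * (1 + b + c P + b ^+ 2 * Cstar P).

Lemma coarse_const_parts : [/\ 0 <= coarse_const, 256 <= coarse_const, 320 * c P <= coarse_const &
  480 * b + 256 * (b ^+ 2 * Cstar P) <= coarse_const].
Proof.
have h : 0 <= b ^+ 2 * Cstar P by apply: mulr_ge0; [exact: sqr_ge0|exact: ltW].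
have hb := ltW b0; have hc := ltW c0; rewrite /coarse_const.
by move: (b ^+ 2 * Cstar P) h => x x0; split; lra.
Qed.

(** The pointwise interpolation bounds reduce the integrand to the product
    estimated in the scalar inequality, and the outcome is again a multiple of
    the local energy. *)
Lemma energy_err_coarse K : coarse K ->
  integral2 (oK K) (energy_err P eps modified xst sb se q qi K) <=
  coarse_const * 28 * 1024 * energy_const / Num.sqrt k * integral2 (oK K) (weighted_density P eps modified xst sb se q K).
Proof.
move=> cK'; have /andP[ci cj] := cK'.
have mT := measurable_open_tri xs ys K.
have sT := open_tri_sub N0 evN lx0 lx2 ly0 ly2 (K := K).
have [[b' c'] s'] := (ltW b0, ltW c0, ltW Cs0).
have k0 : 0 < k by have := k1; lra.
have nn1 : 1 <= n by rewrite ler1n.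
have [CC0 l1 l2 l3] := coarse_const_parts.
have M0 := vertex_max_ge0 q K; have T0 := corner_weight_gt0 K; have S0 := corner_dweight_gt0 K.
set gb := `|gbeta be (q K)|; set gE := `|geta et (q K)|.
set eh := epshat_s N eps modified.
have ehE : tri_epshat eps modified K = eh by rewrite /tri_epshat cK'.
have dE : tri_delta P K = Cstar P / n by rewrite /tri_delta cK'.
have eeh : eps <= eh by exact: epshat_s_ge.
have hu : n^-1 <= `|uk K| by rewrite mesh_widthE ci; exact: coarse_h_ge.
have hw : n^-1 <= `|wk K| by rewrite mesh_heightE cj; exact: coarse_h_ge.
(* both sides of the cell are at least 1/n, so differences of vertex values
   bound the gradient *)
have inv : gE <= 4 * n * vertex_max q K.
  have aux (z e g0 g1 : R) : z != 0 -> n^-1 <= `|z| -> e * z = g1 - g0 -> `|g0| <= vertex_max q K ->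
     `|g1| <= vertex_max q K -> `|e| <= 2 * n * vertex_max q K.
    move=> z0 nz ez h0 h1.
    have : `|e| * `|z| <= 2 * vertex_max q K.
      by rewrite -normrM ez; apply: (le_trans (ler_normB _ _)); lra.
    move=> h; have : `|e| * n^-1 <= 2 * vertex_max q K by apply: le_trans h; rewrite ler_wpM2l.
    by rewrite ler_pdivrMr// mulrAC.
  have g1 : `|(q K).1.2| <= 2 * n * vertex_max q K.
    apply: (aux (uk K) _ (aff (q K) (ck K)) (aff (q K) (vtx1 (ck K) (uk K)))) => //.
    - by rewrite /aff /=; ring.
    - exact: le_vmax0.
    - exact: le_vmax1.
  have g2 : `|(q K).2| <= 2 * n * vertex_max q K.
    apply: (aux (wk K) _ (aff (q K) (ck K)) (aff (q K) (vtx2 (ck K) (wk K)))) => //.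
    - by rewrite /aff /=; ring.
    - exact: le_vmax0.
    - exact: le_vmax2.
  have [e1 e2] := et_le1.
  rewrite /gE /geta; apply: (le_trans (ler_normD _ _)); rewrite (normrM et.1) (normrM et.2).
  have : `|et.1| * `|(q K).1.2| <= `|(q K).1.2| by rewrite ler_piMl.
  have : `|et.2| * `|(q K).2| <= `|(q K).2| by rewrite ler_piMl.
  lra.
(* after division by the weight at the corner, only the quotient kap of
   Theta_beta and Theta there is left *)
set kap := corner_dweight K / corner_weight K.
have SE : corner_dweight K = kap * corner_weight K by rewrite /kap divfK// lt0r_neq0.
have kap0 : 0 <= kap by rewrite divr_ge0// ltW.
have kkap : k * kap <= n.
  have h : kap <= sb^-1.
    by rewrite /kap ler_pdivrMr// mulrC ler_pdivlMr// mulrC; exact: Theta_beta_le.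
  apply: (@le_trans _ _ (k * sb^-1)); first by rewrite ler_wpM2l// ltW.
  by rewrite ler_pdivrMr.
have gb0 : 0 <= gb by exact: normr_ge0.
have ge0 : 0 <= gE by exact: normr_ge0.
have pure := coarse_scalar_bound nn1 k1 se0 kap0 M0 gb0 ge0 eps0 eeh eps_eh kkap inv ke kee hcase.
set X := kap * vertex_max q K / n + (gb + gE) / (n ^+ 2 * se) + vertex_max q K / (n ^+ 2 * se ^+ 2) in pure.
set Y := eps * n * gb + eh * n * gE + vertex_max q K + gb in pure.
set Z := (X in _ <= _ * X) in pure.
have XE : second_order_size be et xst sb se (ck K) (uk K) (wk K) n (q K) = corner_weight K * X.
  by rewrite /second_order_size -/(corner_weight K) -/(corner_dweight K) -/(vertex_max q K) -/gb -/gE SE /X; ring.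
have X0 : 0 <= corner_weight K * X.
  rewrite mulr_ge0 ?(ltW T0)// /X; have [hn hs] := (ltW n0, ltW se0).
  by nonneg_tac.
have bound p : oK K p -> energy_err P eps modified xst sb se q qi K p <=
    coarse_const * (corner_weight K * X) * Y.
  move=> Tp; have Tp' := otri_ctri Tp.
  have [v0 v1 v2] := Hv K.
  have [r0 r1 r2] := interp_err_coarse sb0 se0 ub (etE P) (u0 K) (w0 K) n0 (mesh_width_le K) (mesh_height_le K)
     sbn sen Tp' v0 v1 v2.
  rewrite XE in r0 r1 r2; set XX := corner_weight K * X in r0 r1 r2 X0 *.
  have s1 : `|ER1 K p| <= 128 * n * XX.
    have h : `|ER1 K p| * n^-1 <= 128 * XX by apply: le_trans r1; rewrite ler_wpM2l.
    by move: h; rewrite ler_pdivrMr// mulrAC.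
  have s2 : `|ER2 K p| <= 128 * n * XX.
    have h : `|ER2 K p| * n^-1 <= 128 * XX by apply: le_trans r2; rewrite ler_wpM2l.
    by move: h; rewrite ler_pdivrMr// mulrAC.
  have comb (x y : R) : `|x| <= 1 -> `|y| <= 1 -> `|x * ER1 K p + y * ER2 K p| <= 256 * n * XX.
    move=> x1 y1; apply: (le_trans (ler_normD _ _)); rewrite !normrM.
    have h1 : `|x| * `|ER1 K p| <= `|ER1 K p| by rewrite ler_piMl.
    have h2 : `|y| * `|ER2 K p| <= `|ER2 K p| by rewrite ler_piMl.
    lra.
  have [b1 b2] := be_le1 ub; have [e1 e2] := et_le1.
  have hb := comb _ _ b1 b2; rewrite -err_betaE in hb.
  have he := comb _ _ e1 e2; rewrite -err_etaE in he.
  rewrite -err_value_interp_err in r0.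
  have Ga : `|aff (q K) p| <= vertex_max q K by exact: aff_le_vmax.
  rewrite /energy_err ehE dE; move: hb he r0 Ga.
  set eb := err_beta _ _ _ _ _ _ _ _; set ee := err_eta _ _ _ _ _ _ _ _; set e := err_value _ _ _ _ _ _ _ _.
  set a := aff _ _; set m := vertex_max q K => hb he h0 ha.
  have t1 : eps * (eb * gbeta be (q K)) <= eps * (256 * n * XX * gb).
    rewrite ler_wpM2l ?(ltW eps0)//; apply: (le_trans (ler_norm _)); rewrite normrM.
    by rewrite ler_wpM2r.
  have t2 : eh * (ee * geta et (q K)) <= eh * (256 * n * XX * gE).
    rewrite ler_wpM2l ?(le_trans (ltW eps0))//; apply: (le_trans (ler_norm _)); rewrite normrM.
    by rewrite ler_wpM2r.
  have t3 : c P * e * a <= c P * (320 * XX * m).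
    rewrite -mulrA ler_wpM2l//; apply: (le_trans (ler_norm _)); rewrite normrM.
    by apply: ler_pM.
  have t4 : - (b * (e * gbeta be (q K))) <= b * (320 * XX * gb).
    rewrite -mulrN ler_wpM2l//; apply: (le_trans (ler_norm _)); rewrite normrN normrM.
    by rewrite ler_wpM2r.
  have cs0 : 0 <= Cstar P / n by rewrite divr_ge0// ltW.
  have t5 : (b * eb + c P * e) * (Cstar P / n * b * gbeta be (q K)) <=
     (b * (256 * n * XX) + c P * (320 * XX)) * (Cstar P / n * b * gb).
    apply: (le_trans (ler_norm _)); rewrite normrM; apply: ler_pM => //.
      apply: (le_trans (ler_normD _ _)); rewrite !normrM (ger0_norm b') (ger0_norm c').
      by apply: lerD; rewrite ler_wpM2l.
    by rewrite normrM (ger0_norm (mulr_ge0 cs0 b')).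
  have t6 : (b * (256 * n * XX) + c P * (320 * XX)) * (Cstar P / n * b * gb) =
     256 * (b ^+ 2 * Cstar P) * (XX * gb) + 320 * b * (XX * gb) * (c P * (Cstar P * n^-1)).
    by field; rewrite lt0r_neq0.
  have Xg : 0 <= XX * gb by rewrite mulr_ge0.
  have t7 : 320 * b * (XX * gb) * (c P * (Cstar P * n^-1)) <= 320 * b * (XX * gb) * (1 / 2).
    by apply: ler_wpM2l hcd; apply: mulr_ge0 Xg; apply: mulr_ge0 b'; exact: ler0n.
  have Y1 : 0 <= XX * (eps * n * gb) by have he0 := ltW eps0; have hn0 := ltW n0; nonneg_tac.
  have Y2 : 0 <= XX * (eh * n * gE).
    by have he0 := le_trans (ltW eps0) eeh; have hn0 := ltW n0; nonneg_tac.
  have Y3 : 0 <= XX * m by rewrite mulr_ge0.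
  have bC : 0 <= b ^+ 2 * Cstar P by nonneg_tac.
  have -> : coarse_const * XX * Y = coarse_const * (XX * (eps * n * gb)) + coarse_const * (XX * (eh * n * gE)) +
    coarse_const * (XX * m) + coarse_const * (XX * gb) by rewrite /Y -/m; ring.
  have lin (x y : R) : x <= coarse_const -> 0 <= y -> x * y <= coarse_const * y by move=> *; rewrite ler_wpM2r.
  have m1 := lin _ _ l1 Y1; have m2 := lin _ _ l1 Y2; have m3 := lin _ _ l2 Y3.
  have m4 := lin _ _ l3 Xg.
  clear Y1 Y2 Y3 Xg l1 l2 l3 hb he h0 ha pure inv s1 s2 X0 kkap.
  lra.
have nE := bmeasurable_energy_err P eps modified xst sb se q qi K.
have Y0 : 0 <= Y.
  rewrite /Y; have h1 := ltW eps0; have h2 := le_trans h1 eeh; have h3 := ltW n0.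
  by nonneg_tac.
have B0 : 0 <= coarse_const * (corner_weight K * X) * Y by nonneg_tac.
apply: (@le_trans _ _ (integral2 (oK K) (fun=> coarse_const * (corner_weight K * X) * Y))).
  by apply: integral2_le => //; bmeasurable_tac.
apply: (le_trans (integral2_cst_le (u0 K) (w0 K) sT B0)); rewrite -/(area K).
have sk0 : 0 < Num.sqrt k by rewrite sqrtr_gt0.
have LE : corner_weight K * Z = local_energy q K.
  rewrite /Z /local_energy SE ehE dE /gb /gE !real_normK ?num_real//.
  by field; rewrite !lt0r_neq0.
apply: (@le_trans _ _ (coarse_const * (28 / Num.sqrt k) * (area K * local_energy q K))).
  rewrite -LE; have h : coarse_const * area K * corner_weight K * (X * Y) <= coarse_const * area K * corner_weight K * (28 / Num.sqrt k * Z).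
    apply: ler_wpM2l pure; apply: mulr_ge0; last exact: ltW.
    by apply: mulr_ge0; [exact: CC0|exact: area_ge0].
  by move: h; set i := 28 / _; clear bound pure inv; lra.
have h := local_energy_le q K.
have c28 : 0 <= coarse_const * (28 / Num.sqrt k) by rewrite mulr_ge0// divr_ge0// ltW.
apply: (le_trans (ler_wpM2l c28 h)).
by rewrite le_eqVlt; apply/orP; left; apply/eqP; ring.
Qed.

End CoarseCell.

End LocalBounds.

(** * Error in the layers *)

Section DiscretePoincare.
Context {R : realType}.

(** The Cauchy-Schwarz inequality against the constant 1. *)
Lemma sqr_sum_le (m : nat) (a : 'I_m -> R) (p : pred 'I_m) :
  (\sum_(i | p i) a i) ^+ 2 <= m%:R * \sum_(i | p i) a i ^+ 2.
Proof.
have -> : \sum_(i | p i) a i = \sum_i (if p i then a i else 0) by rewrite big_mkcond.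
have -> : \sum_(i | p i) a i ^+ 2 = \sum_i (if p i then a i else 0) ^+ 2.
  by rewrite big_mkcond; apply: eq_bigr => i _; case: ifP => // _; rewrite expr0n.
set f := fun i => if p i then a i else 0.
rewrite -/f; under eq_bigr do rewrite -/(f _); under [X in _ * X]eq_bigr do rewrite -/(f _).
have -> : (\sum_i f i) ^+ 2 = \sum_i \sum_j f i * f j.
  by rewrite expr2 mulr_suml; apply: eq_bigr => i _; rewrite mulr_sumr.
have -> : m%:R * \sum_i f i ^+ 2 = \sum_(i < m) \sum_(j < m) (f i ^+ 2 / 2 + f j ^+ 2 / 2).
  set s := \sum_i f i ^+ 2.
  have e i : \sum_(j < m) (f i ^+ 2 / 2 + f j ^+ 2 / 2) = m%:R / 2 * f i ^+ 2 + s / 2.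
    by rewrite big_split /= sumr_const card_ord -mulr_suml -/s -mulr_natl; ring.
  under [RHS]eq_bigr do rewrite e.
  by rewrite big_split /= -mulr_sumr -/s sumr_const card_ord -mulr_natl; field.
apply: ler_sum => i _; apply: ler_sum => j _.
by have := sqr_ge0 (f i - f j); nra.
Qed.

Lemma layer_telescope (N h : nat) (f : nat -> R) (a : 'I_N -> R) :
  f N = 0 -> (forall l : 'I_N, (h <= l)%N -> `|f l.+1 - f l| <= a l) ->
  forall i, (h <= i <= N)%N -> f i ^+ 2 <= N%:R * \sum_(l < N | (h <= l)%N) a l ^+ 2.
Proof.
move=> fN fa i /andP[hi iN].
apply: le_trans (sqr_sum_le _ _).
have a0 (l : 'I_N) : (h <= l)%N -> 0 <= a l by move=> hl; apply: le_trans (fa l hl).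
suff le : `|f i| <= \sum_(l < N | (h <= l)%N) a l.
  rewrite -real_normK ?num_real//; apply: lerXn2r le; rewrite nnegrE ?normr_ge0//.
  exact: sumr_ge0.
have e : f i = - \sum_(i <= l < N) (f l.+1 - f l).
  by rewrite telescope_sumr// fN sub0r opprK.
rewrite e normrN; apply: (le_trans (ler_norm_sum _ _ _)).
rewrite big_geq_mkord [leRHS](bigID (fun l : 'I_N => (i <= l)%N)) /=.
apply: (@le_trans _ _ (\sum_(l < N | (h <= l)%N && (i <= l)%N) a l)).
  rewrite [leRHS](eq_bigl (fun l : 'I_N => (i <= l)%N)).
    by apply: ler_sum => l il; apply: fa; exact: leq_trans il.
  by move=> l /=; apply/andP/idP => [[]//|il]; split=> //; exact: leq_trans il.
by rewrite lerDl; apply: sumr_ge0 => l /andP[hl _]; exact: a0.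
Qed.

(** A and T are the area and the weight of the triangles of a strip. The area is
    constant along the strip and the weight varies by a factor at most 2, so the
    unweighted bound on the vertex values can be multiplied by them and summed. *)
Lemma row_poincare (N h : nat) (A T M g : 'I_N -> bool -> R) (D : R) :
  0 <= D -> (forall i a, 0 <= A i a) -> (forall i a, 0 <= T i a) ->
  (forall (i : 'I_N) a (l : 'I_N) a', (h <= i)%N -> (h <= l)%N -> A i a = A l a') ->
  (forall (i : 'I_N) a (l : 'I_N) a', (h <= i)%N -> (h <= l)%N -> T i a <= 2 * T l a') ->
  (forall (i : 'I_N) a, (h <= i)%N -> M i a ^+ 2 <=
     D * \sum_(l < N | (h <= l)%N) (g l false ^+ 2 + g l true ^+ 2)) ->
  \sum_(i < N | (h <= i)%N) (A i false * (T i false * M i false ^+ 2) +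
                             A i true * (T i true * M i true ^+ 2)) <=
  4 * N%:R * D * \sum_(l < N | (h <= l)%N) (A l false * (T l false * g l false ^+ 2) +
                             A l true * (T l true * g l true ^+ 2)).
Proof.
move=> D0 A0 T0 AE TE ME; set S := (X in _ <= _ * X).
have S0 : 0 <= S.
  by apply: sumr_ge0 => l _; apply: addr_ge0; apply: mulr_ge0 => //; apply: mulr_ge0 => //; exact: sqr_ge0.
have cell (i : 'I_N) a : (h <= i)%N -> A i a * (T i a * M i a ^+ 2) <= 2 * D * S.
  move=> hi; have AT : 0 <= A i a * T i a by rewrite mulr_ge0.
  rewrite mulrA; apply: le_trans (ler_wpM2l AT (ME i a hi)) _.
  have -> : 2 * D * S = D * (2 * S) by ring.
  rewrite mulrCA ler_wpM2l// /S !mulr_sumr.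
  apply: ler_sum => l hl.
  have b a' : A i a * T i a * g l a' ^+ 2 <= 2 * (A l a' * (T l a' * g l a' ^+ 2)).
    rewrite (AE i a l a')//.
    have := ler_wpM2l (mulr_ge0 (A0 l a') (sqr_ge0 (g l a'))) (TE i a l a' hi hl); lra.
  by have := b false; have := b true; lra.
apply: (@le_trans _ _ (\sum_(i < N | (h <= i)%N) (2 * D * S + 2 * D * S))).
  by apply: ler_sum => i hi; apply: lerD; exact: cell.
rewrite big_mkcond /=; apply: (@le_trans _ _ (\sum_(i < N) (4 * D * S))).
  apply: ler_sum => i _; case: ifP => _; first lra.
  by rewrite !mulr_ge0.
rewrite sumr_const card_ord -mulr_natr; lra.
Qed.

End DiscretePoincare.

(** The product m s of vertex maximum and gradient is split between m^2 / (eps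
    L^2) and eps s^2 at the price of a factor L, which the smallness 1 / (k L)
    of the interpolation error absorbs. *)
Lemma layer_scalar_bound (R : realType) (x y e a gb g1 g2 m T n eps b c L k : R) :
  let kp := (k * L)^-1 in
  0 < eps -> 0 <= c -> 0 <= b -> 0 <= n -> 0 < k -> 1/2 <= L -> 0 <= T -> 0 <= m ->
  eps * n <= 1 ->
  `|e| <= 260 * (kp * T * m) ->
  `|x| <= 10 * (kp * n * T * m) + 36 * (kp * T * `|g1|) ->
  `|y| <= 10 * (kp * n * T * m) + 36 * (kp * T * `|g2|) ->
  `|a| <= m -> `|gb| <= `|g1| + `|g2| ->
  eps * (x * g1 + y * g2) + c * (e * a) - b * (e * gb) <=
  600 * (1 + b + c) / k * (T * (m ^+ 2 / (eps * L ^+ 2) + (eps * (g1 ^+ 2 + g2 ^+ 2) + m ^+ 2))).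
Proof.
move=> kp eps0 c' b' n0 k0 L2 T0 M0 epsn h0 h1 h2 ha gs.
have e' := ltW eps0; have L0 : 0 < L by lra.
have kp0 : 0 < kp by rewrite invr_gt0 mulr_gt0.
set s := `|g1| + `|g2| in gs.
have s0 : 0 <= s by apply: addr_ge0; exact: normr_ge0.
set Z := (X in _ <= _ * (T * X)).
have f1 : x * g1 <= (10 * (kp * n * T * m) + 36 * (kp * T * `|g1|)) * `|g1|.
  by apply: (le_trans (ler_norm _)); rewrite normrM; apply: ler_wpM2r.
have f2 : y * g2 <= (10 * (kp * n * T * m) + 36 * (kp * T * `|g2|)) * `|g2|.
  by apply: (le_trans (ler_norm _)); rewrite normrM; apply: ler_wpM2r.
have f3 : e * a <= 260 * (kp * T * m) * m.
  by apply: (le_trans (ler_norm _)); rewrite normrM; apply: ler_pM.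
have f4 : - (e * gb) <= 260 * (kp * T * m) * s.
  by apply: (le_trans (ler_norm _)); rewrite normrN normrM; apply: ler_pM.
have kT0 : 0 <= kp * T by apply: mulr_ge0 => //; exact: ltW.
(* eps n <= 1 removes the factor n from the gradient of the error *)
have i1 : eps * (x * g1 + y * g2) <=
    kp * T * (10 * (m * s) + 36 * (eps * (g1 ^+ 2 + g2 ^+ 2))).
  apply: (@le_trans _ _ (kp * T * (10 * (eps * n * (m * s)) + 36 * (eps * (g1 ^+ 2 + g2 ^+ 2))))).
    have := ler_wpM2l e' (lerD f1 f2); rewrite /s.
    rewrite -(real_normK (num_real g1)) -(real_normK (num_real g2)).
    move=> h; apply: (le_trans h); rewrite le_eqVlt; apply/orP; left; apply/eqP; ring.
  apply: ler_wpM2l => //.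
  have ms : 0 <= m * s by exact: mulr_ge0.
  have := ler_wpM2r ms epsn; rewrite mul1r; lra.
have i2 : c * (e * a) <= kp * T * (260 * c * m ^+ 2).
  by have := ler_wpM2l c' f3; lra.
have i3 : - (b * (e * gb)) <= kp * T * (260 * b * (m * s)).
  by have := ler_wpM2l b' f4; lra.
apply: (@le_trans _ _ (kp * T * ((10 + 260 * b) * (m * s) +
   36 * (eps * (g1 ^+ 2 + g2 ^+ 2)) + 260 * c * m ^+ 2))).
  clear h0 h1 h2 ha gs f1 f2 f3 f4; lra.
have -> : (600 * (1 + b + c)) / k * (T * Z) = kp * T * (600 * (1 + b + c) * L * Z).
  by rewrite /kp; field; rewrite !lt0r_neq0.
apply: ler_wpM2l => //.
clear h0 h1 h2 ha gs f1 f2 f3 f4 i1 i2 i3 epsn T0 n0 k0 kT0 kp0; clear kp.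
have sle : s ^+ 2 <= 2 * (g1 ^+ 2 + g2 ^+ 2).
  rewrite -(real_normK (num_real g1)) -(real_normK (num_real g2)) /s.
  have := sqr_ge0 (`|g1| - `|g2|); nra.
set g2' := g1 ^+ 2 + g2 ^+ 2 in sle Z *.
have g20 : 0 <= g2' by apply: addr_ge0; exact: sqr_ge0.
have amgm : m * s <= L * (m ^+ 2 / (eps * L ^+ 2) + eps * g2').
  have sq : 0 <= eps * L * (m / (eps * L) - s / 1) ^+ 2.
    by apply: mulr_ge0; [apply: mulr_ge0; exact: ltW|exact: sqr_ge0].
  have E : eps * L * (m / (eps * L) - s / 1) ^+ 2 =
     L * (m ^+ 2 / (eps * L ^+ 2)) + L * (eps * s ^+ 2) - 2 * (m * s).
    by field; rewrite !lt0r_neq0.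
  rewrite E in sq.
  have Y0 : 0 <= L * (m ^+ 2 / (eps * L ^+ 2)).
    apply: mulr_ge0; first exact: ltW.
    apply: divr_ge0; first exact: sqr_ge0.
    by apply: mulr_ge0 => //; exact: sqr_ge0.
  have := ler_wpM2l (mulr_ge0 (ltW L0) e') sle; lra.
have L12 := L2.
have m20 := sqr_ge0 m.
have e1 : eps * g2' <= 2 * (L * (eps * g2')).
  have := ler_wpM2r (mulr_ge0 e' g20) L12; lra.
have e2 : m ^+ 2 <= 2 * (L * m ^+ 2) by have := ler_wpM2r m20 L12; lra.
have e3 := ler_wpM2l (mulr_ge0 (ler0n R 260) c') e2.
have e4 : 0 <= 10 + 260 * b by lra.
have e5 := ler_wpM2l e4 amgm.
set Y := m ^+ 2 / (eps * L ^+ 2) in e5 *.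
have Y0 : 0 <= L * Y.
  apply: mulr_ge0; first exact: ltW.
  apply: divr_ge0; first exact: sqr_ge0.
  by apply: mulr_ge0 => //; exact: sqr_ge0.
have G0 : 0 <= L * (eps * g2') by apply: mulr_ge0; [exact: ltW|exact: mulr_ge0].
have M20 : 0 <= L * m ^+ 2 by apply: mulr_ge0 => //; exact: ltW.
have -> : 600 * (1 + b + c) * L * Z = 600 * (1 + b + c) * (L * Y) +
   600 * (1 + b + c) * (L * (eps * g2')) + 600 * (1 + b + c) * (L * m ^+ 2).
  by rewrite /Z -/Y; ring.
have l1 : 10 + 260 * b <= 600 * (1 + b + c) by clear -b' c'; lra.
have l2 : 82 + 260 * b <= 600 * (1 + b + c) by clear -b' c'; lra.
have l3 : 520 * c <= 600 * (1 + b + c) by clear -b' c'; lra.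
have m1 := ler_wpM2r Y0 l1; have m2 := ler_wpM2r G0 l2; have m3 := ler_wpM2r M20 l3.
by clear -m1 m2 m3 e1 e2 e3 e5; lra.
Qed.

Section LayerBounds.
Context {R : realType}.
Variables (P : data R) (N : nat) (eps : R) (modified : bool).
Hypotheses (N0 : (0 < N)%N) (evN : ~~ odd N) (eps0 : 0 < eps).
Local Notation lx := (lambda_x P N eps).
Local Notation ly := (lambda_y P N eps).
Hypotheses (lx0 : 0 < lx) (lx2 : lx <= 1/2) (ly0 : 0 < ly) (ly2 : ly <= 1/2).
Hypotheses (b0 : 0 < bnorm P) (c0 : 0 < c P) (Cs0 : 0 < Cstar P).
Local Notation xs := (mesh_point N lx).
Local Notation ys := (mesh_point N ly).
Local Notation b := (bnorm P).
Local Notation be := (beta_dir P).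
Local Notation et := (eta_dir P).
Local Notation oK := (@open_tri R N xs ys).
Local Notation n := (N%:R : R).
Variables (xst : R * R) (sb se : R).
Hypotheses (sb0 : 0 < sb) (se0 : 0 < se).
Hypotheses (sbn : 16 <= n * sb) (sen : 16 <= n * se).
Local Notation TH := (Theta be et xst sb se).
Implicit Types (q qi : tri_index N -> R * R * R) (K : tri_index N).
Local Notation ck K := (corner xs ys K).
Local Notation uk K := (signed_width xs K).
Local Notation wk K := (signed_height ys K).
Local Notation AK K := (area P eps K).
Local Notation TT K := (corner_weight P eps xst sb se K).
Local Notation MM q K := (vertex_max P eps q K).
Local Notation JW q K := (integral2 (oK K) (weighted_density P eps modified xst sb se q K)).

Let n0 : 0 < n. Proof. by rewrite ltr0n. Qed.
Let u0 K : uk K != 0. Proof. exact: mesh_width_neq0. Qed.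
Let w0 K : wk K != 0. Proof. exact: mesh_height_neq0. Qed.
Let ub : be.1 ^+ 2 + be.2 ^+ 2 = 1. Proof. exact: unit_be. Qed.

Variable L : R.
Hypothesis L2 : 1/2 <= L.

Lemma local_energy_gradient q K :
  TT K * (eps * ((q K).1.2 ^+ 2 + (q K).2 ^+ 2) + MM q K ^+ 2) <=
  local_energy P eps modified xst sb se q K.
Proof.
rewrite -(sqr_gradient ub (etE P) (q K)) /local_energy.
have T0 := corner_weight_gt0 P eps xst sb se K; have S0 := corner_dweight_gt0 P eps xst se sb0 K.
have e := tri_epshat_ge eps modified K.
have g0 := sqr_ge0 (gbeta be (q K)); have g1 := sqr_ge0 (geta et (q K)).
have d0 : 0 <= tri_delta P K / Cstar P by apply: divr_ge0; [exact: tri_delta_ge0|exact: ltW].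
have h1 := ler_wpM2r g1 e; have h2 := mulr_ge0 d0 g0.
have h3 : 0 <= corner_dweight P eps xst sb se K * MM q K ^+ 2.
  by apply: mulr_ge0; [exact: ltW|exact: sqr_ge0].
apply: (@le_trans _ _ (TT K * (eps * gbeta be (q K) ^+ 2 +
    tri_epshat eps modified K * geta et (q K) ^+ 2 + MM q K ^+ 2 +
    tri_delta P K / Cstar P * gbeta be (q K) ^+ 2))); last by rewrite lerDl.
by apply: ler_wpM2l; [exact: ltW|lra].
Qed.

Section Cell.
Variables (q qi : tri_index N -> R * R * R).
Hypothesis Hv : forall K, [/\ aff (qi K) (ck K) = TH (ck K) * aff (q K) (ck K),
  aff (qi K) (vtx1 (ck K) (uk K)) = TH (vtx1 (ck K) (uk K)) * aff (q K) (vtx1 (ck K) (uk K)) &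
  aff (qi K) (vtx2 (ck K) (wk K)) = TH (vtx2 (ck K) (wk K)) * aff (q K) (vtx2 (ck K) (wk K))].
Variable k : R.
Hypotheses (k32 : 32 <= k) (kb : k * L <= n * sb) (ke : k * L <= n * se).
Hypothesis (epsn : eps * n <= 1).

Definition layer_const : R := 600 * (1 + b + c P).

(** In contrast to the coarse region a term appears that the local energy does
    not control; the discrete Poincare inequality takes care of it. *)
Lemma energy_err_layer K : ~~ coarse K ->
  integral2 (oK K) (energy_err P eps modified xst sb se q qi K) <=
  layer_const / k * (AK K * (TT K * (MM q K ^+ 2 / (eps * L ^+ 2))) + 1024 * energy_const P * JW q K).
Proof.
move=> ncK.
have mT := measurable_open_tri xs ys K.
have sT := open_tri_sub N0 evN lx0 lx2 ly0 ly2 (K := K).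
have b' := ltW b0; have c' := ltW c0; have e' := ltW eps0.
have k0 : 0 < k by have := k32; lra.
have L0 : 0 < L by have := L2; lra.
have M0 := vertex_max_ge0 P eps q K; have T0 := corner_weight_gt0 P eps xst sb se K.
have ehE : tri_epshat eps modified K = eps by rewrite /tri_epshat (negbTE ncK).
have dE : tri_delta P K = 0 by rewrite /tri_delta (negbTE ncK).
set kp := (k * L)^-1.
have kL0 : 0 < k * L by rewrite mulr_gt0.
have kp0 : 0 < kp by rewrite invr_gt0.
have kp16 : kp <= 1 / 16.
  have h16 : 16 <= k * L by have := L2; have := k32; nra.
  rewrite /kp -div1r ler_pdivrMr//; lra.
have kpb : 1 <= kp * (n * sb) by rewrite mulrC ler_pdivlMr// mul1r.
have kpe : 1 <= kp * (n * se) by rewrite mulrC ler_pdivlMr// mul1r.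
set m := MM q K; set T := TT K; set s := `|(q K).1.2| + `|(q K).2|.
have s0 : 0 <= s by apply: addr_ge0; exact: normr_ge0.
set Z := m ^+ 2 / (eps * L ^+ 2) + (eps * ((q K).1.2 ^+ 2 + (q K).2 ^+ 2) + m ^+ 2).
have bound p : oK K p -> energy_err P eps modified xst sb se q qi K p <= layer_const / k * (T * Z).
  move=> Tp; have Tp' := otri_ctri Tp.
  have [v0 v1 v2] := Hv K.
  have [r0 r1 r2] := interp_err_layer sb0 se0 ub (etE P) (u0 K) (w0 K) n0
     (mesh_width_le N0 evN lx0 lx2 K) (mesh_height_le N0 evN ly0 ly2 K) sbn sen kpb kpe kp16 Tp' v0 v1 v2.
  rewrite -err_value_interp_err -/(TT K) -/T -/m in r0.
  rewrite -/(TT K) -/T -/m in r1 r2.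
  have Ga : `|aff (q K) p| <= m by exact: aff_le_vmax.
  have ortho : err_beta P xst sb se q qi K p * gbeta be (q K) + err_eta P xst sb se q qi K p * geta et (q K) =
    interp_err_x be et xst sb se (q K) p (qi K) * (q K).1.2 + interp_err_y be et xst sb se (q K) p (qi K) * (q K).2.
    rewrite (err_betaE b0 xst sb0 se0) (err_etaE b0 xst) /gbeta /geta (etE P).
    move: (interp_err_x _ _ _ _ _ _ _ _) (interp_err_y _ _ _ _ _ _ _ _) => x y.
    transitivity ((be.1 ^+ 2 + be.2 ^+ 2) * (x * (q K).1.2 + y * (q K).2)).
      by move: (be) => B /=; ring.
    by rewrite ub mul1r.
  have -> : energy_err P eps modified xst sb se q qi K p =
     eps * (interp_err_x be et xst sb se (q K) p (qi K) * (q K).1.2 + interp_err_y be et xst sb se (q K) p (qi K) * (q K).2)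
     + c P * (err_value P xst sb se q qi K p * aff (q K) p) - b * (err_value P xst sb se q qi K p * gbeta be (q K)).
    by rewrite -ortho /energy_err ehE dE; ring.
  move: r0 r1 r2 Ga; move: (interp_err_x _ _ _ _ _ _ _ _) (interp_err_y _ _ _ _ _ _ _ _) (err_value _ _ _ _ _ _ _ _) => x y e.
  move: (aff (q K) p) => a h0 h1 h2 ha.
  have gs : `|gbeta be (q K)| <= s.
    have [b1' b2'] := be_le1 ub; rewrite /gbeta; apply: (le_trans (ler_normD _ _)).
    by rewrite (normrM be.1) (normrM be.2); apply: lerD; apply: ler_piMl => //; exact: normr_ge0.
  clear ortho Hv v0 v1 v2.
  rewrite /layer_const; exact: (layer_scalar_bound (n := n) eps0 c' b' (ltW n0) k0 L2 (ltW T0) M0 epsn h0 h1 h2 ha gs).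
have nE := bmeasurable_energy_err P eps modified xst sb se q qi K.
have CL0 : 0 <= layer_const / k by apply: divr_ge0; [rewrite /layer_const; lra|exact: ltW].
have m20 := sqr_ge0 m.
have Y0 : 0 <= m ^+ 2 / (eps * L ^+ 2).
  by apply: divr_ge0 => //; apply: mulr_ge0 => //; exact: sqr_ge0.
have g20 : 0 <= eps * ((q K).1.2 ^+ 2 + (q K).2 ^+ 2).
  by apply: mulr_ge0 => //; apply: addr_ge0; exact: sqr_ge0.
have B0 : 0 <= layer_const / k * (T * Z).
  by apply: mulr_ge0 => //; apply: mulr_ge0; [exact: ltW|rewrite /Z; lra].
apply: (@le_trans _ _ (integral2 (oK K) (fun=> layer_const / k * (T * Z)))).
  by apply: integral2_le => //; bmeasurable_tac.
apply: (le_trans (integral2_cst_le (u0 K) (w0 K) sT B0)); rewrite -/(AK K).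
have A0 := area_ge0 P eps K.
have h := ler_wpM2l A0 (local_energy_gradient q K); rewrite -/T -/m in h.
have h2 : AK K * (T * (eps * ((q K).1.2 ^+ 2 + (q K).2 ^+ 2) + m ^+ 2)) <= 1024 * energy_const P * JW q K.
  by apply: (le_trans h); exact: local_energy_le.
rewrite -mulrA; apply: ler_wpM2l => //; rewrite mulrC.
have -> : AK K * (T * Z) = AK K * (T * (m ^+ 2 / (eps * L ^+ 2))) +
   AK K * (T * (eps * ((q K).1.2 ^+ 2 + (q K).2 ^+ 2) + m ^+ 2)) by rewrite /Z; ring.
by apply: lerD.
Qed.

End Cell.
End LayerBounds.

(** * Poincare inequality in the layers and nodal bounds *)

Section StripPoincare.
Context {R : realType}.

(** F l s is the nodal value at position l on the side s of the strip, M is the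
    vertex maximum, and g is the slope of the edge of length hh on the side s. *)
Lemma strip_poincare (N h : nat) (A T M g : 'I_N -> bool -> R) (F : nat -> bool -> R) (hh : R) :
  0 <= hh -> (forall i a, 0 <= A i a) -> (forall i a, 0 <= T i a) ->
  (forall (i : 'I_N) a (l : 'I_N) a', (h <= i)%N -> (h <= l)%N -> A i a = A l a') ->
  (forall (i : 'I_N) a (l : 'I_N) a', (h <= i)%N -> (h <= l)%N -> T i a <= 2 * T l a') ->
  (forall s, F N s = 0) ->
  (forall s (l : 'I_N), (h <= l)%N -> `|F l.+1 s - F l s| <= hh * `|g l s|) ->
  (forall (i : 'I_N) a, exists i' s, (i <= i' <= i.+1)%N /\ M i a = `|F i' s|) ->
  \sum_(i < N | (h <= i)%N) (A i false * (T i false * M i false ^+ 2) +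
                             A i true * (T i true * M i true ^+ 2)) <=
  4 * (N%:R * hh) ^+ 2 * \sum_(l < N | (h <= l)%N) (A l false * (T l false * g l false ^+ 2) +
                             A l true * (T l true * g l true ^+ 2)).
Proof.
move=> hh0 A0 T0 AE TE FN dF MF.
have -> : 4 * (N%:R * hh) ^+ 2 = 4 * N%:R * (N%:R * hh ^+ 2) by ring.
apply: row_poincare => //; first by apply: mulr_ge0 => //; exact: sqr_ge0.
move=> i a hi; have [i' [s [/andP[ii' i'i] ->]]] := MF i a.
rewrite real_normK ?num_real//.
have hi' : (h <= i' <= N)%N by rewrite (leq_trans hi ii') (leq_trans i'i).
apply: le_trans (layer_telescope (f := F ^~ s) (FN s) (dF s) hi') _.
rewrite -mulrA; apply: ler_wpM2l => //.
rewrite mulr_sumr; apply: ler_sum => l hl.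
rewrite exprMn real_normK ?num_real//; apply: ler_wpM2l; first exact: sqr_ge0.
by case: s; rewrite ?lerDl ?lerDr sqr_ge0.
Qed.

End StripPoincare.

Section LayerSums.
Context {R : realType}.
Variables (P : data R) (N : nat) (eps : R) (modified : bool).
Hypotheses (N0 : (0 < N)%N) (evN : ~~ odd N) (eps0 : 0 < eps).
Local Notation lx := (lambda_x P N eps).
Local Notation ly := (lambda_y P N eps).
Hypotheses (lx0 : 0 < lx) (lx2 : lx <= 1/2) (ly0 : 0 < ly) (ly2 : ly <= 1/2).
Hypotheses (b0 : 0 < bnorm P) (c0 : 0 < c P) (Cs0 : 0 < Cstar P).
Local Notation xs := (mesh_point N lx).
Local Notation ys := (mesh_point N ly).
Local Notation b := (bnorm P).
Local Notation be := (beta_dir P).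
Local Notation et := (eta_dir P).
Local Notation oK := (@open_tri R N xs ys).
Local Notation cK := (@closed_tri R N xs ys).
Local Notation n := (N%:R : R).
Variables (xst : R * R) (sb se : R).
Hypotheses (sb0 : 0 < sb) (se0 : 0 < se).
Hypotheses (sbn : 16 <= n * sb) (sen : 16 <= n * se).
Local Notation TH := (Theta be et xst sb se).
Implicit Types (K : tri_index N).
Local Notation ck K := (corner xs ys K).
Local Notation uk K := (signed_width xs K).
Local Notation wk K := (signed_height ys K).
Local Notation AK K := (area P eps K).
Local Notation TT K := (corner_weight P eps xst sb se K).
Local Notation MM q K := (vertex_max P eps q K).
Local Notation JW q K := (integral2 (oK K) (weighted_density P eps modified xst sb se q K)).

Let n0 : 0 < n. Proof. by rewrite ltr0n. Qed.
Let ub : be.1 ^+ 2 + be.2 ^+ 2 = 1. Proof. exact: unit_be. Qed.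

Variable L : R.
Hypothesis L2 : 1/2 <= L.
Variables (k CLam : R).
Hypotheses (CLam0 : 0 <= CLam) (k4 : 4 * (CLam + 4) <= k).
Hypotheses (kb : k * L <= n * sb) (ke : k * L <= n * se).
Hypothesis (epsn : eps * n <= 1).
Hypotheses (lxL : lx <= CLam * (eps * L)) (lyL : ly <= CLam * (eps * L)).

Lemma layer_width_small : lx + 2 / n <= (CLam + 4) * L / n /\ ly + 2 / n <= (CLam + 4) * L / n.
Proof.
have H l : l <= CLam * (eps * L) -> l + 2 / n <= (CLam + 4) * L / n.
  move=> lL; rewrite ler_pdivlMr// mulrDl divfK ?lt0r_neq0//.
  have h1 := ler_wpM2r (ltW n0) lL.
  have CL0 : 0 <= CLam * L by apply: mulr_ge0 => //; have := L2; lra.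
  have h2 := ler_wpM2l CL0 epsn.
  by have := L2; lra.
by split; exact: H.
Qed.

(** The width of a layer is O(eps ln N) = O(ln N / N), hence small compared with
    sigma_beta and sigma_eta. *)
Lemma Theta_harnack_layer p p' : `|p'.1 - p.1| + `|p'.2 - p.2| <= (CLam + 4) * L / n ->
  TH p' <= 2 * TH p.
Proof.
move=> h; set d := (p'.1 - p.1, p'.2 - p.2).
have -> : p' = p + d by case: (p) (p') @d => [x y] [x' y'] /=; congr pair => /=; ring.
have CL0 : 0 < (CLam + 4) * L by apply: mulr_gt0; have := CLam0; have := L2; lra.
have aux (z s : R) : 0 < s -> k * L <= n * s -> `|z| <= (CLam + 4) * L / n -> `|z / s| <= 1/4.
  move=> s0 ks zl; rewrite normrM (gtr0_norm (_ : 0 < s^-1)) ?invr_gt0// ler_pdivrMr//.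
  apply: (le_trans zl); rewrite ler_pdivrMr//.
  have L0 : 0 <= L by have := L2; lra.
  by have := ler_wpM2r L0 k4; lra.
apply: Theta_harnack => //.
have h1 : `|dot d be / sb| <= 1/4 by apply: aux => //; exact: le_trans (dot_be_le ub d) h.
have h2 : `|dot d et / se| <= 1/4 by apply: aux => //; exact: le_trans (dot_et_le ub (etE P) d) h.
lra.
Qed.

Lemma mesh_layer (l : R) i : 0 < l -> l <= 1/2 -> (N./2 <= i <= N)%N ->
  1 - l <= mesh_point N l i <= 1.
Proof.
move=> l0 l2 /andP[hi iN].
rewrite -{1}(mesh_half _ N0 evN) (mesh_mono N0 evN l0 l2 hi) /=.
by rewrite -(mesh_N l N0 evN); exact: mesh_mono.
Qed.

Lemma mesh_near (l : R) j (a a' : bool) : 0 < l -> l <= 1/2 ->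
  `|mesh_point N l (j + a) - mesh_point N l (j + a')| <= 2 / n.
Proof.
move=> l0 l2; have s := mesh_step l N0 evN j.
have h : 0 <= mesh_point N l j.+1 - mesh_point N l j <= 2 / n.
  rewrite subr_ge0 ltW ?mesh_lt//= s; have h := coarse_h_le N0 l0.
  case: ifP => // _; exact: le_trans (fine_h_le N0 l2) h.
have n2 : 0 <= 2 / n by apply: divr_ge0 => //; exact: ltW.
have /andP[h1 h2] := h.
by case: a; case: a'; rewrite ?addn0 ?addn1 ?subrr ?normr0//; [rewrite ger0_norm|rewrite distrC ger0_norm].
Qed.

Lemma corner_weight_xlayer (i i' j : 'I_N) a a' : (N./2 <= i)%N -> (N./2 <= i')%N ->
  TT (i, j, a) <= 2 * TT (i', j, a').
Proof.
move=> hi hi'; apply: Theta_harnack_layer; rewrite /corner /=.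
apply: le_trans layer_width_small.1; apply: lerD; last exact: mesh_near.
have hN (l : 'I_N) (e : bool) : (l + e <= N)%N by case: e; rewrite ?addn1 ?addn0 // ltnW.
have /andP[h1 h2] : 1 - lx <= xs (i + a) <= 1.
  by apply: mesh_layer => //; rewrite hN (leq_trans hi)// leq_addr.
have /andP[h3 h4] : 1 - lx <= xs (i' + a') <= 1.
  by apply: mesh_layer => //; rewrite hN (leq_trans hi')// leq_addr.
by rewrite ler_norml; apply/andP; split; lra.
Qed.

Lemma corner_weight_ylayer (i j j' : 'I_N) a a' : (N./2 <= j)%N -> (N./2 <= j')%N ->
  TT (i, j, a) <= 2 * TT (i, j', a').
Proof.
move=> hj hj'; apply: Theta_harnack_layer; rewrite /corner /=.
rewrite addrC; apply: le_trans layer_width_small.2; apply: lerD; last exact: mesh_near.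
have hN (l : 'I_N) (e : bool) : (l + e <= N)%N by case: e; rewrite ?addn1 ?addn0 // ltnW.
have /andP[h1 h2] : 1 - ly <= ys (j + a) <= 1.
  by apply: mesh_layer => //; rewrite hN (leq_trans hj)// leq_addr.
have /andP[h3 h4] : 1 - ly <= ys (j' + a') <= 1.
  by apply: mesh_layer => //; rewrite hN (leq_trans hj')// leq_addr.
by rewrite ler_norml; apply/andP; split; lra.
Qed.

Lemma areaE K : AK K = (if (K.1.1 < N./2)%N then coarse_h N lx else fine_h N lx) *
  (if (K.1.2 < N./2)%N then coarse_h N ly else fine_h N ly).
Proof.
have e1 := mesh_widthE N0 evN lx0 lx2 K; have e2 := mesh_heightE N0 evN ly0 ly2 K.
by rewrite /area (normrM (uk K)) e1 e2.
Qed.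

Lemma area_xlayer (i i' j : 'I_N) a a' : (N./2 <= i)%N -> (N./2 <= i')%N ->
  AK (i, j, a) = AK (i', j, a').
Proof.
move=> h h'; rewrite (areaE (i, j, a)) (areaE (i', j, a')) /=.
by rewrite !ltnNge h h'.
Qed.

Lemma area_ylayer (i j j' : 'I_N) a a' : (N./2 <= j)%N -> (N./2 <= j')%N ->
  AK (i, j, a) = AK (i, j', a').
Proof.
move=> h h'; rewrite (areaE (i, j, a)) (areaE (i, j', a')) /=.
by rewrite !ltnNge h h'.
Qed.

Variables (G : R * R -> R) (q : tri_index N -> R * R * R).
Hypotheses (Gq : pieces P eps G q) (GO : forall p, (Omegabar `\` Omega) p -> G p = 0).

Local Notation Gn i j := (G (xs i, ys j)).

Lemma vtx1_node K : vtx1 (ck K) (uk K) = (xs (K.1.1 + ~~ K.2)%N, ys (K.1.2 + K.2)%N).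
Proof. by rewrite /vtx1 /corner /signed_width /signed_step /= addrC subrK. Qed.

Lemma vtx2_node K : vtx2 (ck K) (wk K) = (xs (K.1.1 + K.2)%N, ys (K.1.2 + ~~ K.2)%N).
Proof. by rewrite /vtx2 /corner /signed_height /signed_step /= addrC subrK. Qed.

Lemma vertex_values K : [/\ aff (q K) (ck K) = Gn (K.1.1 + K.2)%N (K.1.2 + K.2)%N,
  aff (q K) (vtx1 (ck K) (uk K)) = Gn (K.1.1 + ~~ K.2)%N (K.1.2 + K.2)%N &
  aff (q K) (vtx2 (ck K) (wk K)) = Gn (K.1.1 + K.2)%N (K.1.2 + ~~ K.2)%N].
Proof.
have [h0 h1 h2] := vertices_closed_tri N0 evN lx0 lx2 ly0 ly2 K.
by split; rewrite -Gq// ?vtx1_node// vtx2_node.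
Qed.

Lemma vertex_max_node K : exists a a' : bool, MM q K = `|Gn (K.1.1 + a)%N (K.1.2 + a')%N|.
Proof.
have [v0 v1 v2] := vertex_values K; rewrite /vertex_max.
case: (vmax_attained (ck K) (uk K) (wk K) (aff (q K))) => ->; rewrite ?v0 ?v1 ?v2.
- by exists K.2, K.2.
- by exists (~~ K.2), K.2.
- by exists K.2, (~~ K.2).
Qed.

Lemma edge_x K : `|Gn K.1.1.+1 (K.1.2 + K.2)%N - Gn K.1.1 (K.1.2 + K.2)%N| = `|uk K| * `|(q K).1.2|.
Proof.
have [v0 v1 _] := vertex_values K.
rewrite -normrM; have <- : aff (q K) (vtx1 (ck K) (uk K)) - aff (q K) (ck K) = uk K * (q K).1.2.
  by rewrite /aff /vtx1 /=; ring.
by rewrite v0 v1; case: (K.2); rewrite ?addn0 ?addn1 // distrC.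
Qed.
 
Lemma edge_y K : `|Gn (K.1.1 + K.2)%N K.1.2.+1 - Gn (K.1.1 + K.2)%N K.1.2| = `|wk K| * `|(q K).2|.
Proof.
have [v0 _ v2] := vertex_values K.
rewrite -normrM; have <- : aff (q K) (vtx2 (ck K) (wk K)) - aff (q K) (ck K) = wk K * (q K).2.
  by rewrite /aff /vtx2 /=; ring.
by rewrite v0 v2; case: (K.2); rewrite ?addn0 ?addn1 // distrC.
Qed.

Lemma mesh_itv (l : R) i : 0 < l -> l <= 1/2 -> (i <= N)%N -> 0 <= mesh_point N l i <= 1.
Proof.
move=> l0 l2 iN; rewrite -{1}(mesh_0 N l) -(mesh_N l N0 evN).
by apply/andP; split; exact: mesh_mono.
Qed.

Lemma G_right j : (j <= N)%N -> Gn N j = 0.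
Proof.
move=> jN; apply: GO; rewrite mesh_N//; split.
  by split; rewrite /= in_itv /= ?lexx ?ler01//; exact: mesh_itv.
by case=> /=; rewrite in_itv /= ltxx andbF.
Qed.

Lemma G_top i : (i <= N)%N -> Gn i N = 0.
Proof.
move=> iN; apply: GO; rewrite mesh_N//; split.
  by split; rewrite /= in_itv /= ?lexx ?ler01//; exact: mesh_itv.
by case=> _ /=; rewrite in_itv /= ltxx andbF.
Qed.

Let ordb (j : 'I_N) (s : bool) : (j + s <= N)%N.
Proof. by case: s; rewrite ?addn1 ?addn0 // ltnW. Qed.

Lemma xlayer_row (j : 'I_N) :
  \sum_(i < N | (N./2 <= i)%N) (AK (i, j, false) * (TT (i, j, false) * MM q (i, j, false) ^+ 2) +
     AK (i, j, true) * (TT (i, j, true) * MM q (i, j, true) ^+ 2)) <=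
  4 * (n * fine_h N lx) ^+ 2 * \sum_(i < N | (N./2 <= i)%N)
    (AK (i, j, false) * (TT (i, j, false) * (q (i, j, false)).1.2 ^+ 2) +
     AK (i, j, true) * (TT (i, j, true) * (q (i, j, true)).1.2 ^+ 2)).
Proof.
apply: (@strip_poincare _ N N./2 (fun i a => AK (i, j, a)) (fun i a => TT (i, j, a))
  (fun i a => MM q (i, j, a)) (fun i a => (q (i, j, a)).1.2) (fun i s => Gn i (j + s)%N)).
- by apply: ltW; exact: fine_h_gt0.
- by move=> i a; exact: area_ge0.
- by move=> i a; apply: ltW; exact: corner_weight_gt0.
- by move=> *; exact: area_xlayer.
- by move=> *; exact: corner_weight_xlayer.
- by move=> s; exact: G_right.
- move=> s l hl; have := edge_x (l, j, s).
  by rewrite (mesh_widthE N0 evN lx0 lx2) /= ltnNge hl /= => ->.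
- move=> i a; have [e [e' h]] := vertex_max_node (i, j, a).
  exists (i + e)%N, e'; split => //.
  by rewrite leq_addr -addn1 leq_add2l leq_b1.
Qed.

Lemma ylayer_column (i : 'I_N) :
  \sum_(j < N | (N./2 <= j)%N) (AK (i, j, false) * (TT (i, j, false) * MM q (i, j, false) ^+ 2) +
     AK (i, j, true) * (TT (i, j, true) * MM q (i, j, true) ^+ 2)) <=
  4 * (n * fine_h N ly) ^+ 2 * \sum_(j < N | (N./2 <= j)%N)
    (AK (i, j, false) * (TT (i, j, false) * (q (i, j, false)).2 ^+ 2) +
     AK (i, j, true) * (TT (i, j, true) * (q (i, j, true)).2 ^+ 2)).
Proof.
apply: (@strip_poincare _ N N./2 (fun j a => AK (i, j, a)) (fun j a => TT (i, j, a))
  (fun j a => MM q (i, j, a)) (fun j a => (q (i, j, a)).2) (fun j s => Gn (i + s)%N j)).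
- by apply: ltW; exact: fine_h_gt0.
- by move=> j a; exact: area_ge0.
- by move=> j a; apply: ltW; exact: corner_weight_gt0.
- by move=> *; exact: area_ylayer.
- by move=> *; exact: corner_weight_ylayer.
- by move=> s; exact: G_top.
- move=> s l hl; have := edge_y (i, l, s).
  by rewrite (mesh_heightE N0 evN ly0 ly2) /= ltnNge hl /= => ->.
- move=> j a; have [e [e' h]] := vertex_max_node (i, j, a).
  exists (j + e')%N, e; split => //.
  by rewrite leq_addr -addn1 leq_add2l leq_b1.
Qed.

Lemma gradient_le K : AK K * (TT K * (eps * (q K).1.2 ^+ 2)) <= 1024 * energy_const P * JW q K /\
  AK K * (TT K * (eps * (q K).2 ^+ 2)) <= 1024 * energy_const P * JW q K.
Proof.
have h : AK K * (TT K * (eps * ((q K).1.2 ^+ 2 + (q K).2 ^+ 2) + MM q K ^+ 2)) <= 1024 * energy_const P * JW q K.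
  apply: (@le_trans _ _ (AK K * local_energy P eps modified xst sb se q K)); last exact: local_energy_le.
  by apply: ler_wpM2l; [exact: area_ge0|exact: local_energy_gradient].
have A0 := area_ge0 P eps K; have T0 := ltW (corner_weight_gt0 P eps xst sb se K).
have g1 := mulr_ge0 (ltW eps0) (sqr_ge0 (q K).1.2).
have g2 := mulr_ge0 (ltW eps0) (sqr_ge0 (q K).2).
have m := sqr_ge0 (MM q K).
by split; apply: le_trans h; apply: ler_wpM2l => //; apply: ler_wpM2l => //; lra.
Qed.

Lemma weighted_integral_ge0 K : 0 <= JW q K.
Proof. by apply: integral2_ge0 => p _; exact: weighted_density_ge0. Qed.

Let L0 : 0 < L. Proof. by have := L2; lra. Qed.

(** The strip has width lam <= CLam eps L, so the factor lam^2 / (eps L^2)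
    produced by the Poincare inequality is at most CLam^2 eps. *)
Lemma strip_scaled (lam hh : R) (A T M g e : 'I_N -> bool -> R) :
  0 < lam -> lam <= CLam * (eps * L) -> n * hh = 2 * lam ->
  (forall i a, 0 <= A i a * (T i a * g i a ^+ 2)) ->
  (forall i a, A i a * (T i a * (eps * g i a ^+ 2)) <= e i a) ->
  \sum_(i < N | (N./2 <= i)%N) (A i false * (T i false * M i false ^+ 2) +
                             A i true * (T i true * M i true ^+ 2)) <=
  4 * (n * hh) ^+ 2 * \sum_(i < N | (N./2 <= i)%N) (A i false * (T i false * g i false ^+ 2) +
                             A i true * (T i true * g i true ^+ 2)) ->
  \sum_(i < N | (N./2 <= i)%N) (A i false * (T i false * (M i false ^+ 2 / (eps * L ^+ 2))) +
                             A i true * (T i true * (M i true ^+ 2 / (eps * L ^+ 2)))) <=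
  16 * CLam ^+ 2 * \sum_(i < N | (N./2 <= i)%N) (e i false + e i true).
Proof.
move=> lam0 lamL hhE ATg ATe.
set S1 := \sum_(i < N | _) _; set S2 := \sum_(i < N | _) _; set S3 := (X in _ -> X <= _).
set S4 := \sum_(i < N | _) _ => H.
have eL0 : 0 < eps * L ^+ 2 by rewrite mulr_gt0// exprn_gt0.
have -> : S3 = S1 / (eps * L ^+ 2).
  by rewrite /S1 mulr_suml; apply: eq_bigr => i _; ring.
rewrite ler_pdivrMr//; apply: (le_trans H).
rewrite hhE.
have S20 : 0 <= S2 by apply: sumr_ge0 => i _; apply: addr_ge0.
have S24 : eps * S2 <= S4.
  rewrite mulr_sumr; apply: ler_sum => i _.
  by have := ATe i false; have := ATe i true; lra.
have h1 : lam ^+ 2 <= (CLam * (eps * L)) ^+ 2.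
  by rewrite ler_sqr ?nnegrE ?(ltW lam0)//; apply: le_trans lamL; exact: ltW.
have h2 := ler_wpM2r S20 h1.
have h3 : 0 <= CLam ^+ 2 * (eps * L ^+ 2) by apply: mulr_ge0; [exact: sqr_ge0|exact: ltW].
have h4 := ler_wpM2l h3 S24.
lra.
Qed.

Local Notation PK K := (AK K * (TT K * (MM q K ^+ 2 / (eps * L ^+ 2)))).

Lemma fine_hE l : n * fine_h N l = 2 * l.
Proof. by rewrite /fine_h mulrC divfK// lt0r_neq0. Qed.

Lemma xlayer_poincare : \sum_(K : tri_index N | (N./2 <= K.1.1)%N) PK K <=
  16 * CLam ^+ 2 * (1024 * energy_const P * \sum_K JW q K).
Proof.
have CW0 := energy_const_ge0 b0 c0 Cs0.
rewrite big_mkcond !sum_tri exchange_big /= [X in _ <= _ * (_ * X)]exchange_big /= !mulr_sumr.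
apply: ler_sum => j _.
have H := @strip_scaled lx (fine_h N lx) (fun i a => AK (i, j, a)) (fun i a => TT (i, j, a))
  (fun i a => MM q (i, j, a)) (fun i a => (q (i, j, a)).1.2)
  (fun i a => 1024 * energy_const P * JW q (i, j, a)) lx0 lxL (fine_hE lx).
have {}H := H _ _ (xlayer_row j).
apply: le_trans (_ : _ <= 16 * CLam ^+ 2 * (\sum_(i < N | (N./2 <= i)%N)
   (1024 * energy_const P * JW q (i, j, false) + 1024 * energy_const P * JW q (i, j, true)))) _.
  rewrite [leLHS](_ : _ = \sum_(i < N | (N./2 <= i)%N) (PK (i, j, false) + PK (i, j, true))).
    apply: H => i a.
      by apply: mulr_ge0; [exact: area_ge0|apply: mulr_ge0; [exact/ltW/corner_weight_gt0|exact: sqr_ge0]].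
    exact: (gradient_le (i, j, a)).1.
  by rewrite [RHS]big_mkcond; apply: eq_bigr => i _ /=; case: (N./2 <= i)%N; rewrite /= ?addr0.
apply: ler_wpM2l; first by apply: mulr_ge0 => //; exact: sqr_ge0.
rewrite mulr_sumr big_mkcond; apply: ler_sum => i _.
have CW1 : 0 <= 1024 * energy_const P by apply: mulr_ge0 CW0; exact: ler0n.
case: ifP => _; first by rewrite -mulrDr lexx.
by apply: mulr_ge0 => //; apply: addr_ge0; exact: weighted_integral_ge0.
Qed.

Lemma ylayer_poincare : \sum_(K : tri_index N | (N./2 <= K.1.2)%N) PK K <=
  16 * CLam ^+ 2 * (1024 * energy_const P * \sum_K JW q K).
Proof.
have CW0 := energy_const_ge0 b0 c0 Cs0.
rewrite big_mkcond sum_tri /= sum_tri /= !mulr_sumr.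
apply: ler_sum => i _.
have H := @strip_scaled ly (fine_h N ly) (fun j a => AK (i, j, a)) (fun j a => TT (i, j, a))
  (fun j a => MM q (i, j, a)) (fun j a => (q (i, j, a)).2)
  (fun j a => 1024 * energy_const P * JW q (i, j, a)) ly0 lyL (fine_hE ly).
have {}H := H _ _ (ylayer_column i).
apply: le_trans (_ : _ <= 16 * CLam ^+ 2 * (\sum_(j < N | (N./2 <= j)%N)
   (1024 * energy_const P * JW q (i, j, false) + 1024 * energy_const P * JW q (i, j, true)))) _.
  rewrite [leLHS](_ : _ = \sum_(j < N | (N./2 <= j)%N) (PK (i, j, false) + PK (i, j, true))).
    apply: H => j a.
      by apply: mulr_ge0; [exact: area_ge0|apply: mulr_ge0; [exact/ltW/corner_weight_gt0|exact: sqr_ge0]].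
    exact: (gradient_le (i, j, a)).2.
  by rewrite [RHS]big_mkcond; apply: eq_bigr => j _ /=; case: (N./2 <= j)%N; rewrite /= ?addr0.
apply: ler_wpM2l; first by apply: mulr_ge0 => //; exact: sqr_ge0.
rewrite mulr_sumr big_mkcond; apply: ler_sum => j _.
have CW1 : 0 <= 1024 * energy_const P by apply: mulr_ge0 CW0; exact: ler0n.
case: ifP => _; first by rewrite -mulrDr lexx.
by apply: mulr_ge0 => //; apply: addr_ge0; exact: weighted_integral_ge0.
Qed.

(** A triangle outside the coarse region lies in a row or in a column that runs
    through a layer to the outflow boundary. *)
Lemma layer_poincare : \sum_(K : tri_index N | ~~ coarse K) PK K <=
  32 * CLam ^+ 2 * (1024 * energy_const P * \sum_K JW q K).
Proof.
have P0 K : 0 <= PK K.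
  apply: mulr_ge0; first exact: area_ge0.
  apply: mulr_ge0; first exact/ltW/corner_weight_gt0.
  by apply: divr_ge0; [exact: sqr_ge0|apply: mulr_ge0; [exact: ltW|exact: sqr_ge0]].
apply: (@le_trans _ _ (\sum_(K : tri_index N | (N./2 <= K.1.1)%N) PK K +
   \sum_(K : tri_index N | (N./2 <= K.1.2)%N) PK K)); last first.
  by have := xlayer_poincare; have := ylayer_poincare; lra.
rewrite big_mkcond [X in _ <= X + _]big_mkcond [X in _ <= _ + X]big_mkcond -big_split /=.
apply: ler_sum => K _; rewrite /coarse negb_and -!leqNgt.
by case: (leqP N./2 K.1.1) => h1; case: (leqP N./2 K.1.2) => h2 /=; rewrite ?addr0 ?add0r ?lerDl ?P0.
Qed.

Local Notation W2 := (\sum_K JW q K).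

Definition error_const : R := 1024 * energy_const P * (28 * coarse_const P + layer_const P * (32 * CLam ^+ 2 + 1)).

Section ErrorSum.
Variable qi : tri_index N -> R * R * R.
Hypothesis Hv : forall K, [/\ aff (qi K) (ck K) = TH (ck K) * aff (q K) (ck K),
  aff (qi K) (vtx1 (ck K) (uk K)) = TH (vtx1 (ck K) (uk K)) * aff (q K) (vtx1 (ck K) (uk K)) &
  aff (qi K) (vtx2 (ck K) (wk K)) = TH (vtx2 (ck K) (wk K)) * aff (q K) (vtx2 (ck K) (wk K))].
Hypotheses (k32 : 32 <= k) (eps_eh : n * epshat_s N eps modified <= 1).
Hypotheses (knb : k <= n * sb) (kne : k <= n * se) (kee : k <= n * Num.sqrt n * se ^+ 2).
Hypothesis hcase : (k <= Num.sqrt n * se) \/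
  (k <= Num.sqrt (epshat_s N eps modified) * (n * Num.sqrt n) * se).
Hypothesis hcd : c P * (Cstar P * n^-1) <= 1 / 2.

Lemma energy_err_sum :
  \sum_K integral2 (oK K) (energy_err P eps modified xst sb se q qi K) <= error_const / Num.sqrt k * W2.
Proof.
have k1 : 1 <= k by have := k32; lra.
have k0 : 0 < k by lra.
have sk0 : 0 < Num.sqrt k by rewrite sqrtr_gt0.
have CW0 := energy_const_ge0 b0 c0 Cs0.
have [CC0 _ _ _] := coarse_const_parts b0 c0 Cs0.
have CL0 : 0 <= layer_const P by rewrite /layer_const; have := ltW b0; have := ltW c0; lra.
have W0 : 0 <= W2 by apply: sumr_ge0 => K _; exact: weighted_integral_ge0.
rewrite /error_const; set a := 1024 * energy_const P.
have a0 : 0 <= a by apply: mulr_ge0 CW0; exact: ler0n.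
rewrite (bigID (fun K : tri_index N => coarse K)) /=.
have h1 : \sum_(K : tri_index N | coarse K) integral2 (oK K) (energy_err P eps modified xst sb se q qi K) <=
    coarse_const P * 28 * a / Num.sqrt k * W2.
  have p0 : 0 <= coarse_const P * 28 * a / Num.sqrt k.
    apply: divr_ge0; last exact: ltW.
    by apply: mulr_ge0 => //; apply: mulr_ge0 => //; exact: ler0n.
  apply: (@le_trans _ _ (\sum_(K : tri_index N | coarse K) coarse_const P * 28 * a / Num.sqrt k * JW q K)).
    apply: ler_sum => K cK; rewrite /a !mulrA; exact: energy_err_coarse.
  rewrite -mulr_sumr; apply: ler_wpM2l => //.
  by rewrite [leRHS](bigID (fun K : tri_index N => coarse K)) /= lerDl; apply: sumr_ge0 => K _; exact: weighted_integral_ge0.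
have h2 : \sum_(K : tri_index N | ~~ coarse K) integral2 (oK K) (energy_err P eps modified xst sb se q qi K) <=
    layer_const P / k * (32 * CLam ^+ 2 * (a * W2) + a * W2).
  have p0 : 0 <= layer_const P / k by apply: divr_ge0 => //; exact: ltW.
  apply: (@le_trans _ _ (\sum_(K : tri_index N | ~~ coarse K) layer_const P / k * (PK K + a * JW q K))).
    by apply: ler_sum => K cK; exact: energy_err_layer.
  rewrite -mulr_sumr; apply: ler_wpM2l => //.
  rewrite big_split /=; apply: lerD; first exact: layer_poincare.
  rewrite -mulr_sumr; apply: ler_wpM2l => //.
  by rewrite [leRHS](bigID (fun K : tri_index N => coarse K)) /= lerDr; apply: sumr_ge0 => K _; exact: weighted_integral_ge0.
apply: (le_trans (lerD h1 h2)).
have kk : k^-1 <= (Num.sqrt k)^-1.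
  rewrite lef_pV2 ?posrE// -[leRHS](sqr_sqrtr (ltW k0)) expr2 ler_peMl ?(ltW sk0)//.
  by rewrite -sqrtr1 ler_wsqrtr.
have p1 : 0 <= layer_const P * (a * W2 * (32 * CLam ^+ 2 + 1)).
  apply: mulr_ge0 => //; apply: mulr_ge0; first exact: mulr_ge0.
  by have := sqr_ge0 CLam; lra.
have := ler_wpM2l p1 kk.
move: (k^-1) (Num.sqrt k)^-1 => u v; lra.
Qed.

End ErrorSum.

Lemma weight_center : Theta_beta be et xst sb se xst = (2 * sb)^-1 /\ TH xst = 1.
Proof.
have e d s : dot (xst - xst) d / s = 0 by rewrite /dot /= !subrr !mul0r addr0 mul0r.
rewrite /Theta /Theta_beta /arg_beta /arg_eta !e /Afac /dAfac /Bfac oppr0 expR0; split; last by lra.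
by field; rewrite lt0r_neq0.
Qed.

Lemma weighted_integral_le_sum K : JW q K <= W2.
Proof. by rewrite (bigD1 K)//= lerDl; apply: sumr_ge0 => K' _; exact: weighted_integral_ge0. Qed.

(** The triangle with corner xstar on its upper right lies in the coarse region
    and has area at least 1 / (2 N^2); the term (b/2) Theta_beta G^2 of the
    weighted norm controls G(xstar) there. *)
Lemma node_coarse_bound i j : (0 < i <= N./2)%N -> (0 < j <= N./2)%N -> xst = (xs i, ys j) ->
  G xst ^+ 2 <= 2048 * energy_const P * n ^+ 2 * sb * W2.
Proof.
case: i => // i /= hi; case: j => // j /= hj xE.
have hN : (N./2 <= N)%N by rewrite -[leqRHS](half_nat evN) leq_addr.
have iN := leq_trans hi hN; have jN := leq_trans hj hN.
set K : tri_index N := (Ordinal iN, Ordinal jN, true).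
have cE : ck K = xst by rewrite xE /corner /= !addn1.
have CW0 := energy_const_ge0 b0 c0 Cs0.
have h : AK K * local_energy P eps modified xst sb se q K <= 1024 * energy_const P * JW q K by exact: local_energy_le.
have aK : (n ^+ 2)^-1 <= AK K.
  rewrite areaE /= hi hj expr2 invfM; apply: ler_pM; try by rewrite invr_ge0 ltW.
    exact: coarse_h_ge.
  exact: coarse_h_ge.
have M : `|G xst| <= MM q K.
  have := le_vmax0 (ck K) (uk K) (wk K) (aff (q K)).
  by rewrite -/(vertex_max P eps q K); have [-> _ _] := vertex_values K; rewrite /= !addn1 -xE.
have M2 : G xst ^+ 2 <= MM q K ^+ 2.
  by rewrite -(real_normK (num_real (G xst))) lerXn2r// nnegrE ?normr_ge0// (le_trans _ M).
have lE : (2 * sb)^-1 * G xst ^+ 2 <= local_energy P eps modified xst sb se q K.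
  have S : corner_dweight P eps xst sb se K = (2 * sb)^-1 by rewrite /corner_dweight cE weight_center.1.
  have T0 := ltW (corner_weight_gt0 P eps xst sb se K).
  rewrite /local_energy S.
  have X0 : 0 <= (2 * sb)^-1 by rewrite invr_ge0; have := sb0; lra.
  apply: le_trans (ler_wpM2l X0 M2) _; rewrite lerDr.
  apply: mulr_ge0 => //.
  have e := le_trans (ltW eps0) (tri_epshat_ge eps modified K).
  have d := tri_delta_ge0 Cs0 K; have ds0 := ltW Cs0; have e0 := ltW eps0.
  by nonneg_tac.
have A0 : 0 <= (n ^+ 2)^-1 by rewrite invr_ge0 exprn_ge0 ?ltW.
have l0 : 0 <= (2 * sb)^-1 * G xst ^+ 2.
  by apply: mulr_ge0; [rewrite invr_ge0; have := sb0; lra|exact: sqr_ge0].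
have h1 : (n ^+ 2)^-1 * ((2 * sb)^-1 * G xst ^+ 2) <= 1024 * energy_const P * W2.
  apply: (le_trans (ler_pM A0 l0 aK lE)); apply: (le_trans h).
  by apply: ler_wpM2l; [apply: mulr_ge0 CW0; exact: ler0n|exact: weighted_integral_le_sum].
have p0 : 0 <= 2 * sb * n ^+ 2 by apply: mulr_ge0; [have := sb0; lra|exact: sqr_ge0].
have := ler_wpM2l p0 h1.
have -> : 2 * sb * n ^+ 2 * ((n ^+ 2)^-1 * ((2 * sb)^-1 * G xst ^+ 2)) = G xst ^+ 2.
  by field; rewrite !lt0r_neq0.
by move=> h2; apply: (le_trans h2); rewrite le_eqVlt; apply/orP; left; apply/eqP; ring.
Qed.

(** The cells of the strip have area at least hh / n, as their other side is
    coarse; the fine mesh size cancels up to lam / eps. *)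
Lemma strip_point (lam hh A T g e : R) :
  0 < lam -> lam <= CLam * (eps * L) -> 0 < hh -> n * hh = 2 * lam -> hh / n <= A -> 1/2 <= T ->
  0 <= e -> A * (T * (eps * g ^+ 2)) <= 1024 * energy_const P * e ->
  n * (hh * `|g|) ^+ 2 <= 4096 * energy_const P * CLam * L * n * e.
Proof.
move=> lam0 lamL hh0 hhE hA T2 e0 h.
have CW0 := energy_const_ge0 b0 c0 Cs0.
have hn0 : 0 <= hh / n by apply: divr_ge0; exact: ltW.
have g0 := mulr_ge0 (ltW eps0) (sqr_ge0 g).
have h1 : hh / n * (1/2 * (eps * g ^+ 2)) <= 1024 * energy_const P * e.
  apply: le_trans h; apply: ler_pM => //; first by apply: mulr_ge0 => //; lra.
  by apply: ler_wpM2r.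
have h2 : hh * g ^+ 2 * eps <= 2048 * energy_const P * e * n.
  have := ler_wpM2r (ltW n0) h1.
  have -> : hh / n * (1 / 2 * (eps * g ^+ 2)) * n = hh * g ^+ 2 * eps / 2.
    by field; rewrite lt0r_neq0.
  lra.
have -> : n * (hh * `|g|) ^+ 2 = n * hh * (hh * g ^+ 2).
  by rewrite exprMn real_normK ?num_real//; ring.
rewrite hhE.
have x0 : 0 <= hh * g ^+ 2 by apply: mulr_ge0; [exact: ltW|exact: sqr_ge0].
have h3 := ler_wpM2r x0 lamL.
have h4 := ler_wpM2l (mulr_ge0 CLam0 (ltW L0)) h2.
lra.
Qed.

Lemma corner_weight_half K : 1/2 <= TT K. Proof. exact: Theta_ge. Qed.

(** The value at a node is the sum of the differences along its row up to the
    outflow boundary. *)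
Lemma node_x_bound i (j : 'I_N) : (N./2 <= i <= N)%N -> (j < N./2)%N ->
  Gn i j ^+ 2 <= 4096 * energy_const P * CLam * L * n * W2.
Proof.
move=> hi hj.
have CW0 := energy_const_ge0 b0 c0 Cs0.
have f0 : 0 < fine_h N lx by exact: fine_h_gt0.
have dF (l : 'I_N) : (N./2 <= l)%N ->
    `|Gn l.+1 j - Gn l j| <= fine_h N lx * `|(q (l, j, false)).1.2|.
  move=> hl; have := edge_x (l, j, false); rewrite /= addn0.
  by rewrite (mesh_widthE N0 evN lx0 lx2) /= ltnNge hl /= => ->.
apply: le_trans (layer_telescope (f := fun i => Gn i j) (G_right (ltnW (ltn_ord j))) dF hi) _.
rewrite mulr_sumr.
have K0 : 0 <= 4096 * energy_const P * CLam * L * n.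
  apply: mulr_ge0 (ltW n0); apply: mulr_ge0 (ltW L0); apply: mulr_ge0 CLam0.
  apply: mulr_ge0 CW0; exact: ler0n.
apply: (@le_trans _ _ (\sum_(l < N | (N./2 <= l)%N)
   4096 * energy_const P * CLam * L * n * JW q (l, j, false))).
  apply: ler_sum => l hl.
  apply: (strip_point (A := AK (l, j, false)) (T := TT (l, j, false)) lx0 lxL f0 (fine_hE lx)).
  - rewrite areaE /= hj ltnNge hl /=; apply: ler_wpM2l; [exact: ltW|exact: coarse_h_ge].
  - exact: corner_weight_half.
  - exact: weighted_integral_ge0.
  - exact: (gradient_le (l, j, false)).1.
rewrite -mulr_sumr; apply: ler_wpM2l => //.
rewrite sum_tri big_mkcond; apply: ler_sum => l _; rewrite (bigD1 j)//=.
have : 0 <= \sum_(j0 < N | j0 != j) (JW q (l, j0, false) + JW q (l, j0, true)).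
  by apply: sumr_ge0 => j0 _; apply: addr_ge0; exact: weighted_integral_ge0.
have := weighted_integral_ge0 (l, j, false); have := weighted_integral_ge0 (l, j, true).
by case: ifP => _; lra.
Qed.

Lemma node_y_bound (i : 'I_N) j : (i < N./2)%N -> (N./2 <= j <= N)%N ->
  Gn i j ^+ 2 <= 4096 * energy_const P * CLam * L * n * W2.
Proof.
move=> hi hj.
have CW0 := energy_const_ge0 b0 c0 Cs0.
have f0 : 0 < fine_h N ly by exact: fine_h_gt0.
have dF (l : 'I_N) : (N./2 <= l)%N ->
    `|Gn i l.+1 - Gn i l| <= fine_h N ly * `|(q (i, l, false)).2|.
  move=> hl; have := edge_y (i, l, false); rewrite /= addn0.
  by rewrite (mesh_heightE N0 evN ly0 ly2) /= ltnNge hl /= => ->.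
apply: le_trans (layer_telescope (f := fun j => Gn i j) (G_top (ltnW (ltn_ord i))) dF hj) _.
rewrite mulr_sumr.
have K0 : 0 <= 4096 * energy_const P * CLam * L * n.
  apply: mulr_ge0 (ltW n0); apply: mulr_ge0 (ltW L0); apply: mulr_ge0 CLam0.
  apply: mulr_ge0 CW0; exact: ler0n.
apply: (@le_trans _ _ (\sum_(l < N | (N./2 <= l)%N)
   4096 * energy_const P * CLam * L * n * JW q (i, l, false))).
  apply: ler_sum => l hl.
  apply: (strip_point (A := AK (i, l, false)) (T := TT (i, l, false)) ly0 lyL f0 (fine_hE ly)).
  - rewrite areaE /= hi ltnNge hl /= mulrC; apply: ler_wpM2r; [exact: ltW|exact: coarse_h_ge].
  - exact: corner_weight_half.
  - exact: weighted_integral_ge0.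
  - exact: (gradient_le (i, l, false)).2.
rewrite -mulr_sumr; apply: ler_wpM2l => //.
rewrite sum_tri [leRHS](bigD1 i)//= big_mkcond -[leLHS]addr0; apply: lerD.
  apply: ler_sum => l _.
  have := weighted_integral_ge0 (i, l, false); have := weighted_integral_ge0 (i, l, true).
  by case: ifP => _; lra.
apply: sumr_ge0 => i0 _; apply: sumr_ge0 => j0 _; apply: addr_ge0; exact: weighted_integral_ge0.
Qed.

End LayerSums.

(** * The energy estimate for the Green function *)

Section GreenEnergy.
Context {R : realType}.
Variables (P : data R) (N : nat) (eps : R) (modified : bool).
Hypotheses (N0 : (0 < N)%N) (evN : ~~ odd N) (eps0 : 0 < eps).
Local Notation lx := (lambda_x P N eps).
Local Notation ly := (lambda_y P N eps).
Hypotheses (lx0 : 0 < lx) (lx2 : lx <= 1/2) (ly0 : 0 < ly) (ly2 : ly <= 1/2).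
Hypotheses (b0 : 0 < bnorm P) (c0 : 0 < c P) (Cs0 : 0 < Cstar P).
Local Notation xs := (mesh_point N lx).
Local Notation ys := (mesh_point N ly).
Local Notation b := (bnorm P).
Local Notation be := (beta_dir P).
Local Notation et := (eta_dir P).
Local Notation oK := (@open_tri R N xs ys).
Local Notation n := (N%:R : R).
Variables (xst : R * R) (sb se : R).
Hypotheses (sb0 : 0 < sb) (se0 : 0 < se).
Hypotheses (sbn : 16 <= n * sb) (sen : 16 <= n * se).
Local Notation TH := (Theta be et xst sb se).
Implicit Types (K : tri_index N).
Local Notation ck K := (corner xs ys K).
Local Notation uk K := (signed_width xs K).
Local Notation wk K := (signed_height ys K).

Variables (L k CLam : R).
Hypothesis L2 : 1/2 <= L.
Hypotheses (CLam0 : 0 <= CLam) (k4 : 4 * (CLam + 4) <= k) (k32 : 32 <= k).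
Hypotheses (kb : k * L <= n * sb) (ke : k * L <= n * se).
Hypothesis (epsn : eps * n <= 1).
Hypotheses (lxL : lx <= CLam * (eps * L)) (lyL : ly <= CLam * (eps * L)).
Hypothesis (eps_eh : n * epshat_s N eps modified <= 1).
Hypotheses (knb : k <= n * sb) (kne : k <= n * se) (kee : k <= n * Num.sqrt n * se ^+ 2).
Hypothesis hcase : (k <= Num.sqrt n * se) \/
  (k <= Num.sqrt (epshat_s N eps modified) * (n * Num.sqrt n) * se).
Hypothesis hcd : c P * (Cstar P * n^-1) <= 1 / 2.
Hypothesis streamline : eps + Cstar P * n^-1 * b ^+ 2 <= b / 4 * sb.
Hypothesis crosswind : 4 * epshat_s N eps modified <= c P * se ^+ 2.
Hypothesis CEk : error_const P CLam / Num.sqrt k <= 1 / 8.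

(** Here the lower bounds on sigma_beta and sigma_eta act in the form of the
    hypotheses streamline and crosswind. *)
Lemma coercive_sum q :
  (\sum_K integral2 (oK K) (weighted_density P eps modified xst sb se q K)) / 4 <=
  \sum_K integral2 (oK K) (energy_main P eps modified xst sb se q K).
Proof.
rewrite mulr_suml; apply: ler_sum => K _.
have mT := measurable_open_tri xs ys K.
have sT := open_tri_sub N0 evN lx0 lx2 ly0 ly2 (K := K).
have nd := bmeasurable_weighted_density P eps modified xst sb se q K.
have nm := bmeasurable_energy_main P eps modified xst sb se q K.
rewrite mulrC -integral2Z//; apply: integral2_le => //; first by bmeasurable_tac.
move=> p _; rewrite mulrC.
have d0 := tri_delta_ge0 Cs0 K.
have b' := ltW b0; have e' := ltW eps0.
have dle : tri_delta P K <= Cstar P * n^-1.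
  by rewrite /tri_delta; case: ifP => // _; apply: mulr_ge0; [exact: ltW|rewrite invr_ge0].
have ehle : tri_epshat eps modified K <= epshat_s N eps modified.
  by rewrite /tri_epshat; case: ifP => // _; exact: epshat_s_ge.
apply: (coercive_pointwise (sb := sb) (se := se)) => //.
- exact: Theta_gt0.
- exact: Theta_beta_gt0.
- exact: le_trans e' (tri_epshat_ge eps modified K).
- exact: Theta_beta_le.
- exact: Theta_eta_le.
- by apply: le_trans hcd; apply: ler_wpM2l => //; exact: ltW.
- apply: le_trans streamline; rewrite lerD2l; apply: ler_wpM2r => //; exact: sqr_ge0.
- by apply: le_trans crosswind; apply: ler_wpM2l.
Qed.

Variable G : R * R -> R.
Hypothesis green : is_green P N eps modified xst G.
Hypothesis node : is_node P N eps xst.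

Local Notation I := (interp N lx ly (fun p => TH p * G p)).

Lemma green_boundary p : (Omegabar `\` Omega) p -> G p = 0.
Proof. by case: green => -[_ h _] _; exact: h. Qed.

Lemma boundary_node i j : (i <= N)%N -> (j <= N)%N ->
  [|| i == 0%N, i == N, j == 0%N | j == N] -> (Omegabar `\` Omega) (xs i, ys j).
Proof.
move=> iN jN h; split.
  by split; rewrite /= in_itv /=; exact: mesh_itv.
move=> [/=]; rewrite !in_itv /=; case/or4P: h => /eqP ->.
- by rewrite mesh_0 ltxx.
- by rewrite mesh_N// ltxx andbF.
- by rewrite mesh_0 ltxx.
- by rewrite mesh_N// ltxx andbF.
Qed.

Lemma interp_in_VN : in_VN P N eps I.
Proof.
split.
- by apply: continuous_subspaceT; exact: continuous_interp.
- move=> p; apply: interp_boundary => // i j iN jN h.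
  by rewrite green_boundary ?mulr0//; exact: boundary_node.
- by move=> K; rewrite triangleE//; exact: interp_P1.
Qed.

Lemma a_MSD_interp : a_MSD P N eps modified I G = G xst.
Proof.
case: green => _ ->; last exact: interp_in_VN.
have [i [j xE]] := node.
have iN : (i <= N)%N by rewrite -ltnS.
have jN : (j <= N)%N by rewrite -ltnS.
have e : (xs i, ys j) = xst by rewrite xE.
have := interp_node N0 evN lx0 lx2 ly0 ly2 (fun p => TH p * G p) iN jN.
by rewrite e => ->; rewrite (weight_center P xst se sb0).2 mul1r.
Qed.

(** With the error at most W^2 / 8, it can be moved to the left-hand side of W^2
    / 4 <= G(xstar) + error. *)
Lemma weighted_energy_le q : pieces P eps G q ->
  \sum_K integral2 (oK K) (weighted_density P eps modified xst sb se q K) <= 8 * G xst.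
Proof.
move=> Gq; have [qi Iqi] := in_VN_pieces N0 evN lx0 lx2 ly0 ly2 interp_in_VN.
have ordb (j : 'I_N) (s : bool) : (j + s <= N)%N by case: s; rewrite ?addn1 ?addn0 // ltnW.
have Hv K : [/\ aff (qi K) (ck K) = TH (ck K) * aff (q K) (ck K),
    aff (qi K) (vtx1 (ck K) (uk K)) = TH (vtx1 (ck K) (uk K)) * aff (q K) (vtx1 (ck K) (uk K)) &
    aff (qi K) (vtx2 (ck K) (wk K)) = TH (vtx2 (ck K) (wk K)) * aff (q K) (vtx2 (ck K) (wk K))].
  have [v0 v1 v2] := vertex_values N0 evN lx0 lx2 ly0 ly2 Gq K.
  have [w0 w1 w2] := vertex_values N0 evN lx0 lx2 ly0 ly2 Iqi K.
  by rewrite v0 v1 v2 w0 w1 w2 !interp_node ?ordb// vtx1_node vtx2_node.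
have id := energy_identity modified N0 evN lx0 lx2 ly0 ly2 b0 xst sb0 se0 Gq Iqi green_boundary.
have co := coercive_sum q.
have er := energy_err_sum N0 evN eps0 lx0 lx2 ly0 ly2 b0 c0 Cs0 sb0 se0 sbn sen L2 CLam0 k4 kb ke
  epsn lxL lyL Gq green_boundary Hv k32 eps_eh knb kne kee hcase hcd.
have W0 : 0 <= \sum_K integral2 (oK K) (weighted_density P eps modified xst sb se q K).
  by apply: sumr_ge0 => K _; exact: weighted_integral_ge0.
rewrite a_MSD_interp in id; rewrite id in co; clear id.
move: co er W0; move: (\sum_K integral2 _ _) (\sum_K integral2 _ _) => W E co er W0.
have h := ler_wpM2r W0 CEk; lra.
Qed.

End GreenEnergy.

(** * Choice of the constants *)

Section ConstantChoice.
Context {R : realType}.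

Lemma ln_nat_ge_half (N : nat) : (1 < N)%N -> 1/2 <= ln (N%:R : R).
Proof.
move=> N1; have n2 : (2 : R) <= N%:R by rewrite ler_nat.
apply: (@le_trans _ _ (ln 2)); last by rewrite ler_ln ?posrE//; lra.
have : ln (1 + (- (1/2)) : R) <= - (1/2) by apply: le_ln1Dx; lra.
have -> : 1 + - (1/2) = 2^-1 :> R by field.
by rewrite lnV ?posrE//; lra.
Qed.

Section Powers.
Variables (N : nat).
Hypothesis N0 : (0 < N)%N.
Local Notation n := (N%:R : R).

Let n0 : 0 < n. Proof. by rewrite ltr0n. Qed.
Let n1 : 1 <= n. Proof. by rewrite ler1n. Qed.

Lemma powR_half (x : R) : 0 <= x -> x `^ (1/2) = Num.sqrt x.
Proof. by move=> x0; rewrite div1r powR12_sqrt. Qed.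

Lemma powR_three_half : n `^ (3/2) = n * Num.sqrt n.
Proof.
have -> : 3/2 = 1 + 1/2 :> R by field.
rewrite powRD; last by rewrite lt0r_neq0// implybT.
by rewrite powRr1 ?powR_half// ltW.
Qed.

Lemma powR_three_quarter : n * Num.sqrt n * (n `^ (- (3/4))) ^+ 2 = 1.
Proof.
have -> : (n `^ (- (3/4))) ^+ 2 = n `^ (- (3/2)).
  by rewrite -powR_mulrn ?powR_ge0// -powRrM; congr (_ `^ _); field.
by rewrite powRN powR_three_half divff// lt0r_neq0// mulr_gt0// sqrtr_gt0.
Qed.

Lemma powR_three_quarter_ge : n^-1 <= n `^ (- (3/4)).
Proof. by rewrite -powR_inv1 ?(ltW n0)//; apply: ler_powR => //; lra. Qed.

End Powers.

(** Combines W^2 <= 8 g with a bound on g by W: squaring the first and dividing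
    by W^2 leaves a bound on W. *)
Lemma quadratic_bound (W g X : R) :
  0 <= W -> 0 <= X -> W ^+ 2 <= 8 * g -> g ^+ 2 <= X * W ^+ 2 -> W <= 8 * Num.sqrt X.
Proof.
move=> W0 X0 h1 h2.
have [W00|Wn0] := eqVneq W 0; first by rewrite W00 mulr_ge0// sqrtr_ge0.
have Wp : 0 < W ^+ 2 by rewrite exprn_gt0// lt_neqAle eq_sym Wn0.
have h3 : (W ^+ 2) * (W ^+ 2) <= 64 * X * W ^+ 2.
  have := ler_pM (ltW Wp) (ltW Wp) h1 h1; lra.
rewrite ler_pM2r// in h3.
rewrite -ler_sqr ?nnegrE ?mulr_ge0 ?sqrtr_ge0//.
by rewrite exprMn sqr_sqrtr//; lra.
Qed.

Section Mesh.
Variables (N : nat) (l : R).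
Hypotheses (N0 : (0 < N)%N) (evN : ~~ odd N) (l0 : 0 < l) (l2 : l <= 1/2).
Local Notation mp := (mesh_point N l).

Lemma mesh_strict i j : (i < j)%N -> mp i < mp j.
Proof. by move=> ij; apply: lt_le_trans (mesh_lt N0 evN l0 l2 i) _; exact: mesh_mono. Qed.

Lemma mesh_le_half i : mp i <= 1 - l -> (i <= N./2)%N.
Proof.
rewrite -(mesh_half l N0 evN) leqNgt => h; apply/negP => /mesh_strict; rewrite ltNge h//.
Qed.

Lemma mesh_lt_half i : mp i < 1 - l -> (i < N./2)%N.
Proof.
rewrite -(mesh_half l N0 evN) ltnNge => h; apply/negP => hi.
by have := mesh_mono N0 evN l0 l2 hi; rewrite leNgt h.
Qed.

Lemma mesh_ge_half i : 1 - l <= mp i -> (N./2 <= i)%N.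
Proof.
rewrite -(mesh_half l N0 evN) leqNgt => h; apply/negP => /mesh_strict; rewrite ltNge h//.
Qed.

Lemma mesh_gt0_pos i : 0 < mp i -> (0 < i)%N.
Proof. by case: i => //; rewrite mesh_0 ltxx. Qed.

End Mesh.

Section Suprema.
Variables (P : data R) (N : nat) (eps : R) (modified : bool).
Hypotheses (Cs0 : 0 < Cstar P).
Hypotheses (lx2 : lambda_x P N eps <= 1/2) (ly2 : lambda_y P N eps <= 1/2).

Let quarter : R * R := (1/4, 1/4).

Lemma quarter_Omega : Omega quarter.
Proof. by split; rewrite /= in_itv /=; apply/andP; split; lra. Qed.

Lemma quarter_Omega_s : quarter \in Omega_s P N eps.
Proof.
apply/mem_set; have h1 := lx2; have h2 := ly2.
by split; rewrite /= in_itv /=; apply/andP; split; lra.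
Qed.

(** The point (1/4, 1/4) lies in Omega_s, because the transition points are at
    most 1/2 away from the boundary. *)
Lemma delta_M_ge : Cstar P * N%:R^-1 <= delta_M P N eps.
Proof.
have c0 : 0 <= Cstar P * N%:R^-1 by apply: mulr_ge0; [exact: ltW|rewrite invr_ge0].
apply: ub_le_sup.
  by exists (Cstar P * N%:R^-1) => _ [x _ <-]; rewrite /delta; case: ifP.
by exists quarter; [exact: quarter_Omega|rewrite /delta quarter_Omega_s].
Qed.

Lemma epshat_M_ge : epshat_s N eps modified <= epshat_M P N eps modified.
Proof.
apply: ub_le_sup.
  exists (epshat_s N eps modified) => _ [x _ <-]; rewrite /epshat.
  by case: ifP => // _; exact: epshat_s_ge.
by exists quarter; [exact: quarter_Omega|rewrite /epshat quarter_Omega_s].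
Qed.

End Suprema.

Section Constants.
Variable P : data R.

Definition width_const : R := rho / mesh_beta1 P + rho / mesh_beta2 P.

(** The summands serve, in order, the bounds 32 <= k, the comparability of the
    weight across a layer, the smallness of the error, and the coercivity in
    streamline and crosswind direction. *)
Definition k_const : R := 32 + 4 * (width_const + 4) + (8 * error_const P width_const) ^+ 2 +
  4 * (1 + bnorm P ^+ 2) / bnorm P + 4 / c P.

Definition C_const : R := Num.sqrt 8 *
  (8 * (Num.sqrt (2048 * energy_const P) + Num.sqrt (4096 * energy_const P * width_const))).

End Constants.

End ConstantChoice.

Section Bounds.
Context {R : realType}.
Variables (P : data R) (HP : data_pos P).

Lemma bnorm_gt0 : 0 < bnorm P.
Proof.
case: HP => -[h1 h2 _] _; rewrite sqrtr_gt0.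
by apply: addr_gt0; exact: exprn_gt0.
Qed.

Let b0 := bnorm_gt0.
Let c0 : 0 < c P. Proof. by case: HP => -[]. Qed.
Let Cs0 : 0 < Cstar P. Proof. by case: HP => _ []. Qed.

Lemma width_const_gt0 : 0 < width_const P.
Proof.
case: HP => _ [h1 h2 _]; have r0 : 0 < rho :> R by rewrite /rho; lra.
by apply: addr_gt0; exact: divr_gt0.
Qed.

Lemma k_const_parts : [/\ 32 <= k_const P, 4 * (width_const P + 4) <= k_const P,
  (8 * error_const P (width_const P)) ^+ 2 <= k_const P,
  4 * (1 + bnorm P ^+ 2) / bnorm P <= k_const P & 4 / c P <= k_const P].
Proof.
have w0 := width_const_gt0.
have h1 : 0 <= 4 * (1 + bnorm P ^+ 2) / bnorm P.
  by apply: divr_ge0 (ltW b0); have := sqr_ge0 (bnorm P); lra.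
have h2 : 0 <= 4 / c P by apply: divr_ge0 => //; exact: ltW.
have h3 := sqr_ge0 (8 * error_const P (width_const P)).
rewrite /k_const; move: h1 h2 h3; move: (_ / _) (_ / _) ((8 * _) ^+ 2) => x y z.
by move=> *; split; lra.
Qed.

Lemma energy_const_gt0 : 0 < energy_const P.
Proof. by have [h _ _ _] := energy_const_parts b0 c0 Cs0; apply: lt_le_trans h. Qed.

Lemma C_const_gt0 : 0 < C_const P.
Proof.
have h := energy_const_gt0; rewrite /C_const.
have a : 0 < Num.sqrt (2048 * energy_const P) by rewrite sqrtr_gt0; apply: mulr_gt0 h; rewrite ltr0n.
have a' : 0 < Num.sqrt 8 :> R by rewrite sqrtr_gt0 ltr0n.
apply: (mulr_gt0 a'); apply: mulr_gt0; first by rewrite ltr0n.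
by apply: ltr_wpDr a; exact: sqrtr_ge0.
Qed.

Lemma error_const_small k : k_const P <= k -> error_const P (width_const P) / Num.sqrt k <= 1 / 8.
Proof.
have [h32 _ h _ _] := k_const_parts => kk.
have k0 : 0 < k by lra.
rewrite ler_pdivrMr ?sqrtr_gt0//.
suff : 8 * error_const P (width_const P) <= Num.sqrt k by lra.
apply: le_trans (ler_norm _) _; rewrite -sqrtr_sqr ler_wsqrtr//; exact: le_trans h kk.
Qed.

End Bounds.

Theorem theorem1 (R : realType) (P : data R) (HP : data_pos P) :
  exists k0 C : R, [/\ 1 < k0, 0 < C &
  forall (N : nat) (eps : R) (modified : bool),
    (0 < N)%N -> ~~ odd N ->
    0 < eps -> eps < bnorm P -> eps <= N%:R^-1 ->
    lambda_x P N eps = rho * eps * (mesh_beta1 P)^-1 * ln N%:R ->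
    lambda_y P N eps = rho * eps * (mesh_beta2 P)^-1 * ln N%:R ->
    (forall K : tri_index N, c P * delta_K P eps K <= 1 / 2) ->
  forall k : R, k0 <= k ->
  forall sigma_beta sigma_eta : R,
    0 < sigma_beta -> 0 < sigma_eta ->
    k * (eps + delta_M P N eps) <= sigma_beta ->
    k * Num.sqrt (epshat_M P N eps modified) <= sigma_eta ->
    k * N%:R^-1 <= sigma_beta ->
    k * N%:R `^ (- (3 / 4)) <= sigma_eta ->
    sigma_eta_star N eps modified k <= sigma_eta ->
    k * N%:R^-1 * ln N%:R <= sigma_beta ->
    k * N%:R^-1 * ln N%:R <= sigma_eta ->
    k * eps `^ (1 / 4) * N%:R `^ (- (1 / 2)) * Num.sqrt (ln N%:R) <= sigma_eta ->
  forall xstar : R * R,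
    is_node P N eps xstar -> (Omega `\` Omega_xy P N eps) xstar ->
  forall G : R * R -> R, is_green P N eps modified xstar G ->
    let W := norm_weighted P N eps modified
               (omega P sigma_beta sigma_eta xstar) G in
    [/\ norm_MSD P N eps modified G <= Num.sqrt 8 * W,
        Omega_s P N eps xstar ->
          Num.sqrt 8 * W <= C * N%:R * Num.sqrt sigma_beta &
        (Omega_x P N eps `|` Omega_y P N eps) xstar ->
          Num.sqrt 8 * W <= C * Num.sqrt N%:R * Num.sqrt (ln N%:R)]].
Proof.
exists (k_const P), (C_const P).
have [K32 K4 KE Kb Kc] := k_const_parts HP.
have b0 := bnorm_gt0 HP; have C0 := C_const_gt0 HP; have w0 := width_const_gt0 HP.
have CW0 := energy_const_gt0 HP.
split=> [|//|]; first by lra.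
move=> N eps modified N0 evN eps0 _ epsN lxE lyE hdK k kk sb se sb0 se0.
move=> hb1 he1 hb2 he2 he3 hb4 he4 _ xst node nodeO G green W.
have c0 : 0 < c P by case: HP => -[].
have Cs0 : 0 < Cstar P by case: HP => _ [].
have [be1 be2] : 0 < mesh_beta1 P /\ 0 < mesh_beta2 P by case: HP => _ [].
have N1 : (1 < N)%N by move: N0 evN; case: (N) => [|[]].
have n0 : 0 < (N%:R : R) by rewrite ltr0n.
have n1 : 1 <= (N%:R : R) by rewrite ler1n.
have L2 := @ln_nat_ge_half R N N1.
set L := ln N%:R in L2 lxE lyE hb4 he4 *.
set n := (N%:R : R) in n0 n1 epsN hb1 he1 hb2 he2 he3 hb4 he4 *.
have L0 : 0 < L by lra.
have k32 : 32 <= k by exact: le_trans K32 kk.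
have k1 : 1 <= k by apply: le_trans k32; rewrite ler1n.
have k0 : 0 < k by exact: lt_le_trans ltr01 k1.
have r0 : 0 < rho :> R by rewrite /rho; lra.
have lx0 : 0 < lambda_x P N eps by rewrite lxE; do !apply: mulr_gt0 => //; rewrite invr_gt0.
have ly0 : 0 < lambda_y P N eps by rewrite lyE; do !apply: mulr_gt0 => //; rewrite invr_gt0.
have lx2 : lambda_x P N eps <= 1/2 by rewrite /lambda_x /transition ge_min lexx.
have ly2 : lambda_y P N eps <= 1/2 by rewrite /lambda_y /transition ge_min lexx.
have eL0 : 0 <= eps * L by apply: mulr_ge0; exact: ltW.
have w1 : 0 <= rho / mesh_beta1 P by apply: divr_ge0; exact: ltW.
have w2 : 0 <= rho / mesh_beta2 P by apply: divr_ge0; exact: ltW.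
have lxL : lambda_x P N eps <= width_const P * (eps * L).
  have -> : lambda_x P N eps = rho / mesh_beta1 P * (eps * L) by rewrite lxE; ring.
  by apply: ler_wpM2r => //; rewrite lerDl.
have lyL : lambda_y P N eps <= width_const P * (eps * L).
  have -> : lambda_y P N eps = rho / mesh_beta2 P * (eps * L) by rewrite lyE; ring.
  by apply: ler_wpM2r => //; rewrite lerDr.
have over (x s : R) : x / n <= s -> x <= n * s by rewrite ler_pdivrMr// mulrC.
have sn0 : 0 < Num.sqrt n by rewrite sqrtr_gt0.
have kb : k * L <= n * sb by apply: over; rewrite mulrAC.
have ke : k * L <= n * se by apply: over; rewrite mulrAC.
have knb : k <= n * sb by exact: over.
have kne : k <= n * se.
  apply: over; apply: le_trans he2; apply: ler_wpM2l; first exact: ltW.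
  exact: powR_three_quarter_ge.
have kee : k <= n * Num.sqrt n * se ^+ 2.
  have h : (k * n `^ (- (3 / 4))) ^+ 2 <= se ^+ 2.
    by rewrite ler_sqr ?nnegrE ?(ltW se0)//; apply: mulr_ge0; [exact: ltW|exact: powR_ge0].
  have m0 : 0 <= n * Num.sqrt n by apply: mulr_ge0; exact: ltW.
  apply: le_trans (ler_wpM2l m0 h); rewrite exprMn mulrCA powR_three_quarter// mulr1.
  by rewrite expr2; apply: ler_peMl k1; exact: ltW.
have eh0 : 0 < epshat_s N eps modified by apply: lt_le_trans eps0 (epshat_s_ge _ _ _).
have epsn : eps * n <= 1 by rewrite -ler_pdivlMr// div1r.
have eps_eh : n * epshat_s N eps modified <= 1.
  rewrite /epshat_s; case: (modified); last by rewrite mulrC.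
  rewrite mulrC -ler_pdivlMr// div1r ge_max epsN /= -/n powRN powR_three_half//.
  rewrite lef_pV2 ?posrE ?mulr_gt0//; apply: ler_peMr; first exact: ltW.
  by rewrite -[leLHS]sqrtr1; exact: ler_wsqrtr.
have hcase : (k <= Num.sqrt n * se) \/
    (k <= Num.sqrt (epshat_s N eps modified) * (n * Num.sqrt n) * se).
  move: he3; rewrite /sigma_eta_star -/n !powRN powR_three_half// !powR_half ?(ltW eh0) ?(ltW n0)//.
  case: ifP => _ h; [left|right].
    by rewrite mulrC -ler_pdivrMr.
  have se0' : 0 < Num.sqrt (epshat_s N eps modified) by rewrite sqrtr_gt0.
  by move: h; rewrite -mulrA -invfM ler_pdivrMr ?mulr_gt0// mulrC.
have hcd : c P * (Cstar P * n^-1) <= 1 / 2.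
  have i0 : (0 < N)%N := N0.
  have := hdK (Ordinal i0, Ordinal i0, false); rewrite delta_K_tri// /tri_delta /coarse /=.
  by rewrite half_gt0 N1.
have streamline : eps + Cstar P * n^-1 * bnorm P ^+ 2 <= bnorm P / 4 * sb.
  have hM := delta_M_ge Cs0 lx2 ly2.
  have b2 := sqr_ge0 (bnorm P).
  have d0 : 0 <= Cstar P * n^-1 by apply: mulr_ge0; [exact: ltW|rewrite invr_ge0 ltW].
  have h1 : k * (eps + Cstar P * n^-1) <= sb.
    by apply: le_trans hb1; apply: ler_wpM2l; [exact: ltW|rewrite lerD2l].
  have h2 : 4 * (1 + bnorm P ^+ 2) <= bnorm P * k.
    by rewrite [leRHS]mulrC -ler_pdivrMr//; exact: le_trans Kb kk.
  have x0 : 0 <= eps + Cstar P * n^-1 by apply: addr_ge0 => //; exact: ltW.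
  have h3 := ler_wpM2l (ltW b0) h1; have h4 := ler_wpM2r x0 h2.
  have h5 := mulr_ge0 (ltW eps0) b2.
  by clear -h3 h4 h5 d0 eps0; lra.
have crosswind : 4 * epshat_s N eps modified <= c P * se ^+ 2.
  have hM : epshat_s N eps modified <= epshat_M P N eps modified by exact: epshat_M_ge.
  have h1 : k * Num.sqrt (epshat_s N eps modified) <= se.
    by apply: le_trans he1; apply: ler_wpM2l; [exact: ltW|exact: ler_wsqrtr].
  have h2 : k ^+ 2 * epshat_s N eps modified <= se ^+ 2.
    have -> : k ^+ 2 * epshat_s N eps modified = (k * Num.sqrt (epshat_s N eps modified)) ^+ 2.
      by rewrite exprMn sqr_sqrtr// ltW.
    rewrite ler_sqr ?nnegrE ?(ltW se0)//; apply: mulr_ge0; [exact: ltW|exact: sqrtr_ge0].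
  have h3 : 4 <= c P * k by rewrite mulrC -ler_pdivrMr//; exact: le_trans Kc kk.
  apply: le_trans (ler_wpM2l (ltW c0) h2); rewrite mulrA; apply: ler_wpM2r; first exact: ltW.
  by rewrite expr2 mulrA; apply: le_trans h3 _; apply: ler_peMr => //; apply: mulr_ge0; exact: ltW.
have k16 : 16 <= k by apply: le_trans k32; rewrite ler_nat.
have sbn := le_trans k16 knb; have sen := le_trans k16 kne.
have k4 : 4 * (width_const P + 4) <= k by exact: le_trans K4 kk.
have [q Gq] := in_VN_pieces N0 evN lx0 lx2 ly0 ly2 green.1.
have GO := green_boundary green.
have WE : W ^+ 2 = _ := norm_weighted_sum modified N0 evN eps0 lx0 lx2 ly0 ly2 b0 c0 Cs0 xst sb0 se0 Gq.
have W0 : 0 <= W by exact: sqrtr_ge0.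
have W8 : W ^+ 2 <= 8 * G xst.
  rewrite WE; exact: (weighted_energy_le N0 evN eps0 lx0 lx2 ly0 ly2 b0 c0 Cs0 sb0 se0 sbn sen L2
    (ltW w0) k4 k32 kb ke epsn lxL lyL eps_eh knb kne kee hcase hcd streamline crosswind
    (error_const_small HP kk) green node Gq).
have s8 : 0 <= Num.sqrt 8 :> R by exact: sqrtr_ge0.
have [i [j xE]] := node; rewrite /mesh_x /mesh_y in xE.
have iN : (i <= N)%N by rewrite -ltnS.
have jN : (j <= N)%N by rewrite -ltnS.
have [[]] := nodeO; rewrite xE /= !in_itv /= => /andP[x0 x1] /andP[y0 y1] nxy.
have i0 := mesh_gt0_pos x0; have j0 := mesh_gt0_pos y0.
set X1 := 2048 * energy_const P; set X2 := 4096 * energy_const P * width_const P.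
have X10 : 0 <= X1 by apply: mulr_ge0 (ltW CW0); exact: ler0n.
have X20 : 0 <= X2 by apply: mulr_ge0 (ltW w0); apply: mulr_ge0 (ltW CW0); exact: ler0n.
split.
- exact: (norm_MSD_le modified N0 evN eps0 lx0 lx2 ly0 ly2 b0 c0 Cs0 xst sb0 se0 Gq).
- case=> hx hy; move: hx hy; rewrite /= !in_itv /= => /andP[_ hx] /andP[_ hy].
  have hi : (0 < i <= N./2)%N by rewrite i0 (mesh_le_half N0 evN lx0 lx2 hx).
  have hj : (0 < j <= N./2)%N by rewrite j0 (mesh_le_half N0 evN ly0 ly2 hy).
  have := node_coarse_bound modified N0 evN eps0 lx0 lx2 ly0 ly2 b0 c0 Cs0 sb0 se0 sbn sen Gq hi hj xE.
  rewrite -WE -/X1 => h.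
  have Xn : 0 <= X1 * n ^+ 2 * sb.
    by apply: mulr_ge0 (ltW sb0); apply: mulr_ge0 => //; exact: sqr_ge0.
  have := quadratic_bound W0 Xn W8 h.
  rewrite (sqrtrM sb (mulr_ge0 X10 (sqr_ge0 n))) (sqrtrM (n ^+ 2) X10) sqrtr_sqr (gtr0_norm n0).
  move=> hW; apply: (le_trans (ler_wpM2l s8 hW)).
  have y0' : 0 <= Num.sqrt 8 * 8 * (n * Num.sqrt sb).
    by apply: mulr_ge0; [apply: mulr_ge0 => //; exact: ler0n|apply: mulr_ge0; [exact: ltW|exact: sqrtr_ge0]].
  have := mulr_ge0 y0' (sqrtr_ge0 X2).
  rewrite /C_const -/X1 -/X2 => m; clear -m; lra.
- have layer : G xst ^+ 2 <= X2 * L * n * W ^+ 2 ->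
      Num.sqrt 8 * W <= C_const P * Num.sqrt n * Num.sqrt L.
    move=> h; have Xn : 0 <= X2 * L * n.
      by apply: mulr_ge0 (ltW n0); apply: mulr_ge0 (ltW L0).
    have := quadratic_bound W0 Xn W8 h.
    rewrite (sqrtrM n (mulr_ge0 X20 (ltW L0))) (sqrtrM L X20).
    move=> hW; apply: (le_trans (ler_wpM2l s8 hW)).
    have y0' : 0 <= Num.sqrt 8 * 8 * (Num.sqrt n * Num.sqrt L).
      by apply: mulr_ge0; [apply: mulr_ge0 => //; exact: ler0n|apply: mulr_ge0; exact: sqrtr_ge0].
    have := mulr_ge0 y0' (sqrtr_ge0 X1).
    rewrite /C_const -/X1 -/X2 => m; clear -m; lra.
  case=> -[hx hy]; move: hx hy; rewrite /= !in_itv /= => /andP[hx1 hx2] /andP[hy1 hy2]; apply: layer.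
  + have hi : (N./2 <= i <= N)%N by rewrite iN (mesh_ge_half N0 evN lx0 lx2 hx1).
    have hj : (j < N./2)%N.
      apply: (mesh_lt_half N0 evN ly0 ly2); rewrite ltNge; apply/negP => h; apply: nxy.
      by split; rewrite /= in_itv /=; apply/andP; split => //; exact: ltW.
    have jN' : (j < N)%N by apply: (leq_trans hj); rewrite -[leqRHS](half_nat evN) leq_addr.
    have := node_x_bound modified N0 evN eps0 lx0 lx2 ly0 ly2 b0 c0 Cs0 xst sb0 se0 sbn sen L2
      (ltW w0) lxL Gq GO (j := Ordinal jN') hi hj.
    by rewrite -WE /= -xE.
  + have hj : (N./2 <= j <= N)%N by rewrite jN (mesh_ge_half N0 evN ly0 ly2 hy1).
    have hi : (i < N./2)%N.
      apply: (mesh_lt_half N0 evN lx0 lx2); rewrite ltNge; apply/negP => h; apply: nxy.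
      by split; rewrite /= in_itv /=; apply/andP; split => //; exact: ltW.
    have iN' : (i < N)%N by apply: (leq_trans hi); rewrite -[leqRHS](half_nat evN) leq_addr.
    have := node_y_bound modified N0 evN eps0 lx0 lx2 ly0 ly2 b0 c0 Cs0 xst sb0 se0 sbn sen L2
      (ltW w0) lyL Gq GO (i := Ordinal iN') hi hj.
    by rewrite -WE /= -xE.
Qed.
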